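(* Let $\mathcal{T}_*$ be any countable set of tiles in $\mathbb{R}^d$. Suppose that there exist a compactly supported $g \in L^2(\mathbb{R}^d)$, constants $A, B > 0$ and $\theta \in (0,1)$ such that $$A \leq \sum_{T \in \mathcal{T}_*} |\widehat{g}^T(\xi)|^2 \mathbf{1}_{(1-\theta)T}(\xi) \leq \sum_{T \in \mathcal{T}_*} |\widehat{g}^T(\xi)|^2 \leq B \qquad ( * )$$ for almost every $\xi \in \mathbb{R}^d$. Then for all sufficiently small $\epsilon > 0$ (with smallness threshold depending only on $A$, $B$, $\theta$, and $d$), there exists a compactly supported $\psi \in C^\infty(\mathbb{R}^d)$ such that $$(1-\epsilon) A \|f\|^2 \leq \sum_{T \in \mathcal{T}_*} \sum_{k \in \mathbb{Z}^d} |\langle f, \psi_{T,k}\rangle|^2 \leq (1+\epsilon) B \|f\|^2$$ for all $f \in L^2(\mathbb{R}^d)$. This $\psi$ may be taken to depend only on $g$, $A$, $B$, $\epsilon$, $\theta$, and $d$; in particular it can be defined independently of $\mathcal{T}_*$ (i.e. one and the same $\psi$ works for every countable set of tiles $\mathcal{T}_*$ satisfying $( * )$ with the given $g, A, B, \theta$).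
   Context: $|\cdot|$ denotes the $\ell^\infty$ norm on $\mathbb{R}^d$; $\|\cdot\|$ and $\langle\cdot,\cdot\rangle$ are the $L^2(\mathbb{R}^d)$ norm and inner product. The Fourier transform is $\widehat{f}(\xi) = \int_{\mathbb{R}^d} e^{-2\pi i x\cdot\xi} f(x)\,dx$ (extended to $L^2$). A tile is a pair $T = (D,\xi) \in GL_d(\mathbb{R}) \times \mathbb{R}^d$. Its tile set is $T_\square := \{\eta \in \mathbb{R}^d : |D^{-1}(\eta - \xi)| \leq \tfrac12\}$, and $\mathbf{1}_T$ denotes the indicator function of $T_\square$. For $t > 0$, $tT := (tD,\xi)$. For a function $\varphi$ on $\mathbb{R}^d$ and a tile $T = (D,\xi)$: $\varphi_{T,k}(x) := e^{2\pi i \xi\cdot x}\sqrt{|\det D|}\,\varphi(k + D^t x)$ for $x,k \in \mathbb{R}^d$, where $D^t$ is the transpose of $D$; and $\varphi^T(\xi') := \varphi(D^{-1}(\xi'-\xi))$ for $\xi' \in \mathbb{R}^d$. The notation $\widehat{g}^T$ means $(\widehat{g})^T$. *)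

(* Defs.v *)
From HB Require Import structures.
From mathcomp Require Import all_boot all_order all_algebra.
From mathcomp Require Import complex.
From mathcomp Require Import all_classical all_reals all_analysis.

Set Implicit Arguments.
Unset Strict Implicit.
Unset Printing Implicit Defensive.

Import Order.TTheory GRing.Theory Num.Theory.
Import numFieldNormedType.Exports.

Local Open Scope classical_set_scope.
Local Open Scope ring_scope.

(** Vectors of R^d are column vectors ['cV[R]_d]; the norm [`|x|] that the
    library puts on them is the l^infinity norm. The sigma-algebra is generated
    by the coordinates, i.e. it is the Borel sigma-algebra. *)

Definition cV_display : measure_display.
Proof. exact: default_measure_display. Qed.

Section measurable_cV.
Context (R : realType) (n : nat).

Definition cV_coord (i : 'I_n) (x : 'cV[R]_n) : R := x i 0.

Let cV_set0 : g_sigma_preimage cV_coord set0.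
Proof. exact: sigma_algebra0. Qed.

Let cV_setC A : g_sigma_preimage cV_coord A -> g_sigma_preimage cV_coord (~` A).
Proof. exact: sigma_algebraC. Qed.

Let cV_bigcup (F : (set 'cV[R]_n)^nat) :
  (forall i, g_sigma_preimage cV_coord (F i)) ->
  g_sigma_preimage cV_coord (\bigcup_i (F i)).
Proof. exact: sigma_algebra_bigcup. Qed.

HB.instance Definition _ :=
  @isMeasurable.Build cV_display
    'cV[R]_n (g_sigma_preimage cV_coord) cV_set0 cV_setC cV_bigcup.

End measurable_cV.

Section lebesgue_cV.
Context (R : realType).

Definition cV_cons n (p : R * 'cV[R]_n) : 'cV[R]_n.+1 :=
  @col_mx R 1 n 1 p.1%:M p.2.

Definition cV_uncons n (x : 'cV[R]_n.+1) : R * 'cV[R]_n :=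
  (x 0 0, @dsubmx R 1 n 1 x).

Lemma cV_consK n : cancel (@cV_cons n) (@cV_uncons n).
Proof.
case=> a x; rewrite /cV_uncons /cV_cons /= col_mxKd; congr pair.
rewrite (_ : 0 = lshift n (0 : 'I_1)); last exact/val_inj.
by rewrite (@col_mxEu R 1 n 1) mxE eqxx mulr1n.
Qed.

Lemma cV_unconsK n : cancel (@cV_uncons n) (@cV_cons n).
Proof.
move=> x; rewrite /cV_cons /cV_uncons /=.
have -> : (x 0 0)%:M = @usubmx R 1 n 1 x.
  apply/matrixP => i j; rewrite !ord1 !mxE eqxx mulr1n.
  by congr (x _ _); exact/val_inj.
exact: (@vsubmxK R 1 n 1).
Qed.

Lemma measurable_cV_coord n (i : 'I_n) :
  measurable_fun [set: 'cV[R]_n] (cV_coord i).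
Proof.
move=> _ Y mY; rewrite setTI; apply: sub_sigma_algebra => /=.
rewrite -bigcup_seq/=; exists i => /=; first by rewrite mem_index_enum.
by exists Y => //; rewrite setTI.
Qed.

Lemma measurable_fun_cVP d (T : measurableType d) n (f : T -> 'cV[R]_n) :
  (forall i, measurable_fun [set: T] (cV_coord i \o f)) ->
  measurable_fun [set: T] f.
Proof.
move=> mf _ A; rewrite setTI => mA.
suff: g_sigma_preimage (@cV_coord R n) `<=` [set B | measurable (f @^-1` B)].
  exact.
apply: smallest_sub; first split.
- by rewrite /= preimage_set0; exact: measurable0.
- move=> B mB /=; rewrite setTD preimage_setC; exact: measurableC.
- move=> F mF /=; rewrite preimage_bigcup; by apply: bigcup_measurable => k _; exact: mF.
rewrite -bigcup_seq => B [i _ [C mC <-]] /=.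
by rewrite setTI -comp_preimage -[X in measurable X]setTI; exact: mf.
Qed.

Lemma measurable_cV_cons n : measurable_fun setT (@cV_cons n).
Proof.
apply: measurable_fun_cVP => i; case: (@splitP 1 n i) => j ij.
  rewrite (_ : _ \o _ = fst); first exact: measurable_fst.
  apply/funext => -[a x] /=; rewrite /cV_coord /cV_cons.
  have -> : i = lshift n j :> 'I_(1 + n) by exact/val_inj.
  by rewrite (@col_mxEu R 1 n 1) !ord1 mxE eqxx mulr1n.
rewrite (_ : _ \o _ = cV_coord j \o snd).
  exact: measurableT_comp (measurable_cV_coord j) measurable_snd.
apply/funext => -[a x] /=; rewrite /cV_coord /cV_cons.
have -> : i = rshift 1 j :> 'I_(1 + n) by exact/val_inj.
by rewrite (@col_mxEd R 1 n 1).
Qed.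

Lemma measurable_cV_uncons n : measurable_fun setT (@cV_uncons n).
Proof.
apply: measurable_fun_pair; first exact: (measurable_cV_coord (0 : 'I_n.+1)).
apply: measurable_fun_cVP => i.
rewrite (_ : _ \o _ = cV_coord (rshift 1 i : 'I_n.+1)).
  exact: measurable_cV_coord.
by apply/funext => x /=; rewrite /cV_coord mxE.
Qed.

Section step.
Context n (mu : {sigma_finite_measure set 'cV[R]_n -> \bar R}).

Definition lebesgue_cV_step : set 'cV[R]_n.+1 -> \bar R :=
  pushforward (@lebesgue_measure R \x mu)%E (@cV_cons n).

Let step0 : lebesgue_cV_step set0 = 0%E.
Proof. by rewrite /lebesgue_cV_step /pushforward preimage_set0 measure0. Qed.

Let step_ge0 A : (0 <= lebesgue_cV_step A)%E.
Proof. by rewrite /lebesgue_cV_step /pushforward; exact: measure_ge0. Qed.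

Let step_sigma_additive : semi_sigma_additive lebesgue_cV_step.
Proof.
move=> F mF tF mUF; rewrite /lebesgue_cV_step /pushforward preimage_bigcup.
apply: measure_semi_sigma_additive.
- by move=> k; rewrite -[X in measurable X]setTI; exact: measurable_cV_cons.
- apply/trivIsetP => /= i j _ _ ij; rewrite -preimage_setI.
  by move/trivIsetP : tF => /(_ _ _ _ _ ij) ->//; rewrite preimage_set0.
- rewrite -preimage_bigcup -[X in measurable X]setTI.
  exact: measurable_cV_cons.
Qed.

HB.instance Definition _ := isMeasure.Build _ _ _
  lebesgue_cV_step step0 step_ge0 step_sigma_additive.

Let step_sigma_finite : sigma_finite setT lebesgue_cV_step.
Proof.
have /sigma_finiteP[F [TF ndF Foo]] := sigma_finiteT (@lebesgue_measure R).
have /sigma_finiteP[G [TG ndG Goo]] := sigma_finiteT mu.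
exists (fun k => @cV_uncons n @^-1` (F k `*` G k)).
  apply/esym; rewrite -subTset => x _.
  have [k _ Fx] : (\bigcup_k F k) (cV_uncons x).1 by rewrite -TF.
  have [m _ Gx] : (\bigcup_k G k) (cV_uncons x).2 by rewrite -TG.
  exists (maxn k m) => //; split => /=.
  - by move: Fx; exact/subsetPset/ndF/leq_maxl.
  - by move: Gx; exact/subsetPset/ndG/leq_maxr.
move=> k; have [mF ?] := Foo k; have [mG ?] := Goo k; split.
  rewrite -[X in measurable X]setTI; apply: measurable_cV_uncons => //.
  exact: measurableX.
rewrite /lebesgue_cV_step /pushforward -comp_preimage.
rewrite (_ : _ \o _ = id); last by apply/funext => p; exact: cV_consK.
by rewrite preimage_id product_measure1E// lte_mul_pinfty// ge0_fin_numE.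
Qed.

HB.instance Definition _ := Measure_isSigmaFinite.Build _ _ _
  lebesgue_cV_step step_sigma_finite.

End step.

(** d-dimensional Lebesgue measure, as the d-fold product of [lebesgue_measure]
    (unit mass on the single point of R^0). *)
Fixpoint lebesgue_cV n : {sigma_finite_measure set 'cV[R]_n -> \bar R} :=
  match n with
  | 0 => \d_(0 : 'cV[R]_0)
  | m.+1 => lebesgue_cV_step (lebesgue_cV m)
  end.

End lebesgue_cV.

Section tiles.
Context (R : realType) (d : nat).
Implicit Types (f g : 'cV[R]_d -> R[i]) (x y xi : 'cV[R]_d).

Local Notation mu := (lebesgue_cV R d).

Definition cabs (z : R[i]) : R := Normc.normc z.

Definition expi (t : R) : R[i] := Complex (cos t) (sin t).

Definition dotp x y : R := \sum_(i < d) x i 0 * y i 0.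

Definition cintegral f : R[i] :=
  Complex (\int[mu]_x complex.Re (f x))%R (\int[mu]_x complex.Im (f x))%R.

Definition L2norm_sqr f : \bar R := (\int[mu]_x (cabs (f x) ^+ 2)%:E)%E.

(** Functions in L^2(R^d) are given by Borel representatives. *)
Definition in_L2 f : Prop :=
  [/\ measurable_fun setT (fun x => complex.Re (f x)),
      measurable_fun setT (fun x => complex.Im (f x))
    & (L2norm_sqr f < +oo)%E].

Definition inner f g : R[i] := cintegral (fun x => f x * conjc (g x)).

(** The integral converges absolutely for f in L^1, in particular for f in L^2
    with compact support, where it agrees with the extension of the transform
    to L^2. *)
Definition fourier f xi : R[i] :=
  cintegral (fun x => expi (- (2 * pi * dotp x xi)) * f x).

Definition ess_compact_support f : Prop :=
  exists2 K : set 'cV[R]_d, compact K & {ae mu, forall x, ~ K x -> f x = 0}.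

Definition compact_support f : Prop := compact (closure [set x | f x != 0]).

Definition partial (i : 'I_d) (u : 'cV[R]_d -> R) : 'cV[R]_d -> R :=
  fun x => 'D_(delta_mx i 0) u x.

(** C^infinity, through the iterated partial derivatives along the coordinate
    directions; the empty sequence gives u itself. *)
Definition smooth_real (u : 'cV[R]_d -> R) : Prop :=
  forall s : seq 'I_d,
    continuous (foldr partial u s) /\
    forall i x, derivable (foldr partial u s) x (delta_mx i 0).

Definition smooth f : Prop :=
  smooth_real (fun x => complex.Re (f x)) /\
  smooth_real (fun x => complex.Im (f x)).

(** A tile (D, xi) is a bare pair; the condition D in GL_d(R) is kept apart as
    [is_tile], so that tiles can be rescaled without carrying a proof. *)
Definition tile : Type := ('M[R]_d * 'cV[R]_d)%type.

Definition is_tile (T : tile) : Prop := T.1 \in unitmx.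

Definition tile_set (T : tile) : set 'cV[R]_d :=
  [set eta | `|invmx T.1 *m (eta - T.2)| <= 2^-1].

Definition scale_tile (t : R) (T : tile) : tile := (t *: T.1, T.2).

(** phi_(T,k); the shift k is a real vector, integer k being cast. *)
Definition wave (phi : 'cV[R]_d -> R[i]) (T : tile) (k x : 'cV[R]_d) : R[i] :=
  expi (2 * pi * dotp T.2 x) * (Num.sqrt `|\det T.1|)%:C%C
    * phi (k + T.1^T *m x).

(** phi^T *)
Definition adapt (phi : 'cV[R]_d -> R[i]) (T : tile) : 'cV[R]_d -> R[i] :=
  fun xi => phi (invmx T.1 *m (xi - T.2)).

Definition covering_condition (Ts : set tile) g (A B theta : R) : Prop :=
  {ae mu, forall xi,
    [/\ (A%:E <= \esum_(T in Ts) (cabs (adapt (fourier g) T xi) ^+ 2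
                    * \1_(tile_set (scale_tile (1 - theta) T)) xi)%:E)%E,
        (\esum_(T in Ts) (cabs (adapt (fourier g) T xi) ^+ 2
            * \1_(tile_set (scale_tile (1 - theta) T)) xi)%:E
         <= \esum_(T in Ts) (cabs (adapt (fourier g) T xi) ^+ 2)%:E)%E
      & (\esum_(T in Ts) (cabs (adapt (fourier g) T xi) ^+ 2)%:E <= B%:E)%E]}.

Definition frame_sum (Ts : set tile) psi f : \bar R :=
  (\esum_(T in Ts) \esum_(k in [set: 'cV[int]_d])
    (cabs (inner f (wave psi T (map_mx intr k))) ^+ 2)%:E)%E.

End tiles.

(* Main.v *)
Require Import Defs.
From HB Require Import structures.
From mathcomp Require Import all_boot all_order all_algebra.
From mathcomp Require Import complex.
From mathcomp Require Import all_classical all_reals all_analysis.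
From mathcomp Require Import measurable_realfun.
From mathcomp Require Import ring lra.

Import Order.TTheory GRing.Theory Num.Theory.
Import numFieldNormedType.Exports.

Local Open Scope classical_set_scope.
Local Open Scope ring_scope.

Set Implicit Arguments.
Unset Strict Implicit.
Unset Printing Implicit Defensive.

(* [psi] is [g] convolved with a product kernel, so that its transform is the transform of
   [g] times [h u = \prod_i eta (u i)], where [|h| <= 1], [|h|] is close to 1 on the cube
   [|u| <= (1 - theta) / 2], and [|h|] is small, with quadratic decay in every coordinate,
   outside the unit cube [Q]. For a tile (D, xi), Plancherel and the substitution
   D u + xi turn the inner products of [f] with the waves into |det D|^(1/2) times the
   Fourier coefficients of [H u = f^(D u + xi) * conj (g^ u * h u)]. The part of [H] over
   [Q] is treated by Parseval; the translates [Q + m], m <> 0, only contribute a small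
   multiple of the norm of f^ g^. Integrating the covering condition against |f^|^2 gives
   both bounds for compactly supported [f], and truncation gives the general case.

   Plancherel for compactly supported functions comes from Parseval on [Q], by averaging
   over all shifts of the integer lattice. The factor [eta] is the transform of a finite
   combination of translates of a bump: a trigonometric polynomial close to the indicator
   of an interval, times the transform of the bump. *)

(** * Complex numbers and complex-valued integrals *)

(** The obstacle: a compactly supported [psi] has a transform that spills out of every cube, so the
    lattice coefficients of [H] alias and the translates [Q + m] cannot be dropped. As [psi] is a
    convolution with [g], in each translate [|H|] is at most a small weight [W m] times [|f^ g^|],
    whatever [g] is. After summation over the tiles the error is thus measured by the sum without
    cut-off, which [B] controls, while the main term is the sum cut off to the shrunken tiles, which
    [A] bounds from below. Hence a tolerance [Dl] of order eps A / (A + B), and an [h] built from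
    [Dl], [theta] and the dimension alone, which makes [psi] independent of the tiles. The gap left
    by [theta] is where [h] falls from about 1 to about 0. A trigonometric polynomial produces this
    fall because it is the transform of finitely many point masses, so supports stay compact; being
    periodic it rises again, and the transform of the bump must take over before that. Quadratic
    decay makes the sum of the weights over all [m <> 0] converge. *)

Section cabs.
Context {R : realType}.
Implicit Types z w : R[i].

Lemma cabs_sqr z : cabs z ^+ 2 = complex.Re z ^+ 2 + complex.Im z ^+ 2.
Proof. by case: z => a b /=; rewrite /cabs /= sqr_sqrtr// addr_ge0// sqr_ge0. Qed.

Lemma cabs_ge0 z : 0 <= cabs z.
Proof. by case: z => a b; rewrite /cabs /= sqrtr_ge0. Qed.

Lemma cabs0 : cabs (0 : R[i]) = 0.
Proof. exact: Normc.normc0. Qed.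

Lemma cabs1 : cabs (1 : R[i]) = 1.
Proof. exact: Normc.normc1. Qed.

Lemma cabsM z w : cabs (z * w) = cabs z * cabs w.
Proof. exact: Normc.normcM. Qed.

Lemma cabsD z w : cabs (z + w) <= cabs z + cabs w.
Proof.
have : `|z + w| <= `|z| + `|w| by exact: ler_normD.
by rewrite !normc_def -!rmorphD /= lecR; case: z => a b; case: w.
Qed.

Lemma cabs_real (r : R) : cabs (r%:C%C) = `|r|.
Proof. by rewrite /cabs /= expr0n addr0 sqrtr_sqr. Qed.

Lemma cabs_conj z : cabs (conjc z) = cabs z.
Proof. by case: z => a b; rewrite /cabs /= sqrrN. Qed.

Lemma cabsN z : cabs (- z) = cabs z.
Proof. by case: z => a b; rewrite /cabs /= !sqrrN. Qed.

Lemma cabs_Re z : `|complex.Re z| <= cabs z.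
Proof.
rewrite -(@ler_pXn2r _ 2)// ?nnegrE ?cabs_ge0// cabs_sqr.
by rewrite real_normK ?num_real// lerDl sqr_ge0.
Qed.

Lemma cabs_Im z : `|complex.Im z| <= cabs z.
Proof.
rewrite -(@ler_pXn2r _ 2)// ?nnegrE ?cabs_ge0// cabs_sqr.
by rewrite real_normK ?num_real// lerDr sqr_ge0.
Qed.

Lemma cabs_ReIm z : cabs z <= `|complex.Re z| + `|complex.Im z|.
Proof.
rewrite -(@ler_pXn2r _ 2)// ?nnegrE ?cabs_ge0 ?addr_ge0// cabs_sqr.
rewrite sqrrD !real_normK ?num_real// -addrA lerD2l lerDr.
by rewrite mulrn_wge0// mulr_ge0.
Qed.

Lemma cabs_sum (I : Type) (s : seq I) (P : pred I) (F : I -> R[i]) :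
  cabs (\sum_(i <- s | P i) F i) <= \sum_(i <- s | P i) cabs (F i).
Proof.
elim/big_rec2 : _ => [|i x y _ h]; first by rewrite cabs0.
by rewrite (le_trans (cabsD _ _))// lerD2l.
Qed.

Lemma cabs_prod (I : Type) (s : seq I) (P : pred I) (F : I -> R[i]) :
  cabs (\prod_(i <- s | P i) F i) = \prod_(i <- s | P i) cabs (F i).
Proof. exact: (big_morph (@cabs R) cabsM cabs1). Qed.

Lemma conjcM z w : conjc (z * w) = conjc z * conjc w.
Proof. by rewrite rmorphM. Qed.

Lemma conjcD z w : conjc (z + w) = conjc z + conjc w.
Proof. by rewrite rmorphD. Qed.

Lemma conjc_sum (I : Type) (s : seq I) (P : pred I) (F : I -> R[i]) :
  conjc (\sum_(i <- s | P i) F i) = \sum_(i <- s | P i) conjc (F i).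
Proof. by rewrite rmorph_sum. Qed.

Lemma mul_conjc z : z * conjc z = (cabs z ^+ 2)%:C%C.
Proof. by rewrite cabs_sqr; case: z => a b /=; congr Complex; ring. Qed.

Lemma ReD z w : complex.Re (z + w) = complex.Re z + complex.Re w.
Proof. by case: z; case: w. Qed.
Lemma ImD z w : complex.Im (z + w) = complex.Im z + complex.Im w.
Proof. by case: z; case: w. Qed.
Lemma ReN z : complex.Re (- z) = - complex.Re z. Proof. by case: z. Qed.
Lemma ImN z : complex.Im (- z) = - complex.Im z. Proof. by case: z. Qed.
Lemma ReM z w : complex.Re (z * w) =
  complex.Re z * complex.Re w - complex.Im z * complex.Im w.
Proof. by case: z; case: w. Qed.
Lemma ImM z w : complex.Im (z * w) =
  complex.Re z * complex.Im w + complex.Im z * complex.Re w.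
Proof. by case: z; case: w => a b c d /=; ring. Qed.
Lemma Re_conjc z : complex.Re (conjc z) = complex.Re z. Proof. by case: z. Qed.
Lemma Im_conjc z : complex.Im (conjc z) = - complex.Im z. Proof. by case: z. Qed.
Lemma ReZ (r : R) z : complex.Re (r%:C%C * z) = r * complex.Re z.
Proof. by rewrite ReM /= mul0r subr0. Qed.
Lemma ImZ (r : R) z : complex.Im (r%:C%C * z) = r * complex.Im z.
Proof. by rewrite ImM /= mul0r addr0. Qed.

Lemma Cext z w : complex.Re z = complex.Re w -> complex.Im z = complex.Im w -> z = w.
Proof. by case: z; case: w => ? ? ? ? /= -> ->. Qed.

(** Young's inequality on the cross term. The free parameter matters: [s = Dl] in the estimates for
    one tile, and [s] tending to 0 when general [f] is truncated. *)
Lemma cabs_sqrD (s : R) z w : 0 < s ->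
  cabs (z + w) ^+ 2 <= (1 + s) * cabs z ^+ 2 + (1 + s^-1) * cabs w ^+ 2.
Proof.
move=> s0; rewrite !cabs_sqr ReD ImD.
have key (a b : R) : (a + b) ^+ 2 <= (1 + s) * a ^+ 2 + (1 + s^-1) * b ^+ 2.
  rewrite -subr_ge0.
  have -> : (1 + s) * a ^+ 2 + (1 + s^-1) * b ^+ 2 - (a + b) ^+ 2 =
     s * (a - s^-1 * b) ^+ 2 by field; rewrite gt_eqF.
  by rewrite mulr_ge0 ?sqr_ge0// ltW.
have := key (complex.Re z) (complex.Re w).
have := key (complex.Im z) (complex.Im w).
lra.
Qed.

Lemma expiD (a b : R) : expi (a + b) = expi a * expi b.
Proof. by apply: Cext; rewrite /= ?cosD ?sinD//; ring. Qed.

Lemma expi0 : expi 0 = 1 :> R[i].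
Proof. by rewrite /expi cos0 sin0. Qed.

Lemma conjc_expi (a : R) : conjc (expi a) = expi (- a).
Proof. by rewrite /expi /= cosN sinN. Qed.

Lemma cabs_expi (a : R) : cabs (expi a) = 1.
Proof.
apply/eqP; rewrite -(@eqrXn2 _ 2)// ?cabs_ge0// cabs_sqr /= cos2Dsin2.
by rewrite expr1n.
Qed.

Lemma expi_2pin (n : nat) : expi (2 * pi * n%:R) = 1 :> R[i].
Proof.
elim: n => [|n IH]; first by rewrite mulr0 expi0.
rewrite -(addn1 n) natrD mulrDr mulr1 expiD IH mul1r /expi.
by rewrite (mulrC 2) mulr_natr cos2pi sin2pi.
Qed.

Lemma expi_2piz (n : int) : expi (2 * pi * n%:~R) = 1 :> R[i].
Proof.
case: n => n; first exact: expi_2pin.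
rewrite NegzE intrN mulrN -conjc_expi expi_2pin.
by apply: Cext => //=; rewrite oppr0.
Qed.

Lemma norm_sin_le (x : R) : `|sin x| <= `|x|.
Proof.
wlog x0 : x / 0 <= x.
  move=> h; have [|x0] := leP 0 x; first exact: h.
  by rewrite -normrN -sinN -[in leRHS]normrN h// oppr_ge0 ltW.
have [->|xn0] := eqVneq x 0; first by rewrite sin0.
have xgt0 : 0 < x by rewrite lt_neqAle eq_sym xn0.
have [] := @MVT R sin cos 0 x xgt0.
- by apply: derivable_within_continuous => y _; exact: ex_derive.
move=> c _; rewrite sin0 !subr0 => ->; rewrite normrM ler_piMl//.
by rewrite ler_norml cos_geN1 cos_le1.
Qed.

(** The chord from 1 to [expi x] has length [2 |sin (x / 2)|]. *)
Lemma cabs_expi_sub1 (x : R) : cabs (expi x - 1) <= `|x|.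
Proof.
rewrite -(@ler_pXn2r _ 2)// ?nnegrE ?cabs_ge0// cabs_sqr.
rewrite /expi /= oppr0 addr0 real_normK ?num_real//.
have -> : (cos x - 1) ^+ 2 + sin x ^+ 2 = (2 * sin (x / 2)) ^+ 2.
  have xE : x = (x / 2) + (x / 2) by field.
  have c : cos (x / 2) ^+ 2 = 1 - sin (x / 2) ^+ 2.
    by have := cos2Dsin2 (x / 2); lra.
  rewrite {1 2}xE cosD sinD -expr2 c.
  have -> : (sin (x / 2) * cos (x / 2) + cos (x / 2) * sin (x / 2)) ^+ 2 =
    4 * sin (x / 2) ^+ 2 * cos (x / 2) ^+ 2 by ring.
  by rewrite c; ring.
rewrite -[leLHS]real_normK ?num_real// -[leRHS]real_normK ?num_real//.
rewrite ler_pXn2r ?nnegrE// normrM.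
have := norm_sin_le (x / 2); rewrite normrM.
rewrite (ger0_norm (_ : 0 <= 2^-1))// (ger0_norm (_ : 0 <= 2))//; lra.
Qed.

End cabs.

(** * Measurability of complex-valued functions *)

Section cmeas.
Context {R : realType} {d : measure_display} {T : measurableType d}.
Implicit Types (f g : T -> R[i]).

Definition cmeas f := measurable_fun setT (fun x => complex.Re (f x)) /\
  measurable_fun setT (fun x => complex.Im (f x)).

Lemma cmeasD f g : cmeas f -> cmeas g -> cmeas (fun x => f x + g x).
Proof.
move=> [f1 f2] [g1 g2]; split.
- under eq_fun do rewrite ReD; exact: measurable_funD.
- under eq_fun do rewrite ImD; exact: measurable_funD.
Qed.

Lemma cmeasN f : cmeas f -> cmeas (fun x => - f x).
Proof.
move=> [f1 f2]; split.
- under eq_fun do rewrite ReN; exact: measurable_funN.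
- under eq_fun do rewrite ImN; exact: measurable_funN.
Qed.

Lemma cmeasM f g : cmeas f -> cmeas g -> cmeas (fun x => f x * g x).
Proof.
move=> [f1 f2] [g1 g2]; split.
- by under eq_fun do rewrite ReM; apply: measurable_funB; exact: measurable_funM.
- by under eq_fun do rewrite ImM; apply: measurable_funD; exact: measurable_funM.
Qed.

Lemma cmeas_cst (z : R[i]) : cmeas (fun=> z).
Proof. by split; exact: measurable_cst. Qed.

Lemma cmeas_conj f : cmeas f -> cmeas (fun x => conjc (f x)).
Proof.
move=> [f1 f2]; split.
- by under eq_fun do rewrite Re_conjc.
- under eq_fun do rewrite Im_conjc; exact: measurable_funN.
Qed.

Lemma cmeas_real (h : T -> R) : measurable_fun setT h -> cmeas (fun x => (h x)%:C%C).
Proof. by move=> mh; split => //=; exact: measurable_cst. Qed.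

Lemma cmeas_expi (h : T -> R) : measurable_fun setT h -> cmeas (fun x => expi (h x)).
Proof.
move=> mh; split => /=.
- apply: (measurableT_comp _ mh); apply: continuous_measurable_fun.
  exact: continuous_cos.
- apply: (measurableT_comp _ mh); apply: continuous_measurable_fun.
  exact: continuous_sin.
Qed.

Lemma cmeas_comp d' (T' : measurableType d') (h : T' -> T) f :
  measurable_fun setT h -> cmeas f ->
  measurable_fun setT (fun x => complex.Re (f (h x))) /\
  measurable_fun setT (fun x => complex.Im (f (h x))).
Proof.
by move=> mh [f1 f2]; split; [exact: (measurableT_comp f1)|exact: (measurableT_comp f2)].
Qed.

Lemma cmeas_sum (I : Type) (s : seq I) (P : pred I) (F : I -> T -> R[i]) :
  (forall i, cmeas (F i)) -> cmeas (fun x => \sum_(i <- s | P i) F i x).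
Proof.
move=> mF; elim: s => [|i s IH].
  under eq_fun do rewrite big_nil; exact: cmeas_cst.
under eq_fun do rewrite big_cons.
by case: (P i) => //; exact: cmeasD.
Qed.

Lemma cmeas_prod (I : Type) (s : seq I) (P : pred I) (F : I -> T -> R[i]) :
  (forall i, cmeas (F i)) -> cmeas (fun x => \prod_(i <- s | P i) F i x).
Proof.
move=> mF; elim: s => [|i s IH].
  under eq_fun do rewrite big_nil; exact: cmeas_cst.
under eq_fun do rewrite big_cons.
by case: (P i) => //; exact: cmeasM.
Qed.

Lemma measurable_cabs_sqr f : cmeas f -> measurable_fun setT (fun x => cabs (f x) ^+ 2).
Proof.
move=> [f1 f2]; under eq_fun do rewrite cabs_sqr.
by apply: measurable_funD; exact: measurable_funX.
Qed.

Lemma measurable_cabs f : cmeas f -> measurable_fun setT (fun x => cabs (f x)).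
Proof.
move=> mf; have h x : cabs (f x) = Num.sqrt (cabs (f x) ^+ 2).
  by rewrite sqrtr_sqr ger0_norm ?cabs_ge0.
under eq_fun do rewrite h.
apply: (measurableT_comp _ (measurable_cabs_sqr mf)).
by apply: continuous_measurable_fun; exact: sqrt_continuous.
Qed.

Lemma cmeas_indic (A : set T) : measurable A -> cmeas (fun x => (\1_A x)%:C%C).
Proof. by move=> mA; apply: cmeas_real; exact: measurable_indic. Qed.

End cmeas.

(** * Complex-valued integrals and square norms over an arbitrary measure *)

Section cI.
Context {R : realType} {d : measure_display} {T : measurableType d}.
Variable mu : {measure set T -> \bar R}.
Implicit Types (f g : T -> R[i]).

(** [cintegral] over an arbitrary measure; for [lebesgue_cV] the two are convertible, so that
    [fourier] and [inner] unfold to it. *)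
Definition cI f : R[i] :=
  Complex (\int[mu]_x complex.Re (f x))%R (\int[mu]_x complex.Im (f x))%R.

Definition cint f := cmeas f /\ (\int[mu]_x (cabs (f x))%:E < +oo)%E.

Lemma le_cint f (h : T -> R) : cmeas f -> (forall x, cabs (f x) <= h x) ->
  measurable_fun setT h -> (\int[mu]_x (h x)%:E < +oo)%E -> cint f.
Proof.
move=> mf fh mh hoo; split => //; apply: le_lt_trans hoo.
apply: ge0_le_integral => //=.
- by move=> x _; rewrite lee_fin cabs_ge0.
- by apply/measurable_EFinP; exact: measurable_cabs.
- exact/measurable_EFinP.
- by move=> x _; rewrite lee_fin.
Qed.

Lemma cint_Re f : cint f -> mu.-integrable setT (EFin \o (fun x => complex.Re (f x))).
Proof.
move=> [mf foo]; apply/integrableP; split.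
  by apply/measurable_EFinP; exact: mf.1.
apply: le_lt_trans foo; apply: ge0_le_integral => //=.
- apply/measurable_EFinP; apply: measurableT_comp => //; exact: mf.1.
- by apply/measurable_EFinP; exact: measurable_cabs.
- by move=> x _; rewrite lee_fin cabs_Re.
Qed.

Lemma cint_Im f : cint f -> mu.-integrable setT (EFin \o (fun x => complex.Im (f x))).
Proof.
move=> [mf foo]; apply/integrableP; split.
  by apply/measurable_EFinP; exact: mf.2.
apply: le_lt_trans foo; apply: ge0_le_integral => //=.
- apply/measurable_EFinP; apply: measurableT_comp => //; exact: mf.2.
- by apply/measurable_EFinP; exact: measurable_cabs.
- by move=> x _; rewrite lee_fin cabs_Im.
Qed.

Lemma cint_mulb f g (M : R) : cmeas f -> (forall x, cabs (f x) <= M) ->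
  cint g -> cint (fun x => f x * g x).
Proof.
move=> mf fM [mg goo].
(* A negative bound is possible only on an empty type, where every integral is 0. *)
have [M0|M0] := leP 0 M; last first.
  have [[x _]|T0] := pselect (exists x : T, True).
    by have := le_lt_trans (fM x) M0; rewrite ltNge cabs_ge0.
  split; first exact: cmeasM.
  rewrite integral0_eq// => x _; exfalso; apply: T0; by exists x.
apply: (@le_cint _ (fun x => M * cabs (g x))).
- exact: cmeasM.
- by move=> x; rewrite cabsM ler_wpM2r ?cabs_ge0.
- by apply: measurable_funM => //; exact: measurable_cabs.
- under eq_integral do rewrite EFinM.
  rewrite ge0_integralZl//=; last 2 first.
    + by apply/measurable_EFinP; exact: measurable_cabs.
    + by move=> x _; rewrite lee_fin cabs_ge0.
  by rewrite lte_mul_pinfty.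
Qed.

Lemma cintZ (z : R[i]) f : cint f -> cint (fun x => z * f x).
Proof. by apply: (@cint_mulb (fun=> z) f (cabs z)) => //; exact: cmeas_cst. Qed.

Lemma cint_expi (h : T -> R) f : measurable_fun setT h -> cint f ->
  cint (fun x => expi (h x) * f x).
Proof.
move=> mh; apply: (@cint_mulb (fun x => expi (h x)) f 1); first exact: cmeas_expi.
by move=> x; rewrite cabs_expi.
Qed.

Lemma cintD f g : cint f -> cint g -> cint (fun x => f x + g x).
Proof.
move=> [mf foo] [mg goo]; apply: (@le_cint _ (fun x => cabs (f x) + cabs (g x))).
- exact: cmeasD.
- by move=> x; exact: cabsD.
- by apply: measurable_funD; exact: measurable_cabs.
- under eq_integral do rewrite EFinD.
  rewrite ge0_integralD//=; first by rewrite lte_add_pinfty.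
  + by move=> x _; rewrite lee_fin cabs_ge0.
  + by apply/measurable_EFinP; exact: measurable_cabs.
  + by move=> x _; rewrite lee_fin cabs_ge0.
  + by apply/measurable_EFinP; exact: measurable_cabs.
Qed.

Lemma cint0 : cint (fun=> 0).
Proof.
split; first exact: cmeas_cst.
by rewrite integral0_eq// => x _; rewrite cabs0.
Qed.

Lemma cint_sum (I : Type) (s : seq I) (P : pred I) (F : I -> T -> R[i]) :
  (forall i, cint (F i)) -> cint (fun x => \sum_(i <- s | P i) F i x).
Proof.
move=> mF; elim: s => [|i s IH].
  under eq_fun do rewrite big_nil; exact: cint0.
under eq_fun do rewrite big_cons.
by case: (P i) => //; exact: cintD.
Qed.

Lemma cint_ext f g : f =1 g -> cint f -> cint g.
Proof. by move=> /funext ->. Qed.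

Lemma cI_ext f g : f =1 g -> cI f = cI g.
Proof. by move=> /funext ->. Qed.

Lemma cID f g : cint f -> cint g -> cI (fun x => f x + g x) = cI f + cI g.
Proof.
move=> fi gi; apply: Cext; rewrite ?ReD ?ImD /=.
- under eq_Rintegral do rewrite ReD.
  by apply: RintegralD => //; exact: cint_Re.
- under eq_Rintegral do rewrite ImD.
  by apply: RintegralD => //; exact: cint_Im.
Qed.

Lemma RintegralN_int (u : T -> R) : mu.-integrable setT (EFin \o u) ->
  (\int[mu]_x (- u x) = - \int[mu]_x u x)%R.
Proof.
move=> ui; rewrite -mulN1r -RintegralZl//.
by apply: eq_Rintegral => x _; rewrite mulN1r.
Qed.

Lemma cI_conj f : cint f -> cI (fun x => conjc (f x)) = conjc (cI f).
Proof.
move=> fi; apply: Cext => /=.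
- by apply: eq_Rintegral => x _; rewrite Re_conjc.
- under eq_Rintegral do rewrite Im_conjc.
  exact: RintegralN_int (cint_Im fi).
Qed.

Lemma integrableZl_EFin (c : R) (u : T -> R) : mu.-integrable setT (EFin \o u) ->
  mu.-integrable setT (EFin \o (fun x => c * u x)).
Proof. by move=> ui; exact: (integrableZl _ c ui). Qed.

Lemma cIZ (z : R[i]) f : cint f -> cI (fun x => z * f x) = z * cI f.
Proof.
move=> fi; apply: Cext; rewrite ?ReM ?ImM /=.
- under eq_Rintegral do rewrite ReM.
  rewrite RintegralB// ?RintegralZl//; [exact: cint_Im|exact: cint_Re|..].
  + exact/integrableZl_EFin/cint_Re.
  + exact/integrableZl_EFin/cint_Im.
- under eq_Rintegral do rewrite ImM.
  rewrite RintegralD// ?RintegralZl//; [exact: cint_Re|exact: cint_Im|..].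
  + exact/integrableZl_EFin/cint_Im.
  + exact/integrableZl_EFin/cint_Re.
Qed.

Lemma cIZr (z : R[i]) f : cint f -> cI (fun x => f x * z) = cI f * z.
Proof.
by move=> fi; rewrite mulrC -cIZ//; apply: cI_ext => x; rewrite mulrC.
Qed.

Lemma cI0 : cI (fun=> 0) = 0.
Proof. by apply: Cext => /=; rewrite /Rintegral integral0. Qed.

Lemma cI_sum (I : Type) (s : seq I) (P : pred I) (F : I -> T -> R[i]) :
  (forall i, cint (F i)) ->
  cI (fun x => \sum_(i <- s | P i) F i x) = \sum_(i <- s | P i) cI (F i).
Proof.
move=> mF; elim: s => [|i s IH].
  rewrite big_nil; under cI_ext do rewrite big_nil.
  exact: cI0.
rewrite big_cons; under cI_ext do rewrite big_cons.
case: (P i) => //; rewrite cID//; first by rewrite IH.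
exact: cint_sum.
Qed.

Lemma cI_real (u : T -> R) : cI (fun x => (u x)%:C%C) = (\int[mu]_x u x)%:C%C.
Proof. by apply: Cext => //=; rewrite /Rintegral integral0. Qed.

(** A unimodular factor [w] rotates the integral onto the positive axis; it is then the integral of
    a real part, which the modulus dominates. *)
Lemma cabs_cI f : cint f -> ((cabs (cI f))%:E <= \int[mu]_x (cabs (f x))%:E)%E.
Proof.
move=> fi; set r := cabs (cI f).
have [r0|r0] := eqVneq r 0.
  by rewrite r0 integral_ge0// => x _; rewrite lee_fin cabs_ge0.
have rgt0 : 0 < r by rewrite lt_neqAle eq_sym r0 cabs_ge0.
pose w : R[i] := conjc (cI f) * (r^-1)%:C%C.
have aw : cabs w = 1.
  by rewrite /w cabsM cabs_conj cabs_real ger0_norm ?invr_ge0 ?ltW// mulfV.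
have : cI (fun x => w * f x) = r%:C%C.
  rewrite cIZ// /w mulrAC (mulrC _ (cI f)) mul_conjc -/r.
  rewrite -rmorphM; congr (_ %:C)%C; rewrite expr2 -mulrA mulfV// mulr1.
  by [].
move/(congr1 (@complex.Re R)) => /= rE.
have wi : cint (fun x => w * f x) by exact: cintZ.
rewrite -rE /Rintegral fineK; last first.
  by apply: integrable_fin_num => //; exact: cint_Re wi.
apply: le_integral => //; first exact: cint_Re wi.
  apply/integrableP; split.
    by apply/measurable_EFinP; exact: measurable_cabs fi.1.
  have [_] := fi; congr (_ < _)%E; apply: eq_integral => x _.
  by rewrite /= ger0_norm// cabs_ge0.
move=> x _; rewrite lee_fin (le_trans (ler_norm _))//.
by rewrite (le_trans (cabs_Re _))// cabsM aw mul1r.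
Qed.

Lemma cI_ae f g : cmeas f -> cmeas g -> {ae mu, forall x, f x = g x} -> cI f = cI g.
Proof.
move=> [f1 f2] [g1 g2] fg; apply: Cext => /=; rewrite /Rintegral; congr fine.
- apply: ae_eq_integral => //; [exact/measurable_EFinP|exact/measurable_EFinP|].
  by apply: filterS fg => x -> _.
- apply: ae_eq_integral => //; [exact/measurable_EFinP|exact/measurable_EFinP|].
  by apply: filterS fg => x -> _.
Qed.

(** [nsq] and [inL2] are [L2norm_sqr] and [in_L2] over an arbitrary measure. *)
Definition nsq f : \bar R := (\int[mu]_x (cabs (f x) ^+ 2)%:E)%E.

Definition inL2 f := cmeas f /\ (nsq f < +oo)%E.

Lemma nsq_ge0 f : (0 <= nsq f)%E.
Proof. by apply: integral_ge0 => x _; rewrite lee_fin sqr_ge0. Qed.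

Lemma measurable_nsq f : cmeas f ->
  measurable_fun setT (fun x => (cabs (f x) ^+ 2)%:E).
Proof. by move=> mf; apply/measurable_EFinP; exact: measurable_cabs_sqr. Qed.

Lemma nsqZ (z : R[i]) f : cmeas f -> nsq (fun x => z * f x) = ((cabs z ^+ 2)%:E * nsq f)%E.
Proof.
move=> mf; rewrite /nsq.
under eq_integral do rewrite cabsM exprMn EFinM.
rewrite ge0_integralZl//; first exact: measurable_nsq.
by move=> x _; rewrite lee_fin sqr_ge0.
by rewrite lee_fin sqr_ge0.
Qed.

Lemma nsq_le f g : cmeas f -> cmeas g -> (forall x, cabs (f x) <= cabs (g x)) ->
  (nsq f <= nsq g)%E.
Proof.
move=> mf mg fg; apply: ge0_le_integral => //; try exact: measurable_nsq.
  by move=> x _; rewrite lee_fin sqr_ge0.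
by move=> x _; rewrite lee_fin lerXn2r ?nnegrE ?cabs_ge0.
Qed.

Lemma nsqD (s : R) f g : 0 < s -> cmeas f -> cmeas g ->
  (nsq (fun x => (f x + g x)%R) <= (1 + s)%:E * nsq f + (1 + s^-1)%:E * nsq g)%E.
Proof.
move=> s0 mf mg; have s1 : 0 <= s^-1 by rewrite invr_ge0 ltW.
rewrite /nsq -!ge0_integralZl//=; last 6 first.
- exact: measurable_nsq.
- by move=> x _; rewrite lee_fin sqr_ge0.
- by rewrite lee_fin addr_ge0.
- exact: measurable_nsq.
- by move=> x _; rewrite lee_fin sqr_ge0.
- by rewrite lee_fin addr_ge0// ltW.
have mZ (c : R) h : cmeas h -> measurable_fun setT (fun x => (c%:E * (cabs (h x) ^+ 2)%:E)%E).
  move=> mh; under eq_fun do rewrite -EFinM.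
  by apply/measurable_EFinP; apply: measurable_funM => //; exact: measurable_cabs_sqr.
rewrite -ge0_integralD//=.
- apply: ge0_le_integral => //=.
  + by move=> x _; rewrite lee_fin sqr_ge0.
  + by apply: measurable_nsq; exact: cmeasD.
  + by apply: emeasurable_funD; exact: mZ.
  + by move=> x _; rewrite -!EFinM -EFinD lee_fin cabs_sqrD.
- by move=> x _; rewrite -EFinM lee_fin mulr_ge0 ?sqr_ge0// addr_ge0// ltW.
- exact: mZ.
- by move=> x _; rewrite -EFinM lee_fin mulr_ge0 ?sqr_ge0// addr_ge0// ltW.
- exact: mZ.
Qed.

Lemma inL2Z (z : R[i]) f : inL2 f -> inL2 (fun x => z * f x).
Proof.
move=> [mf foo]; split; first by apply: cmeasM => //; exact: cmeas_cst.
by rewrite nsqZ// lte_mul_pinfty// lee_fin sqr_ge0.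
Qed.

Lemma inL2D f g : inL2 f -> inL2 g -> inL2 (fun x => f x + g x).
Proof.
move=> [mf foo] [mg goo]; split; first exact: cmeasD.
apply: (le_lt_trans (nsqD ltr01 mf mg)).
by rewrite lte_add_pinfty// lte_mul_pinfty// lee_fin addr_ge0.
Qed.

Lemma inL2_sum (I : Type) (s : seq I) (P : pred I) (F : I -> T -> R[i]) :
  (forall i, inL2 (F i)) -> inL2 (fun x => \sum_(i <- s | P i) F i x).
Proof.
move=> mF; elim: s => [|i s IH].
  under eq_fun do rewrite big_nil; split; first exact: cmeas_cst.
  by rewrite /nsq integral0_eq// => x _; rewrite cabs0 expr0n.
under eq_fun do rewrite big_cons.
by case: (P i) => //; exact: inL2D.
Qed.

Lemma inL2_le f g : cmeas f -> (forall x, cabs (f x) <= cabs (g x)) -> inL2 g -> inL2 f.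
Proof. by move=> mf fg [mg goo]; split => //; apply: le_lt_trans goo; exact: nsq_le. Qed.

Lemma inL2_mulb f g (M : R) : cmeas f -> (forall x, cabs (f x) <= M) ->
  inL2 g -> inL2 (fun x => f x * g x).
Proof.
move=> mf fM g2; have [mg _] := g2.
apply: (@inL2_le _ (fun x => `|M|%:C%C * g x)).
- exact: cmeasM.
- move=> x; rewrite !cabsM ler_wpM2r ?cabs_ge0// cabs_real normr_id.
  by rewrite (le_trans (fM x))// ler_norm.
- exact: inL2Z.
Qed.

Lemma inL2_conj f : inL2 f -> inL2 (fun x => conjc (f x)).
Proof.
move=> [mf foo]; split; first exact: cmeas_conj.
by rewrite /nsq; under eq_integral do rewrite cabs_conj.
Qed.

Lemma cintM f g : inL2 f -> inL2 g -> cint (fun x => f x * g x).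
Proof.
move=> [mf foo] [mg goo].
apply: (@le_cint _ (fun x => cabs (f x) ^+ 2 + cabs (g x) ^+ 2)).
- exact: cmeasM.
- move=> x; rewrite cabsM; have := cabs_ge0 (f x); have := cabs_ge0 (g x).
  by have := sqr_ge0 (cabs (f x) - cabs (g x)); nra.
- by apply: measurable_funD; exact: measurable_cabs_sqr.
- under eq_integral do rewrite EFinD.
  rewrite ge0_integralD//=; first by rewrite lte_add_pinfty.
  + by move=> x _; rewrite lee_fin sqr_ge0.
  + exact: measurable_nsq.
  + by move=> x _; rewrite lee_fin sqr_ge0.
  + exact: measurable_nsq.
Qed.

End cI.

(** * Fubini for complex-valued integrands *)

Section Fubini.
Context {R : realType} {d1 d2 : measure_display} {T1 : measurableType d1}
  {T2 : measurableType d2}.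
Variables (m1 : {sigma_finite_measure set T1 -> \bar R})
  (m2 : {sigma_finite_measure set T2 -> \bar R}).
Implicit Types f : T1 * T2 -> R[i].

(** The inner integral is [fine] of the difference of the integrals of the positive and negative
    parts, each measurable in [x] by Tonelli. Where it diverges, the value is a default, and
    measurability persists. *)
Lemma measurable_Rintegral2 (u : T1 * T2 -> R) : measurable_fun setT u ->
  measurable_fun setT (fun x => \int[m2]_y u (x, y))%R.
Proof.
move=> mu; rewrite /Rintegral.
have -> : (fun x => fine (\int[m2]_y (u (x, y))%:E)) =
    fine \o (fun x => \int[m2]_y ((EFin \o u)^\+ (x, y)) -
                      \int[m2]_y ((EFin \o u)^\- (x, y)))%E.
    apply/funext => x /=; congr fine; rewrite integralE.
  congr (_ - _)%E; apply: eq_integral => y _; first by rewrite !funeposE.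
  by rewrite !funenegE.
apply: measurableT_comp => //; apply: emeasurable_funB.
- apply: (measurable_fun_fubini_tonelli_F (EFin \o u)^\+%E) => //.
  by apply: measurable_funepos; exact/measurable_EFinP.
- apply: (measurable_fun_fubini_tonelli_F (EFin \o u)^\-%E) => //.
  by apply: measurable_funeneg; exact/measurable_EFinP.
Qed.

Lemma cmeas_cI2 f : cmeas f -> cmeas (fun x => cI m2 (fun y => f (x, y))).
Proof.
move=> [f1 f2]; split => /=.
- exact: (@measurable_Rintegral2 (fun p => complex.Re (f p))).
- exact: (@measurable_Rintegral2 (fun p => complex.Im (f p))).
Qed.

Lemma cmeas_pair2 f : cmeas f -> forall x, cmeas (fun y => f (x, y)).
Proof.
move=> [f1 f2] x; split.
- exact: (measurableT_comp f1 (pair1_measurable x)).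
- exact: (measurableT_comp f2 (pair1_measurable x)).
Qed.

(** Slices are integrable for almost every [x] only; on the remaining null set the inner [Rintegral]
    is a default value, so the outer integrands are compared almost everywhere. *)
Lemma cI_fubini1 f : cint (m1 \x m2)%E f ->
  cI (m1 \x m2)%E f = cI m1 (fun x => cI m2 (fun y => f (x, y))).
Proof.
move=> fi; apply: Cext => /=.
- rewrite /Rintegral -integral12_prod_meas1; last exact: cint_Re.
  congr fine; apply: ae_eq_integral => //.
  + exact: measurable_fubini_F (cint_Re fi).
  + apply/measurable_EFinP.
    exact: (@measurable_Rintegral2 (fun p => complex.Re (f p)) fi.1.1).
  + have := ae_integrable1 (cint_Re fi); apply: filterS => x ix _ /=.
    by rewrite fineK//; exact: integrable_fin_num.
- rewrite /Rintegral -integral12_prod_meas1; last exact: cint_Im.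
  congr fine; apply: ae_eq_integral => //.
  + exact: measurable_fubini_F (cint_Im fi).
  + apply/measurable_EFinP.
    exact: (@measurable_Rintegral2 (fun p => complex.Im (f p)) fi.1.2).
  + have := ae_integrable1 (cint_Im fi); apply: filterS => x ix _ /=.
    by rewrite fineK//; exact: integrable_fin_num.
Qed.

End Fubini.

(** * Orthonormal families and Parseval on the unit interval *)

Section esum_aux.
Context {R : realType} {T : choiceType}.

Lemma esum_le_seq (A : set T) (a : T -> \bar R) (M : \bar R) :
  (forall i, A i -> 0 <= a i)%E ->
  (forall s : seq T, uniq s -> (forall i, i \in s -> A i) ->
     \sum_(i <- s) a i <= M)%E ->
  (\esum_(i in A) a i <= M)%E.
Proof.
move=> a0 H; apply: ge_ereal_sup => _ [X [finX XA] <-].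
rewrite fsbig_finite//=; apply: H; first exact: finmap.fset_uniq.
by move=> i; rewrite in_fset_set// inE => /XA.
Qed.

Lemma seq_le_esum (A : set T) (a : T -> \bar R) (s : seq T) :
  uniq s -> (forall i, i \in s -> A i) ->
  (\sum_(i <- s) a i <= \esum_(i in A) a i)%E.
Proof.
move=> us sA; apply: esum_ge; exists [set` s]; last by rewrite fsbig_seq.
by split => //; exact: finite_seq.
Qed.

End esum_aux.

Lemma real_complex_sum (R : realType) (I : Type) (s : seq I) (F : I -> R) :
  (\sum_(i <- s) F i)%:C%C = \sum_(i <- s) (F i)%:C%C.
Proof. exact: rmorph_sum. Qed.

(** * Bessel and Parseval for an orthonormal family *)

Section orthonormal.
Context {R : realType} {d : measure_display} {T : measurableType d}.
Variable mu : {measure set T -> \bar R}.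
Implicit Types (f g : T -> R[i]).

Definition ip f g : R[i] := cI mu (fun x => f x * conjc (g x)).

Lemma cint_ip f g : inL2 mu f -> inL2 mu g -> cint mu (fun x => f x * conjc (g x)).
Proof. by move=> f2 g2; apply: cintM => //; exact: inL2_conj. Qed.

Lemma ip_self f : ip f f = (fine (nsq mu f))%:C%C.
Proof. by rewrite /ip; under cI_ext do rewrite mul_conjc; rewrite cI_real. Qed.

Lemma ip_conj f g : inL2 mu f -> inL2 mu g -> ip g f = conjc (ip f g).
Proof.
move=> f2 g2; rewrite /ip -cI_conj; last exact: cint_ip.
by apply: cI_ext => x; rewrite conjcM conjcK mulrC.
Qed.

Lemma ipDl f g h : inL2 mu f -> inL2 mu g -> inL2 mu h ->
  ip (fun x => f x + g x) h = ip f h + ip g h.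
Proof.
move=> f2 g2 h2; rewrite /ip -cID; try exact: cint_ip.
by apply: cI_ext => x; rewrite mulrDl.
Qed.

Lemma ipZl z f h : inL2 mu f -> inL2 mu h ->
  ip (fun x => z * f x) h = z * ip f h.
Proof.
move=> f2 h2; rewrite /ip -cIZ; last exact: cint_ip.
by apply: cI_ext => x; rewrite mulrA.
Qed.

Lemma ipDr f g h : inL2 mu f -> inL2 mu g -> inL2 mu h ->
  ip h (fun x => f x + g x) = ip h f + ip h g.
Proof.
move=> f2 g2 h2; rewrite ip_conj//; last exact: inL2D.
by rewrite ipDl// conjcD -!ip_conj.
Qed.

Lemma ipZr z f h : inL2 mu f -> inL2 mu h ->
  ip h (fun x => z * f x) = conjc z * ip h f.
Proof.
move=> f2 h2; rewrite ip_conj//; last exact: inL2Z.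
by rewrite ipZl// conjcM -ip_conj.
Qed.

Lemma ip_suml (I : Type) (s : seq I) (F : I -> T -> R[i]) h :
  (forall i, inL2 mu (F i)) -> inL2 mu h ->
  ip (fun x => \sum_(i <- s) F i x) h = \sum_(i <- s) ip (F i) h.
Proof.
move=> F2 h2; rewrite /ip -cI_sum; last by move=> i; exact: cint_ip.
by apply: cI_ext => x; rewrite mulr_suml.
Qed.

Lemma ip_sumr (I : Type) (s : seq I) (F : I -> T -> R[i]) h :
  (forall i, inL2 mu (F i)) -> inL2 mu h ->
  ip h (fun x => \sum_(i <- s) F i x) = \sum_(i <- s) ip h (F i).
Proof.
move=> F2 h2; rewrite ip_conj//; last exact: inL2_sum.
rewrite ip_suml// conjc_sum; apply: eq_bigr => i _.
by rewrite -ip_conj.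
Qed.

Lemma nsq_fin f : inL2 mu f -> nsq mu f = (fine (nsq mu f))%:E.
Proof. by move=> [_ foo]; rewrite fineK// ge0_fin_numE// nsq_ge0. Qed.

Lemma nsqE f : inL2 mu f -> nsq mu f = (complex.Re (ip f f))%:E.
Proof. by move=> f2; rewrite ip_self /= -nsq_fin. Qed.

Variables (I : choiceType) (e : I -> T -> R[i]).
Hypothesis e2 : forall i, inL2 mu (e i).
Hypothesis eo : forall i j, ip (e i) (e j) = (i == j)%:R.

(** Completing the square in the coefficients. With [a i = ip f (e i)] it gives Bessel; for other
    [a] it says that the Fourier coefficients are the best choice, which turns density into
    Parseval. It avoids subtraction because [nsq] is an extended real. *)
Lemma nsq_sub_comb f (s : seq I) (a : I -> R[i]) : inL2 mu f -> uniq s ->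
  (nsq mu (fun x => (f x - \sum_(i <- s) a i * e i x)%R) +
   (\sum_(i <- s) cabs (ip f (e i)) ^+ 2)%R%:E =
   nsq mu f + (\sum_(i <- s) cabs (a i - ip f (e i)) ^+ 2)%R%:E)%E.
Proof.
move=> f2 us; set p := fun x => \sum_(i <- s) a i * e i x.
have ae2 i : inL2 mu (fun x => a i * e i x) by exact: inL2Z.
have p2 : inL2 mu p by exact: inL2_sum.
have Np2 : inL2 mu (fun x => -1 * p x) by exact: inL2Z.
have fp : (fun x => f x - p x) = (fun x => f x + (-1) * p x).
  by apply/funext => x; rewrite mulN1r.
rewrite [X in (X + _)%E]nsqE; last by rewrite fp; exact: inL2D.
rewrite [X in (_ = X + _)%E]nsqE// -!EFinD; congr EFin.
rewrite fp.
(* In [R[i]] the inner products expand sesquilinearly; the claim is the real part of the resulting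
   identity. *)
suff E : ip (fun x => f x + -1 * p x) (fun x => f x + -1 * p x) +
    (\sum_(i <- s) cabs (ip f (e i)) ^+ 2)%:C%C =
  ip f f + (\sum_(i <- s) cabs (a i - ip f (e i)) ^+ 2)%:C%C.
  by have := congr1 (@complex.Re R) E; rewrite !ReD.
rewrite !real_complex_sum.
rewrite ipDl ?ipDr//; try exact: inL2D.
rewrite !ipZl ?ipZr//.
have -> : ip f p = \sum_(i <- s) conjc (a i) * ip f (e i).
  by rewrite {1}/p ip_sumr//; apply: eq_bigr => i _; rewrite ipZr.
have -> : ip p f = \sum_(i <- s) a i * ip (e i) f.
  by rewrite {1}/p ip_suml//; apply: eq_bigr => i _; rewrite ipZl.
have -> : ip p p = \sum_(i <- s) a i * conjc (a i).
  rewrite {1}/p ip_suml//; apply: eq_big_seq => i si.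
  rewrite ipZl//; congr (_ * _); rewrite /p ip_sumr// (bigD1_seq i)//= ipZr// eo eqxx mulr1.
  rewrite big1 ?addr0// => j ji; rewrite ipZr// eo eq_sym (negbTE ji) mulr0.
  by [].
under [X in _ + X = _]eq_bigr do rewrite -mul_conjc.
under [X in _ = _ + X]eq_bigr do rewrite -mul_conjc.
have -> : conjc (-1 : R[i]) = -1 by rewrite rmorphN rmorph1.
rewrite !mulN1r opprK -!addrA; congr (_ + _).
rewrite !addrA -!sumrN -!big_split; apply: eq_bigr => i _.
rewrite (ip_conj f2 (e2 i)).
set c := ip f (e i); set ca := conjc c.
rewrite -[LHS]/(- (conjc (a i) * c) - a i * ca + a i * conjc (a i) + c * ca).
have -> : conjc (a i - c) = conjc (a i) - ca by rewrite /ca rmorphB.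
ring.
Qed.

Lemma bessel f : inL2 mu f ->
  (\esum_(i in [set: I]) (cabs (ip f (e i)) ^+ 2)%:E <= nsq mu f)%E.
Proof.
move=> f2; apply: esum_le_seq => [i _|s us _]; first by rewrite lee_fin sqr_ge0.
have := nsq_sub_comb (fun i => ip f (e i)) f2 us.
rewrite [X in (_ = _ + X)%E -> _](_ : _ = 0%E); last first.
  by rewrite big1// => i _; rewrite subrr cabs0 expr0n.
by rewrite adde0 sumEFin => <-; rewrite leeDr// nsq_ge0.
Qed.

Lemma parseval_dense f : inL2 mu f ->
  (forall eps : R, 0 < eps -> exists s : seq I, exists a : I -> R[i],
    uniq s /\ (nsq mu (fun x => (f x - \sum_(i <- s) a i * e i x)%R) <= eps%:E)%E) ->
  (\esum_(i in [set: I]) (cabs (ip f (e i)) ^+ 2)%:E = nsq mu f)%E.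
Proof.
move=> f2 H; apply/eqP; rewrite eq_le bessel//=.
apply/lee_addgt0Pr => eps /H[s [a [us fs]]].
have E := nsq_sub_comb a f2 us.
apply: (@le_trans _ _ (nsq mu f + (\sum_(i <- s) cabs (a i - ip f (e i)) ^+ 2)%:E)%E).
  by rewrite leeDl// lee_fin sumr_ge0// => i _; rewrite sqr_ge0.
rewrite -E addeC leeD// -sumEFin; exact: seq_le_esum.
Qed.

End orthonormal.

Section L2_dominated.
Context {R : realType} {d : measure_display} {T : measurableType d}.
Variable mu : {measure set T -> \bar R}.

Lemma L2_dominated (f : T -> R[i]) (g : nat -> T -> R[i]) (h : T -> R) :
  cmeas f -> (forall n, cmeas (g n)) -> measurable_fun setT h ->
  (forall n x, cabs (f x - g n x) <= h x) ->
  (\int[mu]_x (h x ^+ 2)%:E < +oo)%E ->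
  {ae mu, forall x, cabs (f x - g n x) @[n --> \oo] --> (0 : R)} ->
  forall eps : R, 0 < eps ->
  \forall n \near \oo, (nsq mu (fun x => (f x - g n x)%R) <= eps%:E)%E.
Proof.
move=> mf mg mh fgh hoo fg eps eps0.
have mfg n : cmeas (fun x => f x - g n x) by apply: cmeasD => //; exact: cmeasN.
have [] := @dominated_convergence _ _ R mu setT measurableT
  (fun n x => (cabs (f x - g n x) ^+ 2)%:E) (cst 0%E) (fun x => (h x ^+ 2)%:E).
- by move=> n; exact: measurable_nsq.
- exact: measurable_cst.
- apply: filterS fg => x fgx _ /=; apply: cvg_EFin; first exact: nearW.
  rewrite [X in X @ _ --> _](_ : _ = (fun n => cabs (f x - g n x) * cabs (f x - g n x))); last first.
    by apply/funext => n; rewrite /= -expr2.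
  by rewrite -[X in _ --> X](mulr0 (0 : R)); exact: cvgM.
- apply/integrableP; split; first by apply/measurable_EFinP; exact: measurable_funX.
  by under eq_integral do rewrite gee0_abs ?lee_fin ?sqr_ge0//.
- apply: aeW => x n _ /=; rewrite lee_fin ger0_norm ?sqr_ge0//.
  by rewrite lerXn2r ?nnegrE ?cabs_ge0// (le_trans (cabs_ge0 _) (fgh n x)).
move=> _ _; rewrite integral0 => /fine_cvgP[fin].
move/cvgrPdist_le => /(_ _ eps0); apply: filterS2 fin => n fn.
rewrite sub0r normrN => H; rewrite -[leLHS](fineK fn) lee_fin.
exact: le_trans (ler_norm _) H.
Qed.

End L2_dominated.

(** * The exponentials on the unit interval and trigonometric polynomials *)

Section FTC.
Context {R : realType}.
Notation lam := (@lebesgue_measure R).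

Lemma FTC2_derive (F f : R -> R) (a b : R) : a < b ->
  (forall x : R, is_derive x (1 : R) F (f x)) -> continuous f ->
  (\int[lam]_(x in `[a, b]) (f x)%:E = (F b - F a)%:E)%E.
Proof.
move=> ab dF cf; rewrite EFinB; apply: continuous_FTC2 => //.
- exact: continuous_subspaceT.
- have cF : continuous F.
    by move=> x; apply: differentiable_continuous; apply/derivable1_diffP.
  split; first by move=> x _.
  + by apply: cvg_at_right_filter; exact: cF.
  + by apply: cvg_at_left_filter; exact: cF.
- by move=> x _; rewrite derive1E; apply: derive_val.
Qed.

Lemma sin_pin (n : int) : sin (pi * n%:~R) = 0 :> R.
Proof.
have := congr1 (@complex.Re R) (@expi_2piz R n) => /= c1.
apply/eqP; rewrite -sqrf_eq0.
have : cos (pi * n%:~R + pi * n%:~R : R) = 1.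
  by rewrite -[RHS]c1; congr cos; ring.
rewrite cosD -!expr2.
have := cos2Dsin2 (pi * n%:~R : R).
by set s := sin _ ^+ 2; set c := cos _ ^+ 2 => A B; apply/eqP; lra.
Qed.

Lemma is_derive_comp_lin (F f : R -> R) (c x : R) :
  (forall y : R, is_derive y (1 : R) F (f y)) ->
  is_derive x (1 : R) (fun t => F (c * t)) (c * f (c * x)).
Proof.
move=> dF.
have d1 : is_derive x (1 : R) (fun t => c * t) c.
  by apply: is_derive_eq; rewrite scaler1.
by have := @is_derive1_comp R F (fun t => c * t) x _ _ (dF _) d1; rewrite mulrC.
Qed.

(** Half-open, so that the integer translates partition the line; up to an endpoint it is the
    interval [|t| <= 1/2] in the definition of a tile. *)
Definition I1 : set R := `[- 2^-1, 2^-1[%classic.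

(** Extended by 0, so that the orthonormal family lives in L^2 of the whole line. *)
Definition e1 (k : int) (t : R) : R[i] := (\1_I1 t)%:C%C * expi (2 * pi * (k%:~R * t)).

Lemma conjc_real (r : R) : conjc (r%:C%C) = r%:C%C.
Proof. by rewrite /conjc /= oppr0. Qed.

Lemma indic_sqr (T : Type) (A : set T) x : (\1_A x : R) ^+ 2 = \1_A x.
Proof. by rewrite indicE; case: (_ \in _); rewrite ?expr1n ?expr0n. Qed.

Lemma measurable_I1 : measurable I1. Proof. exact: measurable_itv. Qed.

Lemma lebesgue_I1 : lam I1 = 1%E.
Proof.
rewrite lebesgue_measure_itv/= lte_fin -EFinD opprK.
have -> : (- 2^-1 < 2^-1 :> R) = true by lra.
by congr EFin; field.
Qed.

Lemma integral_indic_I1 : (\int[lam]_t (\1_I1 t)%:E = 1)%E.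
Proof.
rewrite integral_indic//; last exact: measurable_I1.
by rewrite setIT; exact: lebesgue_I1.
Qed.

Lemma measurable_lin (c : R) : measurable_fun setT (fun t : R => c * t).
Proof. by apply: measurable_funM => //; exact: measurable_cst. Qed.

Lemma integral_I1 (u : R -> R) : measurable_fun setT u ->
  (\int[lam]_t (\1_I1 t * u t)%:E = \int[lam]_(t in `[(- 2^-1)%R, (2^-1)%R]) (u t)%:E)%E.
Proof.
move=> mu; rewrite -integral_itv_bndo_bndc; last by apply/measurable_EFinP; exact: measurable_funTS.
rewrite [RHS]integral_mkcond; apply: eq_integral => t _.
rewrite patchE indicE -/I1.
by case: ifPn => _; rewrite ?mul1r ?mul0r.
Qed.

Lemma expi_continuous_parts (c : R) :
  continuous (fun t : R => cos (c * t)) /\ continuous (fun t : R => sin (c * t)).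
Proof.
have cl : continuous (fun t : R => c * t) by move=> t; apply: cvgM; [exact: cvg_cst|exact: cvg_id].
split => t; apply: continuous_comp; [exact: cl|exact: continuous_cos|exact: cl|exact: continuous_sin].
Qed.

Lemma int_cos_period (n : int) : n != 0 ->
  (\int[lam]_t (\1_I1 t * cos (2 * pi * n%:~R * t))%:E = 0)%E.
Proof.
move=> n0; set c := 2 * pi * n%:~R.
have c0 : c != 0 by rewrite mulf_neq0 ?mulf_neq0 ?intr_eq0// gt_eqF ?pi_gt0.
rewrite integral_I1; last first.
  by apply: continuous_measurable_fun; exact: (expi_continuous_parts c).1.
have dF (x : R) : is_derive x (1 : R) (fun t => c^-1 * sin (c * t)) (cos (c * x)).
  apply: is_derive_eq.
  by rewrite /GRing.scale /= mulr1 mulrCA mulVf// mulr1.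
rewrite (FTC2_derive _ dF).
- rewrite mulrN sinN /c; have -> : 2 * pi * n%:~R * 2^-1 = pi * n%:~R :> R by field.
  by rewrite sin_pin oppr0 !mulr0 subrr.
- by rewrite ltrNl; lra.
- exact: (expi_continuous_parts c).1.
Qed.

Lemma int_sin_period (n : int) :
  (\int[lam]_t (\1_I1 t * sin (2 * pi * n%:~R * t))%:E = 0)%E.
Proof.
have [->|n0] := eqVneq n 0.
  by apply: integral0_eq => t _; rewrite mulr0 mul0r sin0 mulr0.
set c := 2 * pi * n%:~R.
have c0 : c != 0 by rewrite mulf_neq0 ?mulf_neq0 ?intr_eq0// gt_eqF ?pi_gt0.
rewrite integral_I1; last first.
  by apply: continuous_measurable_fun; exact: (expi_continuous_parts c).2.
have dF (x : R) : is_derive x (1 : R) (fun t => (- c^-1) * cos (c * t)) (sin (c * x)).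
  apply: is_derive_eq.
  by rewrite /GRing.scale /= mulr1 mulNr mulNr mulrN opprK mulrCA mulVf// mulr1.
rewrite (FTC2_derive _ dF).
- by rewrite mulrN cosN subrr.
- by rewrite ltrNl; lra.
- exact: (expi_continuous_parts c).2.
Qed.

Lemma cmeas_e1 k : cmeas (e1 k).
Proof.
apply: cmeasM; first exact: cmeas_indic measurable_I1.
by apply: cmeas_expi; apply: measurable_funM => //; exact: measurable_lin.
Qed.

Lemma cabs_e1 k t : cabs (e1 k t) = \1_I1 t.
Proof. by rewrite cabsM cabs_expi mulr1 cabs_real ger0_norm. Qed.

Lemma e1_L2 k : inL2 lam (e1 k).
Proof.
split; first exact: cmeas_e1.
rewrite /nsq; under eq_integral do rewrite cabs_e1 indic_sqr.
by rewrite integral_indic_I1 ltry.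
Qed.

Lemma e1_ortho j k : ip lam (e1 j) (e1 k) = (j == k)%:R.
Proof.
have E t : e1 j t * conjc (e1 k t) = (\1_I1 t)%:C%C * expi (2 * pi * (j - k)%:~R * t).
  rewrite /e1 conjcM conjc_expi mulrACA -expiD.
  rewrite conjc_real.
  congr (_ * _); last by congr expi; rewrite rmorphB /=; ring.
  by rewrite -rmorphM indicE; case: (_ \in _); rewrite ?mulr1 ?mulr0.
rewrite /ip; under cI_ext do rewrite E.
apply: Cext => /=; rewrite /Rintegral.
- under eq_integral do rewrite mul0r subr0.
  have [->|jk] := eqVneq j k.
    under eq_integral do rewrite subrr mulr0 mul0r cos0 mulr1.
    by rewrite integral_indic_I1.
  by rewrite int_cos_period// subr_eq0.
- under eq_integral do rewrite mul0r addr0.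
  by rewrite int_sin_period; case: eqVneq.
Qed.

(** A frequency may occur several times in [s]; this keeps sums and products immediate. *)
Definition trig (p : R -> R[i]) : Prop :=
  exists s : seq (int * R[i]), forall t, p t = \sum_(q <- s) q.2 * expi (2 * pi * (q.1%:~R * t)).

Lemma trig_cst z : trig (fun=> z).
Proof. by exists [:: (0, z)] => t; rewrite big_seq1 /= mul0r mulr0 expi0 mulr1. Qed.

Lemma trig_expi k : trig (fun t => expi (2 * pi * (k%:~R * t))).
Proof. by exists [:: (k, 1)] => t; rewrite big_seq1 /= mul1r. Qed.

Lemma trigD p q : trig p -> trig q -> trig (fun t => p t + q t).
Proof. by move=> [s sE] [r rE]; exists (s ++ r) => t; rewrite sE rE big_cat. Qed.

Lemma trigM p q : trig p -> trig q -> trig (fun t => p t * q t).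
Proof.
move=> [s sE] [r rE].
exists [seq (a.1 + b.1, a.2 * b.2) | a <- s, b <- r] => t.
rewrite sE rE big_allpairs_dep mulr_suml; apply: eq_bigr => a _.
rewrite mulr_sumr; apply: eq_bigr => b _ /=.
by rewrite mulrACA -expiD; congr (_ * expi _); rewrite intrD; ring.
Qed.

Lemma trigX p n : trig p -> trig (fun t => p t ^+ n).
Proof.
move=> tp; elim: n => [|n IH]; first exact: (trig_cst 1).
by under eq_fun do rewrite exprS; exact: trigM.
Qed.

Lemma trig_shift p c : trig p -> trig (fun t => p (t - c)).
Proof.
move=> [s sE]; exists [seq (q.1, q.2 * expi (- (2 * pi * (q.1%:~R * c)))) | q <- s] => t.
rewrite sE big_map; apply: eq_bigr => q _ /=.
by rewrite -[RHS]mulrA -[X in _ = _ * X]expiD; congr (_ * expi _); ring.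
Qed.

(** [sin (pi t) ^+ 2 = 1/2 - cos (2 pi t) / 2]. Unlike [sin (pi t)] the square has period 1, which
    is why the approximate indicators are polynomials in it. *)
Lemma trig_sin2 : trig (fun t => (sin (pi * t) ^+ 2)%:C%C).
Proof.
have := trigD (trig_cst (2^-1)%:C%C)
  (trigM (trig_cst (- 4^-1)%:C%C) (trigD (trig_expi 1) (trig_expi (-1)))).
congr trig; apply/funext => t.
rewrite mulN1r !mul1r mulrN; apply: Cext; rewrite ?ReD ?ImD ?ReZ ?ImZ ?ReD ?ImD /=; last first.
  by rewrite sinN; ring.
rewrite cosN; have -> : 2 * pi * t = pi * t + pi * t by ring.
rewrite cosD -!expr2; have := cos2Dsin2 (pi * t); lra.
Qed.

(* The span of the [e1 k], after merging repeated frequencies. *)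
Lemma trig_comb p : trig p -> exists s : seq int, exists a : int -> R[i],
  uniq s /\ forall t, (\1_I1 t)%:C%C * p t = \sum_(k <- s) a k * e1 k t.
Proof.
move=> [s sE]; exists (undup (map fst s)).
exists (fun k => \sum_(q <- s | q.1 == k) q.2); split; first exact: undup_uniq.
move=> t; rewrite sE mulr_sumr.
under [RHS]eq_bigr do rewrite mulr_suml.
rewrite (exchange_big_dep xpredT)//= !big_seq; apply: eq_bigr => q qs.
rewrite (eq_bigl (pred1 q.1)); last by move=> k /=; rewrite eq_sym.
rewrite -big_filter filter_pred1_uniq ?undup_uniq ?mem_undup ?map_f//.
by rewrite big_seq1 /e1 mulrCA.
Qed.

End FTC.

(** * Trigonometric polynomials close to the indicator of an interval *)

Section step_trig.
Context {R : realType}.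
Notation lam := (@lebesgue_measure R).
Notation I1 := (@I1 R).

Lemma bernoulli_ge (x : R) n : -1 <= x -> 1 + x *+ n <= (1 + x) ^+ n.
Proof.
move=> x1; elim: n => [|n IH]; first by rewrite mulr0n addr0 expr0.
have x10 : 0 <= 1 + x by lra.
rewrite exprS (le_trans _ (ler_wpM2l x10 IH))//.
rewrite mulrDr mulr1 mulrDl mul1r mulrSr -!addrA lerD2l.
have : 0 <= x * x *+ n by rewrite mulrn_wge0// -expr2 sqr_ge0.
rewrite mulrnAr; lra.
Qed.

(* [(1 - s^n)^(k^n)] tends to the indicator of [s < 1/k] on [0, 1]. *)
Lemma step_poly_bounds (s : R) (k n : nat) : 0 <= s <= 1 ->
  0 <= (1 - s ^+ n) ^+ (k ^ n) <= 1.
Proof.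
move=> /andP[s0 s1]; have sn1 : s ^+ n <= 1 by rewrite exprn_ile1.
have sn0 : 0 <= s ^+ n by rewrite exprn_ge0.
rewrite exprn_ge0 ?subr_ge0//= exprn_ile1// ?subr_ge0//; lra.
Qed.

Lemma step_poly_lo (s : R) (k n : nat) : 0 <= s <= 1 ->
  1 - (k%:R * s) ^+ n <= (1 - s ^+ n) ^+ (k ^ n).
Proof.
move=> /andP[s0 s1]; have sn1 : s ^+ n <= 1 by rewrite exprn_ile1.
rewrite (le_trans _ (bernoulli_ge _ _))//; last by rewrite lerN2.
by rewrite mulNrn exprMn -natrX mulr_natl.
Qed.

(** With [m = k ^ n], the product of [(1 - s^n)^m] and [(1 + s^n)^m] is at most 1, and Bernoulli
    bounds the second factor below by [(k s)^n]. *)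
Lemma step_poly_hi (s : R) (k n : nat) : 0 < s <= 1 -> (0 < k)%N ->
  (1 - s ^+ n) ^+ (k ^ n) <= ((k%:R * s)^-1) ^+ n.
Proof.
move=> /andP[s0 s1] k0; have sn1 : s ^+ n <= 1 by rewrite exprn_ile1// ltW.
have sn0 : 0 < s ^+ n by rewrite exprn_gt0.
have kR : 0 < k%:R :> R by rewrite ltr0n.
set m := (k ^ n)%N.
have A : (1 - s ^+ n) ^+ m * (1 + s ^+ n) ^+ m <= 1.
  rewrite -exprMn exprn_ile1//.
    by rewrite mulr_ge0 ?subr_ge0// addr_ge0// ltW.
  by rewrite -subr_sqr expr1n lerBlDr lerDl sqr_ge0.
have B : (k%:R * s) ^+ n <= (1 + s ^+ n) ^+ m.
  rewrite (le_trans _ (bernoulli_ge _ _))//; last by rewrite (le_trans _ (ltW sn0)); lra.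
  by rewrite exprMn -natrX mulr_natl lerDr.
rewrite exprVn -[leRHS]mul1r ler_pdivlMr ?exprn_gt0 ?mulr_gt0//.
apply: le_trans A; rewrite ler_wpM2l ?exprn_ge0 ?subr_ge0//.
Qed.

Lemma cvg_geom0 (q : R) : 0 <= q < 1 -> q ^+ n @[n --> \oo] --> (0 : R).
Proof. by move=> /andP[q0 q1]; apply: cvg_expr; rewrite ger0_norm. Qed.

(** An integer above [sin (pi a) ^- 2], so that [steps a t] stays in [0, 1]. For [0 < a < 1],
    [steps] equals [1 / stepk a] exactly where [sin (pi t) ^+ 2 = sin (pi a) ^+ 2], and there the
    step switches. *)
Definition stepk (a : R) : nat := (Num.trunc (sin (pi * a) ^- 2)).+1.

Definition steps (a t : R) : R := (stepk a)%:R^-1 * (sin (pi * a) ^- 2 * sin (pi * t) ^+ 2).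

(** The polynomial of the Brosowski-Deutsch proof of the Stone-Weierstrass theorem, evaluated at
    [steps a t]. *)
Definition stepp (a : R) (n : nat) (t : R) : R :=
  (1 - steps a t ^+ n) ^+ (stepk a ^ n).

Lemma steps01 (a t : R) : 0 <= steps a t <= 1.
Proof.
have k0 : 0 < (stepk a)%:R :> R by rewrite ltr0n.
have s2 : 0 <= sin (pi * a) ^- 2 by rewrite invr_ge0 sqr_ge0.
apply/andP; split; first by rewrite /steps mulr_ge0 ?invr_ge0 ?ler0n// mulr_ge0 ?sqr_ge0.
rewrite /steps mulrC ler_pdivrMr// mul1r.
apply: (@le_trans _ _ (sin (pi * a) ^- 2)).
  by rewrite ler_piMr// sqr_sin lerBlDr lerDl sqr_ge0.
by apply: ltW; rewrite /stepk; apply: truncnS_gt.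
Qed.

Lemma stepp01 a n t : 0 <= stepp a n t <= 1.
Proof. exact/step_poly_bounds/steps01. Qed.

Lemma trig_stepp a n c : trig (fun t => (stepp a n (t - c))%:C%C).
Proof.
suff H : trig (fun t => (stepp a n t)%:C%C) by exact: (trig_shift c H).
have K (p : R -> R) (z : R) : trig (fun t => (p t)%:C%C) -> trig (fun t => (z * p t)%:C%C).
  by move=> tp; under eq_fun do rewrite rmorphM; apply: trigM => //; exact: trig_cst.
have KX (p : R -> R) m : trig (fun t => (p t)%:C%C) -> trig (fun t => (p t ^+ m)%:C%C).
  by move=> tp; under eq_fun do rewrite rmorphXn; exact: trigX.
apply: (KX); under eq_fun do rewrite rmorphB rmorph1 -mulN1r.
apply: trigD; first exact: (trig_cst 1).
apply: trigM; first exact: (trig_cst (-1)).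
by apply: (KX); do 2 apply: (K); exact: trig_sin2.
Qed.

Lemma sin_pi_lt (a s : R) : 0 <= a -> a < s -> s < 1 - a -> sin (pi * a) < sin (pi * s).
Proof.
have p0 := @pi_gt0 R => a0.
have H (t : R) : a < t -> t <= 2^-1 -> sin (pi * a) < sin (pi * t).
  move=> at_ t2; have h1 : 0 <= pi * a by rewrite mulr_ge0 ?pi_ge0.
  have h2 : pi * a < pi * t by rewrite ltr_pM2l.
  have h3 : pi * t <= pi / 2 by rewrite ler_pM2l.
  by rewrite ltr_sin ?h2// in_itv /=; lra.
move=> as_ s1; have [|s2] := leP s 2^-1; first exact: H.
have -> : pi * s = - (pi * (1 - s)) + pi by ring.
by rewrite sinDpi sinN opprK; apply: H; lra.
Qed.

Lemma sin_pi_le (a s : R) : 0 <= a -> a <= s -> s <= 1 - a -> sin (pi * a) <= sin (pi * s).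
Proof.
move=> a0; rewrite le_eqVlt => /predU1P[<-//|as_].
rewrite le_eqVlt => /predU1P[->|s1]; last exact/ltW/sin_pi_lt.
have -> : pi * (1 - a) = - (pi * a) + pi by ring.
by rewrite sinDpi sinN opprK.
Qed.

Lemma sin_pi_gt0 (a : R) : 0 < a < 1 -> 0 < sin (pi * a).
Proof.
move=> /andP[a0 a1]; apply: sin_gt0_pi; have p0 := @pi_gt0 R.
by rewrite mulr_gt0//= -[ltRHS]mulr1 ltr_pM2l.
Qed.

Lemma sin_pi_norm (t : R) : sin (pi * t) ^+ 2 = sin (pi * `|t|) ^+ 2.
Proof.
have [t0|t0] := leP 0 t; first by rewrite ger0_norm.
by rewrite ltr0_norm// mulrN sinN sqrrN.
Qed.

(** [q] bounds [sin (pi t) ^+ 2 / sin (pi a) ^+ 2], that is [stepk a * steps a t]. Keeping it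
    explicit gives a rate uniform in [t], which the window needs and a pointwise limit would not
    give. *)
Lemma stepp_ge (a q t : R) n : 0 < a < 1 -> 
  sin (pi * t) ^+ 2 <= q * sin (pi * a) ^+ 2 -> 1 - q ^+ n <= stepp a n t.
Proof.
move=> a01 H; have sa := sin_pi_gt0 a01.
apply: (le_trans _ (step_poly_lo _ _ (steps01 a t))).
have k0 : (stepk a)%:R != 0 :> R by rewrite pnatr_eq0.
have q0 : 0 <= q by rewrite -(pmulr_lge0 _ (exprn_gt0 2 sa)) (le_trans _ H)// sqr_ge0.
have A : 0 <= sin (pi * a) ^- 2 * sin (pi * t) ^+ 2.
  by rewrite mulr_ge0 ?sqr_ge0// invr_ge0 sqr_ge0.
rewrite lerD2l lerN2 /steps mulVKf// lerXn2r//.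
by rewrite mulrC ler_pdivrMr ?exprn_gt0.
Qed.

Lemma stepp_le (a q t : R) n : 0 < a < 1 -> 0 < q ->
  q * sin (pi * a) ^+ 2 <= sin (pi * t) ^+ 2 -> stepp a n t <= q^-1 ^+ n.
Proof.
move=> a01 q0 H; have sa := sin_pi_gt0 a01.
have sa2 : 0 < sin (pi * a) ^+ 2 by rewrite exprn_gt0.
have st : 0 < sin (pi * t) ^+ 2 by apply: lt_le_trans H; rewrite mulr_gt0.
have k0 : (stepk a)%:R != 0 :> R by rewrite pnatr_eq0.
have kp : 0 < (stepk a)%:R :> R by rewrite ltr0n.
have s01 := steps01 a t.
have ss : 0 < steps a t by rewrite /steps mulr_gt0 ?invr_gt0// mulr_gt0 ?invr_gt0.
apply: (le_trans (step_poly_hi _ _ _)) => //.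
  by rewrite ss; case/andP: s01.
have qs : q <= sin (pi * a) ^- 2 * sin (pi * t) ^+ 2 by rewrite mulrC ler_pdivlMr.
have qp := lt_le_trans q0 qs.
rewrite /steps mulVKf// lerXn2r ?nnegrE ?invr_ge0 ?(ltW qp) ?(ltW q0)//.
by rewrite lef_pV2.
Qed.

Lemma stepp_cvg1 (a t : R) : 0 < a <= 2^-1 -> `|t| < a ->
  stepp a n t @[n --> \oo] --> (1 : R).
Proof.
move=> /andP[a0 a2] ta; have a01 : 0 < a < 1 by lra.
have sa := sin_pi_gt0 a01.
pose q := sin (pi * t) ^+ 2 / sin (pi * a) ^+ 2.
have q1 : 0 <= q < 1.
  rewrite divr_ge0 ?sqr_ge0//= ltr_pdivrMr ?exprn_gt0// mul1r sin_pi_norm.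
  have h : sin (pi * `|t|) < sin (pi * a) by apply: sin_pi_lt => //; lra.
  rewrite ltrXn2r// ?nnegrE ?(ltW sa)//.
  have [->|t0] := eqVneq t 0; first by rewrite normr0 mulr0 sin0.
  by apply/ltW/sin_pi_gt0; rewrite normr_gt0 t0/=; lra.
have := cvgB (cvg_cst (1 : R)) (cvg_geom0 q1); rewrite subr0 => H.
apply: (@squeeze_cvgr _ _ _ _ (fun n => 1 - q ^+ n) (fun=> 1)); [|exact: H|exact: cvg_cst].
apply: nearW => n; apply/andP; split.
  by apply: stepp_ge => //; rewrite divfK// gt_eqF ?exprn_gt0.
by case/andP: (stepp01 a n t).
Qed.

Lemma stepp_cvg0 (a t : R) : 0 < a <= 2^-1 -> a < `|t| -> `|t| < 1 - a ->
  stepp a n t @[n --> \oo] --> (0 : R).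
Proof.
move=> /andP[a0 a2] ta t1; have a01 : 0 < a < 1 by lra.
have sa := sin_pi_gt0 a01.
pose q := sin (pi * t) ^+ 2 / sin (pi * a) ^+ 2.
have q1 : 1 < q.
  rewrite ltr_pdivlMr ?exprn_gt0// mul1r (sin_pi_norm t).
  have h : sin (pi * a) < sin (pi * `|t|) by apply: sin_pi_lt => //; lra.
  by rewrite ltrXn2r// ?nnegrE ?(ltW sa)//; apply/ltW/(lt_trans sa h).
have qV : 0 <= q^-1 < 1 by rewrite invr_ge0 invf_lt1 ?q1 ?andbT; lra.
apply: (@squeeze_cvgr _ _ _ _ (fun=> 0) (fun n => q^-1 ^+ n)); [|exact: cvg_cst|exact: cvg_geom0].
apply: nearW => n; apply/andP; split.
  by case/andP: (stepp01 a n t).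
by apply: stepp_le => //; [lra|rewrite divfK// gt_eqF ?exprn_gt0].
Qed.

End step_trig.

(** * Density of the trigonometric polynomials in L^2 of the unit interval *)

Section dense.
Import HBNNSimple.
Context {R : realType}.
Notation lam := (@lebesgue_measure R).
Notation I1 := (@I1 R).
Implicit Types (f g : R -> R[i]).

Definition ind (A : set R) (t : R) : R[i] := (\1_A t)%:C%C.

(** The L^2 closure of the trigonometric polynomials cut to [I1]; the aim is to show that it
    contains every square integrable function vanishing off [I1]. *)
Definition trig_lim f := inL2 lam f /\ forall eps : R, 0 < eps ->
  exists2 p, trig p & (nsq lam (fun t => (f t - ind I1 t * p t)%R) <= eps%:E)%E.

Lemma trig_meas (p : R -> R[i]) : trig p -> cmeas p.
Proof.
move=> [s sE]; rewrite (_ : p = fun t => \sum_(q <- s) q.2 * expi (2 * pi * (q.1%:~R * t))); last exact/funext.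
apply: cmeas_sum => q; apply: cmeasM; first exact: cmeas_cst.
by apply: cmeas_expi; apply: measurable_funM => //; exact: measurable_lin.
Qed.

Lemma ind_trig_meas (p : R -> R[i]) : trig p -> cmeas (fun t => ind I1 t * p t).
Proof. by move=> tp; apply: cmeasM; [apply: cmeas_indic; exact: measurable_I1|exact: trig_meas]. Qed.

Lemma trig_limD f g : trig_lim f -> trig_lim g -> trig_lim (fun t => f t + g t).
Proof.
move=> [f2 fa] [g2 ga]; split; first exact: inL2D.
(* [nsqD] with [s = 1] doubles each of the two squares, hence the quarter. *)
move=> eps e0; have e4 : 0 < eps / 4 by rewrite divr_gt0.
have [p tp pf] := fa _ e4; have [q tq qg] := ga _ e4.
exists (fun t => p t + q t); first exact: trigD.
rewrite (_ : (fun t => _) = (fun t => (f t - ind I1 t * p t) + (g t - ind I1 t * q t))); last first.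
  by apply/funext => t; ring.
apply: (le_trans (@nsqD _ _ _ lam 1 (fun t => f t - ind I1 t * p t) (fun t => g t - ind I1 t * q t) ltr01 _ _)).
- by apply: cmeasD; [exact: f2.1|exact/cmeasN/ind_trig_meas].
- by apply: cmeasD; [exact: g2.1|exact/cmeasN/ind_trig_meas].
rewrite invr1; apply: (@le_trans _ _ ((1 + 1)%:E * (eps / 4)%:E + (1 + 1)%:E * (eps / 4)%:E)%E).
  by apply: leeD; apply: lee_wpmul2l => //; rewrite lee_fin; lra.
by rewrite -!EFinM -EFinD lee_fin; lra.
Qed.

Lemma trig_lim_lim f : inL2 lam f -> (forall eps : R, 0 < eps ->
    exists2 g, trig_lim g & (nsq lam (fun t => (f t - g t)%R) <= eps%:E)%E) ->
  trig_lim f.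
Proof.
move=> f2 H; split => // eps e0; have e4 : 0 < eps / 4 by rewrite divr_gt0.
have [g [g2 ga] fg] := H _ e4; have [p tp pg] := ga _ e4.
exists p => //.
rewrite (_ : (fun t => _) = (fun t => (f t - g t) + (g t - ind I1 t * p t))); last first.
  by apply/funext => t; ring.
apply: (le_trans (@nsqD _ _ _ lam 1 (fun t => f t - g t) (fun t => g t - ind I1 t * p t) ltr01 _ _)).
- by apply: cmeasD; [exact: f2.1|exact: cmeasN g2.1].
- by apply: cmeasD; [exact: g2.1|exact/cmeasN/ind_trig_meas].
rewrite invr1; apply: (@le_trans _ _ ((1 + 1)%:E * (eps / 4)%:E + (1 + 1)%:E * (eps / 4)%:E)%E).
  by apply: leeD; apply: lee_wpmul2l => //; rewrite lee_fin; lra.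
by rewrite -!EFinM -EFinD lee_fin; lra.
Qed.

Lemma trig_limZ z f : trig_lim f -> trig_lim (fun t => z * f t).
Proof.
move=> [f2 fa]; split; first exact: inL2Z.
move=> eps e0; have z0 : 0 < cabs z ^+ 2 + 1 by rewrite ltr_wpDl// sqr_ge0.
have [p tp pf] := fa _ (divr_gt0 e0 z0).
exists (fun t => z * p t); first by apply: trigM => //; exact: trig_cst.
rewrite (_ : (fun t => _) = (fun t => z * (f t - ind I1 t * p t))); last first.
  by apply/funext => t; ring.
rewrite nsqZ; last by apply: cmeasD; [exact: f2.1|exact/cmeasN/ind_trig_meas].
apply: (le_trans (lee_wpmul2l _ pf)); first by rewrite lee_fin sqr_ge0.
rewrite -EFinM lee_fin mulrA ler_pdivrMr// mulrC ler_wpM2l ?ltW//; lra.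
Qed.

Lemma ind_L2 A : measurable A -> inL2 lam (ind (A `&` I1)).
Proof.
move=> mA; have mAI : measurable (A `&` I1) by apply: measurableI => //; exact: measurable_I1.
apply: (inL2_le _ _ (e1_L2 0)).
  exact: cmeas_indic.
move=> t; rewrite cabs_e1 cabs_real ger0_norm// !indicE ler_nat.
by case: (boolP (t \in A `&` I1)) => //; rewrite !inE => -[_ It]; rewrite mem_set.
Qed.

Lemma trig_lim_dominated f (g : nat -> R -> R[i]) (h : R -> R) :
  inL2 lam f -> (forall n, trig_lim (g n)) -> measurable_fun setT h ->
  (forall n x, cabs (f x - g n x) <= h x) ->
  (\int[lam]_x (h x ^+ 2)%:E < +oo)%E ->
  {ae lam, forall x, cabs (f x - g n x) @[n --> \oo] --> (0 : R)} ->
  trig_lim f.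
Proof.
move=> f2 tg mh fgh hoo fg; apply: trig_lim_lim => // eps e0.
have [N _ H] := L2_dominated f2.1 (fun n => (tg n).1.1) mh fgh hoo fg e0.
by exists (g N); [exact: tg|apply: H => /=].
Qed.

Lemma trig_lim_trig p : trig p -> (forall t, cabs (p t) <= 1) -> trig_lim (fun t => ind I1 t * p t).
Proof.
move=> tp p1; split.
  apply: (inL2_le _ _ (e1_L2 0)); first exact: ind_trig_meas.
  move=> t; rewrite cabs_e1 cabsM cabs_real ger0_norm// ler_piMr//.
move=> eps e0; exists p => //; rewrite /nsq integral0_eq ?lee_fin ?ltW// => t _.
by rewrite subrr cabs0 expr0n.
Qed.

Lemma int_ind2 (c : R) : (\int[lam]_x ((c * \1_I1 x) ^+ 2)%:E < +oo)%E.
Proof.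
under eq_integral do rewrite exprMn indic_sqr EFinM.
rewrite ge0_integralZl//=; first by rewrite integral_indic_I1 mule1 ltry.
- by apply/measurable_EFinP; exact: measurable_indic measurable_I1.
- by rewrite lee_fin sqr_ge0.
Qed.

(** Within [I1] the set is an arc of centre [c] and half-length [a], and [stepp a n (t - c)] tends
    to its indicator. Convergence can fail only at the ends of the arc, [x] and [1/2]; by
    periodicity the latter shows up in [I1] as [-1/2]. *)
Lemma trig_lim_itv (x : R) : - 2^-1 <= x -> x < 2^-1 -> trig_lim (ind (`]x, +oo[ `&` I1)).
Proof.
move=> x1 x2; pose c := (x + 2^-1) / 2; pose a := (2^-1 - x) / 2.
have a02 : 0 < a <= 2^-1 by rewrite /a; lra.
pose p n t : R[i] := (stepp a n (t - c))%:C%C.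
have tp n : trig (p n) by exact: trig_stepp.
have mx : measurable (`]x, +oo[ : set R) by exact: measurable_itv.
apply: (@trig_lim_dominated _ (fun n t => ind I1 t * p n t) (fun t => 2 * \1_I1 t)).
- exact: ind_L2.
- move=> n; apply: trig_lim_trig => // t.
  by rewrite cabs_real ger0_norm; case/andP: (stepp01 a n (t - c)).
- by apply: measurable_funM => //; exact: measurable_indic measurable_I1.
- move=> n t; rewrite (le_trans (cabsD _ _))// cabsN cabsM !cabs_real !ger0_norm//; last first.
    by case/andP: (stepp01 a n (t - c)).
  have -> : 2 * \1_I1 t = \1_I1 t + \1_I1 t :> R by rewrite mulr2n mulrDl mul1r.
  apply: lerD.
    by rewrite !indicE ler_nat in_setI; case: (t \in I1); rewrite ?andbF ?andbT ?leq_b1.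
  by rewrite ler_piMr//; case/andP: (stepp01 a n (t - c)).
- exact: int_ind2.
- have H0 : lam.-negligible [set x; - 2^-1].
    exists [set x; - 2^-1]; split => //.
      by apply: measurableU; exact: measurable_set1.
    by apply: countable_lebesgue_measure0; apply: finite_set_countable; exact: finite_set2.
  suff H (t : R) : t <> x -> t <> - 2^-1 ->
      cabs (ind (`]x, +oo[ `&` I1) t - ind I1 t * p n t) @[n --> \oo] --> (0 : R).
    apply: (negligibleS _ H0) => t nt; apply: contrapT => tt; apply: nt.
    by apply: H => e; apply: tt; [left|right].
  move=> tx t2.
  have [tI|tI] := boolP (t \in I1); last first.
    rewrite (_ : (fun n => cabs (ind (`]x, +oo[ `&` I1) t - ind I1 t * p n t)) = fun=> 0); first exact: cvg_cst.
    apply/funext => n; rewrite /ind !indicE in_setI (negbTE tI) andbF mul0r subrr.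
    exact: cabs0.
  have /andP[tI1 tI2] : - 2^-1 <= t < 2^-1 by move: tI; rewrite inE /I1/= in_itv.
  have tI1' : - 2^-1 < t by rewrite lt_neqAle tI1 andbT eq_sym; apply/eqP.
  have E n : cabs (ind (`]x, +oo[ `&` I1) t - ind I1 t * p n t) =
      `|(x < t)%R%:R - stepp a n (t - c)|.
    rewrite /ind !indicE in_setI tI andbT mul1r /p -rmorphB cabs_real.
    by rewrite (_ : (t \in `]x, +oo[%classic) = (x < t)%R)// mem_setE in_itv/= andbT.
  have -> : (fun n => cabs (ind (`]x, +oo[ `&` I1) t - ind I1 t * p n t)) =
      (fun n => `|(x < t)%R%:R - stepp a n (t - c)|) by apply/funext => n; rewrite E.
  have L : stepp a n (t - c) @[n --> \oo] --> ((x < t)%R%:R : R).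
    have [xt|xt] := ltP x t.
      by apply: stepp_cvg1 => //; rewrite ltr_norml /c /a; lra.
    have xt' : t < x by rewrite lt_neqAle xt andbT; apply/eqP.
    have tc : t - c <= 0 by rewrite /c; lra.
    by apply: stepp_cvg0 => //; rewrite ler0_norm // /c /a; lra.
  rewrite [X in _ --> X](_ : (0 : R) = `|(x < t)%R%:R - (x < t)%R%:R|); last by rewrite subrr normr0.
  by apply: cvg_norm; apply: cvgB => //; exact: cvg_cst.
Qed.

(** Dynkin's pi-lambda theorem over the open rays: complements come from linearity, disjoint
    countable unions from dominated convergence. *)
Lemma trig_lim_ind A : measurable A -> trig_lim (ind (A `&` I1)).
Proof.
have E : @measurable _ R = <<s @RGenOInfty.G R >>.
  exact: RGenOInfty.measurableE.
have ext f g : f =1 g -> trig_lim f -> trig_lim g by move=> /funext ->.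
have one : trig_lim (ind I1).
  apply: (ext (fun t => ind I1 t * 1)); first by move=> t; rewrite mulr1.
  by apply: trig_lim_trig; [exact: trig_cst|move=> t; rewrite cabs1].
have zero : trig_lim (fun=> 0).
  by apply: (ext (fun t => 0 * ind I1 t)); [move=> t; rewrite mul0r|exact: trig_limZ].
have UD : forall A B : set R, A `&` B = set0 -> trig_lim (ind (A `&` I1)) -> trig_lim (ind (B `&` I1)) ->
    trig_lim (ind ((A `|` B) `&` I1)).
  move=> {}A B AB tA tB; apply: ext (trig_limD tA tB) => t.
  rewrite /ind -rmorphD !indicE !in_setI in_setU; congr (_ %:C)%C.
  have : (t \in A `&` B) = false by rewrite AB in_set0.
  rewrite in_setI; case: (t \in A); case: (t \in B); case: (t \in I1) => //= _; by rewrite ?addr0 ?add0r.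
move=> mA; rewrite E in mA.
apply: (@dynkin_induction _ R (@RGenOInfty.G R) (fun A => trig_lim (ind (A `&` I1)))) => //.
- move=> _ _ [x ->] [y ->]; exists (Num.max x y); apply/seteqP; split=> t /=.
    by rewrite !in_itv/= !andbT gt_max => -[-> ->].
  by rewrite !in_itv/= !andbT gt_max => /andP[].
- by rewrite setTI.
- move=> _ [x ->]; have [x1|x1] := ltP x (- 2^-1).
    rewrite (_ : _ `&` _ = I1)//; apply/seteqP; split=> t; first by case.
    move=> It; split => //; move: It; rewrite /I1 /= !in_itv/= andbT => /andP[+ _].
    exact: lt_le_trans.
  have [x2|x2] := ltP x 2^-1; first exact: trig_lim_itv.
  apply: ext zero => t; rewrite /ind indicE memNset// => -[].
  rewrite /I1 /= !in_itv/= andbT => xt /andP[_ t2].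
  by have := lt_trans xt t2; rewrite ltNge x2.
- move=> S mS tS.
  apply: ext (trig_limD one (trig_limZ (-1) tS)) => t.
  rewrite /ind mulN1r -rmorphB !indicE !in_setI in_setC; congr (_ %:C)%C.
  by case: (t \in S); case: (t \in I1); rewrite /= ?subrr ?subr0.
- move=> F mF tF HF.
  have HU n : trig_lim (ind ((\big[setU/set0]_(k < n) F k) `&` I1)).
    elim: n => [|n IH].
      apply: ext zero => t; by rewrite big_ord0 /ind indicE in_setI in_set0.
    rewrite big_ord_recr /=; apply: UD => //.
    by apply: (@trivIset_bigsetUI _ xpredT F) => //; exact: sub_trivIset tF.
  apply: (@trig_lim_dominated _ (fun n => ind ((\big[setU/set0]_(k < n) F k) `&` I1)) (fun t => 2 * \1_I1 t)) => //.
  + by apply: ind_L2; exact: bigcup_measurable.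
  + by apply: measurable_funM => //; exact: measurable_indic measurable_I1.
  + move=> n t; rewrite (le_trans (cabsD _ _))// cabsN !cabs_real !ger0_norm//.
    have -> : 2 * \1_I1 t = \1_I1 t + \1_I1 t :> R by rewrite mulr2n mulrDl mul1r.
    by apply: lerD; rewrite !indicE ler_nat in_setI; case: (t \in I1); rewrite ?andbF ?andbT ?leq_b1.
  + exact: int_ind2.
  + apply: aeW => t; apply: cvg_near_cst.
    have [[k _ Fkt]|nF] := pselect ((\bigcup_k F k) t).
      exists k.+1 => // n kn; have {}kn : (k < n)%N by [].
      have m1 : t \in \bigcup_k F k by rewrite inE; exists k.
      have m2 : t \in \big[setU/set0]_(k < n) F k by rewrite inE -bigcup_mkord; exists k.
      by rewrite /ind !indicE !in_setI m1 m2 subrr; exact: cabs0.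
    have m1 : (t \in \bigcup_k F k) = false by exact: memNset.
    apply: nearW => n.
    have m2 : (t \in \big[setU/set0]_(k < n) F k) = false.
      by apply: memNset; rewrite -bigcup_mkord => -[k _ Fk]; apply: nF; exists k.
    by rewrite /ind !indicE !in_setI m1 m2 subrr; exact: cabs0.
Qed.

Lemma trig_lim_sum (I : Type) (s : seq I) (F : I -> R -> R[i]) :
  (forall i, trig_lim (F i)) -> trig_lim (fun t => \sum_(i <- s) F i t).
Proof.
move=> mF; elim: s => [|i s IH]; last first.
  by under eq_fun do rewrite big_cons; exact: trig_limD.
under eq_fun do rewrite big_nil.
have := trig_limZ 0 (trig_lim_ind measurableT).
by under eq_fun do rewrite mul0r.
Qed.

Lemma trig_lim_nneg (u : R -> R) : measurable_fun setT u -> (forall t, 0 <= u t) ->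
  (forall t, ~ I1 t -> u t = 0) -> (\int[lam]_t (u t ^+ 2)%:E < +oo)%E ->
  trig_lim (fun t => (u t)%:C%C).
Proof.
move=> mu u0 uI uoo.
have mE : measurable_fun setT (EFin \o u) by exact/measurable_EFinP.
pose g := nnsfun_approx measurableT mE.
have gle n t : g n t <= u t.
  rewrite -lee_fin /g nnsfun_approxE; apply: (@le_approx _ _ _ setT (EFin \o u)) => // x _.
  by rewrite lee_fin.
have gu t : g n t @[n --> \oo] --> u t.
  have f0 : forall x : R, setT x -> (0 <= (EFin \o u) x)%E by move=> x _; rewrite lee_fin.
  by have /fine_cvgP[] := cvg_nnsfun_approx measurableT mE f0 (I : setT t).
have nu : forall t, cabs (u t)%:C%C = u t by move=> t; rewrite cabs_real ger0_norm.
apply: (@trig_lim_dominated _ (fun n t => (g n t)%:C%C) u) => //.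
- split; first exact: cmeas_real.
  by rewrite /nsq; under eq_integral do rewrite nu.
- move=> n.
  pose s := finmap.enum_fset (fset_set (range (g n))).
  rewrite (_ : (fun t => _) = fun t => \sum_(y <- s) y%:C%C * ind ((g n @^-1` [set y]) `&` I1) t); last first.
    apply/funext => t; rewrite {1}fimfunE fsbig_finite//= real_complex_sum; apply: eq_bigr => y _.
    rewrite rmorphM /ind !indicE in_setI.
    (* Off [I1] the simple function lies between 0 and [u t = 0]. So the nonzero levels live inside
       [I1], the level [y = 0] contributes nothing, and cutting the level sets to [I1] is
       harmless. *)
    have [tI|tI] := pselect (I1 t); first by rewrite (mem_set tI) andbT.
    rewrite (memNset tI) andbF mulr0.
    have gt0 : g n t = 0 by apply/eqP; rewrite eq_le -{1}(uI _ tI) gle fun_ge0.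
    have [<-|yn] := eqVneq (g n t) y; first by rewrite gt0 mul0r.
    by rewrite memNset ?mulr0//= => e; move: yn; rewrite e eqxx.
  apply: trig_lim_sum => y; apply: trig_limZ; apply: trig_lim_ind.
  by rewrite -[X in measurable X]setTI; exact: measurable_funP.
- move=> n t; rewrite -rmorphB cabs_real ger0_norm ?subr_ge0//.
  by rewrite lerBlDr lerDl fun_ge0.
- apply: aeW => t.
  have -> : (fun n => cabs ((u t)%:C%C - (g n t)%:C%C)) = (fun n => `|u t - g n t|).
    by apply/funext => n; rewrite -rmorphB cabs_real.
  rewrite [X in _ --> X](_ : (0 : R) = `|u t - u t|); last by rewrite subrr normr0.
  by apply: cvg_norm; apply: cvgB => //; exact: cvg_cst.
Qed.

Lemma trig_lim_real (u : R -> R) : measurable_fun setT u ->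
  (forall t, ~ I1 t -> u t = 0) -> (\int[lam]_t (u t ^+ 2)%:E < +oo)%E ->
  trig_lim (fun t => (u t)%:C%C).
Proof.
move=> mu uI uoo.
have K (v : R -> R) : measurable_fun setT v -> (forall t, 0 <= v t <= `|u t|) ->
    trig_lim (fun t => (v t)%:C%C).
  move=> mv v0; apply: trig_lim_nneg => //.
  - by move=> t; case/andP: (v0 t).
  - by move=> t /uI ut; apply/eqP; have := v0 t; rewrite ut normr0 eq_le andbC.
  - apply: le_lt_trans uoo; apply: ge0_le_integral => //.
    + by move=> t _; rewrite lee_fin sqr_ge0.
    + by apply/measurable_EFinP; exact: measurable_funX.
    + by apply/measurable_EFinP; exact: measurable_funX.
    + move=> t _; rewrite lee_fin -[leRHS]real_normK ?num_real//.
      by have /andP[a b] := v0 t; rewrite lerXn2r ?nnegrE.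
have := trig_limD (K (fun t => Num.max (u t) 0) _ _)
  (trig_limZ (-1) (K (fun t => Num.max (- u t) 0) _ _)).
rewrite (_ : (fun t => _ + _) = fun t => (u t)%:C%C); last first.
  apply/funext => t; rewrite mulN1r -rmorphB; congr (_ %:C)%C.
  have [h|h] := leP (u t) 0.
    by rewrite max_l ?oppr_ge0// sub0r opprK.
  by rewrite max_r ?subr0// oppr_le0 ltW.
apply.
- exact: measurable_maxr.
- by move=> t; rewrite le_max lexx orbT/= ge_max ler_norm normr_ge0.
- by apply: measurable_maxr => //; exact: measurable_funN.
- by move=> t; rewrite le_max lexx orbT/= ge_max -normrN ler_norm normr_ge0.
Qed.

Lemma trig_lim_L2 f : inL2 lam f -> (forall t, ~ I1 t -> f t = 0) -> trig_lim f.
Proof.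
move=> f2 fI; have [mf foo] := f2.
have K (v : R -> R) : measurable_fun setT v -> (forall t, `|v t| <= cabs (f t)) ->
    trig_lim (fun t => (v t)%:C%C).
  move=> mv v0; apply: trig_lim_real => //.
  - by move=> t /fI ft; apply/eqP; rewrite -normr_le0 -(@cabs0 R) -ft.
  - apply: le_lt_trans foo; apply: ge0_le_integral => //.
    + by move=> t _; rewrite lee_fin sqr_ge0.
    + by apply/measurable_EFinP; exact: measurable_funX.
    + exact: measurable_nsq.
    + move=> t _; rewrite lee_fin -[leLHS]real_normK ?num_real//.
      by rewrite lerXn2r ?nnegrE ?cabs_ge0.
have := trig_limD (K _ mf.1 (fun t => cabs_Re _))
  (trig_limZ (Complex 0 1) (K _ mf.2 (fun t => cabs_Im _))).
congr trig_lim; apply/funext => t; case: (f t) => a b.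
by apply: Cext; rewrite ?ReD ?ImD /=; ring.
Qed.

Lemma parseval1 f : inL2 lam f -> (forall t, ~ I1 t -> f t = 0) ->
  (\esum_(k in [set: int]) (cabs (cI lam (fun t => f t * expi (- (2 * pi * (k%:~R * t))))) ^+ 2)%:E
   = nsq lam f)%E.
Proof.
move=> f2 fI; rewrite -(parseval_dense e1_L2 e1_ortho f2).
  apply: eq_esum => k _; congr (_ ^+ 2)%:E; congr cabs; apply: cI_ext => t.
  rewrite /e1 conjcM conjc_expi conjc_real mulrA; congr (_ * _).
  have [tI|tI] := pselect (I1 t); first by rewrite indicE mem_set// mulr1.
  by rewrite fI// mul0r.
move=> eps e0; have [p tp pf] := (trig_lim_L2 f2 fI).2 eps e0.
have [s [a [us E]]] := trig_comb tp; exists s, a; split => //.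
by under eq_fun do rewrite -E.
Qed.

End dense.

(** * Lebesgue measure under affine maps *)

Section affine1.
Context {R : realType}.
Notation lam := (@lebesgue_measure R).

Lemma measurable_affine (a b : R) : measurable_fun setT (fun t : R => a * t + b).
Proof. by apply: measurable_funD => //; exact: measurable_lin. Qed.

Section fixed.
Variables (a b : R).
Hypothesis a0 : a != 0.

Let phi (t : measurableTypeR R) : measurableTypeR R := a * t + b.
Let mphi : measurable_fun setT phi. Proof. exact: measurable_affine. Qed.
Let na : {nonneg R} := NngNum (normr_ge0 a).

Let nu : {measure set (measurableTypeR R) -> \bar R} :=
  mscale na (measure_function_pushforward__canonical__measure_function_Measure lam mphi).

(** Uniqueness of Lebesgue measure: it is enough to compare on the intervals []x, y]]. For [a < 0]
    their preimages are closed on the left and open on the right. *)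
Lemma lebesgue_affine A : measurable A -> lam A = (`|a|%:E * lam (phi @^-1` A))%E.
Proof.
move=> mA; apply: (@lebesgue_measure_unique _ nu) => // _ [[x y]] /= xy <-.
rewrite /nu/= /mscale/= /pushforward/=.
have [a_gt0|] := ltP 0 a.
  rewrite (_ : phi @^-1` `]x, y] = `](x - b) / a, (y - b) / a]%classic); last first.
    apply/seteqP; split=> t; rewrite /phi /= !in_itv/= ltr_pdivrMr// ler_pdivlMr// ltrBlDr lerBrDr mulrC//.
  rewrite !lebesgue_measure_itv/= !lte_fin ltr_pM2r ?invr_gt0// ltrD2r.
  case: ifPn => _; rewrite ?mule0// -!EFinD -EFinM gtr0_norm//; congr EFin; field.
  by [].
rewrite le_eqVlt (negbTE a0)/= => a_lt0.
rewrite (_ : phi @^-1` `]x, y] = `[(y - b) / a, (x - b) / a[%classic); last first.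
  apply/seteqP; split=> t; rewrite /phi /= !in_itv/= ltr_ndivlMr// ler_ndivrMr// ltrBlDr lerBrDr mulrC andbC//.
rewrite !lebesgue_measure_itv/= !lte_fin ltr_nM2r ?invr_lt0// ltrD2r.
case: ifPn => _; rewrite ?mule0// -!EFinD -EFinM ltr0_norm//; congr EFin; field.
by [].
Qed.

Lemma ge0_integral_affine (h : R -> \bar R) : measurable_fun setT h ->
  (forall t, 0 <= h t)%E ->
  (\int[lam]_t h t = `|a|%:E * \int[lam]_t h (a * t + b)%R)%E.
Proof.
move=> mh h0.
rewrite (eq_measure_integral nu); last by move=> A mA _; exact: lebesgue_affine.
rewrite ge0_integral_mscale//; congr (_ * _)%E.
by rewrite ge0_integral_pushforward.
Qed.

End fixed.
End affine1.

(** * Linear substitutions in several variables *)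

Section lebesgue_cV.
Context {R : realType}.
Notation lam := (@lebesgue_measure R).
Notation mu := (lebesgue_cV R).
Local Open Scope ereal_scope.

Lemma ge0_integral_cV0 (h : 'cV[R]_0 -> \bar R) : measurable_fun setT h ->
  \int[mu 0]_x h x = h 0%R.
Proof. by move=> mh; rewrite integral_dirac// diracT mul1e. Qed.

Lemma ge0_integral_cVS n (h : 'cV[R]_n.+1 -> \bar R) : measurable_fun setT h ->
  (forall x, 0 <= h x) ->
  \int[mu n.+1]_x h x = \int[lam]_t \int[mu n]_x h (cV_cons (t, x)).
Proof.
move=> mh h0; rewrite /= /lebesgue_cV_step ge0_integral_pushforward//=; last exact: measurable_cV_cons.
rewrite preimage_setT fubini_tonelli1//=.
exact: (measurableT_comp mh (@measurable_cV_cons R n)).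
Qed.

(** The other order of integration: a matrix that adds the remaining coordinates to the first one
    acts on the inner variable [t] by an affine map. *)
Lemma ge0_integral_cVS' n (h : 'cV[R]_n.+1 -> \bar R) : measurable_fun setT h ->
  (forall x, 0 <= h x) ->
  \int[mu n.+1]_x h x = \int[mu n]_x \int[lam]_t h (cV_cons (t, x)).
Proof.
move=> mh h0; rewrite ge0_integral_cVS//.
apply: (@fubini_tonelli _ _ _ _ R lam (mu n) (h \o @cV_cons R n)) => //=.
exact: (measurableT_comp mh (@measurable_cV_cons R n)).
Qed.

Lemma measurable_fun_cV_slice n (h : 'cV[R]_n.+1 -> \bar R) : measurable_fun setT h ->
  forall t, measurable_fun setT (fun x => h (cV_cons (t, x))).
Proof.
move=> mh t; apply: (measurableT_comp mh).
exact: (measurableT_comp (@measurable_cV_cons R n) (pair1_measurable t)).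
Qed.

Lemma measurable_fun_cV_slice' n (h : 'cV[R]_n.+1 -> \bar R) : measurable_fun setT h ->
  forall x, measurable_fun setT (fun t => h (cV_cons (t, x))).
Proof.
move=> mh x; apply: (measurableT_comp mh).
exact: (measurableT_comp (@measurable_cV_cons R n) (pair2_measurable x)).
Qed.

Lemma measurable_integral_cV n (h : 'cV[R]_n.+1 -> \bar R) : measurable_fun setT h ->
  (forall x, 0 <= h x) -> measurable_fun setT (fun x => \int[lam]_t h (cV_cons (t, x))).
Proof.
move=> mh h0; apply: (@measurable_fun_fubini_tonelli_G _ _ _ _ R lam (h \o @cV_cons R n)) => //=.
exact: (measurableT_comp mh (@measurable_cV_cons R n)).
Qed.

Lemma measurable_mulmx m n (A : 'M[R]_(m, n)) : measurable_fun setT (fun x : 'cV[R]_n => A *m x).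
Proof.
apply: measurable_fun_cVP => i /=.
rewrite (_ : _ \o _ = fun x => (\sum_(j < n) A i j * cV_coord j x)%R); last first.
  by apply/funext => x; rewrite /= /cV_coord mxE.
apply: measurable_sum => j; apply: measurable_funM => //.
exact: measurable_cV_coord.
Qed.

Lemma measurable_cVD d' (T : measurableType d') n (f g : T -> 'cV[R]_n) :
  measurable_fun setT f -> measurable_fun setT g ->
  measurable_fun setT (fun x => (f x + g x)%R).
Proof.
move=> mf mg; apply: measurable_fun_cVP => i.
rewrite (_ : _ \o _ = (fun x => (cV_coord i (f x) + cV_coord i (g x))%R)).
  by apply: measurable_funD; apply: measurableT_comp => //; exact: measurable_cV_coord.
by apply/funext => x; rewrite /= /cV_coord mxE.
Qed.

Lemma measurable_cVN d' (T : measurableType d') n (f : T -> 'cV[R]_n) :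
  measurable_fun setT f -> measurable_fun setT (fun x => (- f x)%R).
Proof.
move=> mf; apply: measurable_fun_cVP => i.
rewrite (_ : _ \o _ = (fun x => (- cV_coord i (f x))%R)).
  by apply: measurable_funN; apply: measurableT_comp => //; exact: measurable_cV_coord.
by apply/funext => x; rewrite /= /cV_coord mxE.
Qed.

Lemma measurable_cV_affine m n (A : 'M[R]_(m, n)) (b : 'cV[R]_m) :
  measurable_fun setT (fun x : 'cV[R]_n => (A *m x + b)%R).
Proof. by apply: measurable_cVD; [exact: measurable_mulmx|exact: measurable_cst]. Qed.

Lemma cV_consD n (p q : R * 'cV[R]_n) :
  (cV_cons p + cV_cons q = cV_cons (p.1 + q.1, p.2 + q.2))%R.
Proof. by rewrite /cV_cons; apply: (etrans (@add_col_mx R 1 n 1 _ _ _ _)); rewrite raddfD. Qed.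

Lemma mulmx_cV_cons n (a : R) (b : 'rV[R]_n) (c : 'cV[R]_n) (D : 'M[R]_n) (p : R * 'cV[R]_n) :
  (@block_mx R 1 n 1 n a%:M b c D *m cV_cons p =
   cV_cons (a * p.1 + (b *m p.2) 0 0, p.1 *: c + D *m p.2))%R.
Proof.
rewrite /cV_cons mul_block_col /=; congr col_mx.
  apply/matrixP => i j; rewrite !ord1 !mxE !big_ord1 !mxE !eqxx !mulr1n.
  by [].
by rewrite mul_mx_scalar.
Qed.

Lemma ge0_integral_shift n (b : 'cV[R]_n) (h : 'cV[R]_n -> \bar R) :
  measurable_fun setT h -> (forall x, 0 <= h x) ->
  \int[mu n]_x h x = \int[mu n]_x h (x + b)%R.
Proof.
elim: n b h => [|n IH] b h mh h0.
  by congr integral; apply/funext => x; congr h; apply/matrixP => -[].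
have mhb : measurable_fun setT (fun x : 'cV[R]_n.+1 => h (x + b)%R).
  apply: (measurableT_comp mh); apply: measurable_cVD => //; exact: measurable_cst.
rewrite (ge0_integral_cVS mh h0) (ge0_integral_cVS mhb (fun x => h0 _)).
have bE : b = cV_cons (cV_uncons b) by rewrite cV_unconsK.
have mF : measurable_fun setT (fun t => \int[mu n]_x h (cV_cons (t, x))).
  apply: (@measurable_fun_fubini_tonelli_F _ _ _ _ R (mu n) (h \o @cV_cons R n)) => //=.
  exact: (measurableT_comp mh (@measurable_cV_cons R n)).
rewrite (@ge0_integral_affine R 1 (cV_uncons b).1 (oner_neq0 _))//; last first.
  by move=> t; apply: integral_ge0.
rewrite normr1 mul1e; apply: eq_integral => t _; rewrite mul1r.
rewrite (IH (cV_uncons b).2); last by [].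
  by apply: eq_integral => x _; rewrite {3}bE cV_consD.
exact: measurable_fun_cV_slice.
Qed.

(* Block elimination: a pivot is made nonzero by adding a row, then both
   triangular factors are handled one variable at a time. *)
Definition scales_volume n (A : 'M[R]_n) := forall h : 'cV[R]_n -> \bar R,
  measurable_fun setT h -> (forall x, 0 <= h x) ->
  \int[mu n]_x h x = `|(\det A)%R|%:E * \int[mu n]_x h (A *m x)%R.

Lemma scales_volumeM n (A B : 'M[R]_n) : scales_volume A -> scales_volume B ->
  scales_volume (A *m B).
Proof.
move=> hA hB h mh h0; rewrite (hA h)// (hB (fun x => h (A *m x)%R))//.
  rewrite muleA det_mulmx normrM EFinM.
  by congr (_ * _); apply: eq_integral => x _; rewrite mulmxA.
exact: (measurableT_comp mh (measurable_mulmx A)).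
Qed.

Lemma det_upper n (a : R) (b : 'rV[R]_n) (D : 'M[R]_n) :
  (\det (@block_mx R 1 n 1 n a%:M b 0 D : 'M[R]_n.+1) = a * \det D)%R.
Proof. by have := @det_ublock R 1 n a%:M b D; rewrite det_scalar1; exact. Qed.

Lemma det_lower n (c : 'cV[R]_n) :
  (\det (@block_mx R 1 n 1 n 1%:M 0 c 1%:M : 'M[R]_n.+1) = 1)%R.
Proof. by have := @det_lblock R 1 n 1%:M c 1%:M; rewrite !det1 mulr1; exact. Qed.

Lemma scales_volume_upper n (a : R) (b : 'rV[R]_n) (D : 'M[R]_n) :
  a != 0%R -> scales_volume D -> scales_volume (@block_mx R 1 n 1 n a%:M b 0 D).
Proof.
move=> a0 hD h mh h0.
have mhA : measurable_fun setT (fun x => h (@block_mx R 1 n 1 n a%:M b 0 D *m x)%R).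
  exact: (measurableT_comp mh (measurable_mulmx _)).
rewrite [RHS]muleC ge0_integral_cVS'// [in RHS]ge0_integral_cVS'//.
under [in RHS]eq_integral do under eq_integral do rewrite mulmx_cV_cons /= scaler0 add0r.
rewrite det_upper normrM mulrC EFinM muleC -muleA.
rewrite (hD (fun x => \int[lam]_t h (cV_cons (t, x)))); last 2 first.
- exact: measurable_integral_cV.
- by move=> x; apply: integral_ge0.
congr (_ * _); rewrite -ge0_integralZl//; last 2 first.
- apply: (@measurable_fun_fubini_tonelli_G _ _ _ _ R lam
    (fun p : R * 'cV[R]_n => h (cV_cons (a * p.1 + (b *m p.2) 0 0, D *m p.2)%R))) => //.
  apply: (measurableT_comp mh); apply: (measurableT_comp (@measurable_cV_cons R n)).
  apply: measurable_fun_pair => /=.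
    apply: measurable_funD; first by apply: measurable_funM => //; exact: measurable_cst.
    have mb : measurable_fun setT (fun x : 'cV[R]_n => (b *m x)%R 0%R 0%R).
      rewrite (_ : (fun x : 'cV[R]_n => _) = fun x => (\sum_(j < n) b 0 j * cV_coord j x)%R); last first.
        by apply/funext => x; rewrite mxE.
      by apply: measurable_sum => j; apply: measurable_funM => //; exact: measurable_cV_coord.
    exact: (measurableT_comp mb measurable_snd).
  exact: (measurableT_comp (measurable_mulmx D) measurable_snd).
- by move=> x _; apply: integral_ge0.
apply: eq_integral => x _.
rewrite (@ge0_integral_affine R a ((b *m x) 0 0)%R a0)//.
exact: measurable_fun_cV_slice'.
Qed.

Lemma scales_volume_lower n (c : 'cV[R]_n) :
  scales_volume (@block_mx R 1 n 1 n 1%:M 0 c 1%:M).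
Proof.
move=> h mh h0.
have mhA : measurable_fun setT (fun x => h (@block_mx R 1 n 1 n 1%:M 0 c 1%:M *m x)%R).
  exact: (measurableT_comp mh (measurable_mulmx _)).
rewrite det_lower normr1 mul1e.
rewrite (ge0_integral_cVS mh h0).
rewrite (ge0_integral_cVS mhA (fun x => h0 _)).
apply: eq_integral => t _.
under [in RHS]eq_integral do rewrite mulmx_cV_cons /= mul0mx mxE addr0 mul1r mul1mx addrC.
rewrite (ge0_integral_shift (t *: c)%R)//.
exact: measurable_fun_cV_slice.
Qed.

Lemma scales_volume_unit n (A : 'M[R]_n) : A \in unitmx -> scales_volume A.
Proof.
elim: n A => [|n IH] A uA.
  move=> h mh h0; rewrite det_mx00 normr1 mul1e.
  by apply: eq_integral => x _; congr h; apply/matrixP => -[].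
have main (B : 'M[R]_n.+1) : B \in unitmx -> B 0%R 0%R != 0%R -> scales_volume B.
  move=> uB B0; pose a := B 0%R 0%R.
  pose b := @ursubmx R 1 n 1 n B; pose c := @dlsubmx R 1 n 1 n B.
  pose D := @drsubmx R 1 n 1 n B.
  have aE : @ulsubmx R 1 n 1 n B = a%:M.
    apply/matrixP => i j; rewrite !ord1 !mxE eqxx mulr1n /a.
    by congr (B _ _); exact/val_inj.
  (* The lower corner of the upper triangular factor is the Schur complement of the pivot [a]; the
     induction hypothesis applies to it. *)
  have BE : B = (@block_mx R 1 n 1 n 1%:M 0 (a^-1 *: c) 1%:M *m
                 @block_mx R 1 n 1 n a%:M b 0 (D - a^-1 *: c *m b))%R.
    rewrite mulmx_block !mul1mx !mul0mx !addr0 mul_mx_scalar.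
    rewrite scalerA mulfV// scale1r addrC subrK -aE.
    by rewrite -[LHS](@submxK R 1 n 1 n).
  have uS : (D - a^-1 *: c *m b)%R \in unitmx.
    move: uB; rewrite unitmxE BE det_mulmx det_lower mul1r.
    by rewrite det_upper unitrM => /andP[].
  rewrite BE; apply: scales_volumeM; first exact: scales_volume_lower.
  by apply: scales_volume_upper => //; exact: IH.
have [A0|A0] := eqVneq (A 0%R 0%R) 0%R; last exact: main.
have [i Ai0] : exists i : 'I_n, A (lift ord0 i) 0%R != 0%R.
  apply/existsP; apply: contraT; rewrite negb_exists => /forallP H.
  move: uA; rewrite unitmxE (expand_det_col _ 0%R) big1 ?unitr0// => j _.
  have [k ->|->] := unliftP ord0 j; last by rewrite A0 mul0r.
  by have := H k; rewrite negbK => /eqP ->; rewrite mul0r.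
pose b : 'rV[R]_n := delta_mx 0%R i.
(* Left multiplication by [U 1] adds row [lift ord0 i] to the top row, whose first entry becomes
   nonzero; [U (-1)] undoes it. *)
pose U (s : R) : 'M[R]_n.+1 := @block_mx R 1 n 1 n 1%:M (s *: b)%R 0 1%:M.
have UU : (A = U (-1) *m (U 1 *m A))%R.
  have E : (U (-1) *m U 1 = 1%:M)%R.
    have := @mulmx_block R 1 n 1 n 1 n 1%:M (-1 *: b)%R 0 1%:M 1%:M (1 *: b)%R 0 1%:M.
    rewrite !mul1mx !mulmx1 !mul0mx !mulmx0 !addr0 !add0r -scalerDl subrr scale0r.
    by rewrite -(@scalar_mx_block R 1 n); exact.
  by rewrite mulmxA E mul1mx.
have scU s : scales_volume (U s).
  apply: scales_volume_upper; first exact: oner_neq0.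
  by move=> h mh h0; rewrite det1 normr1 mul1e; apply: eq_integral => x _; rewrite mul1mx.
have uU s : U s \in unitmx by rewrite unitmxE det_upper det1 mulr1 unitr1.
rewrite UU; apply: scales_volumeM; first exact: scU.
apply: main; first by rewrite unitmx_mul uU.
rewrite mxE (bigD1 (0 : 'I_n.+1)%R)//= A0 mulr0 add0r.
rewrite (bigD1 (lift ord0 i))//= big1 ?addr0.
  have -> : U 1%R 0%R (lift ord0 i) = 1%R.
    rewrite (_ : lift ord0 i = @rshift 1 n i); last exact/val_inj.
    rewrite (_ : 0%R = @lshift 1 n 0%R); last exact/val_inj.
    by rewrite /U (@block_mxEur R 1 n 1 n) !mxE !eqxx mul1r.
  by rewrite mul1r.
move=> j /andP[j0 ji].
have [k jk|jk] := unliftP ord0 j; last by rewrite jk eqxx in j0.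
rewrite jk (_ : U 1%R 0%R (lift ord0 k) = 0%R) ?mul0r//.
rewrite (_ : lift ord0 k = @rshift 1 n k); last exact/val_inj.
rewrite (_ : 0%R = @lshift 1 n 0%R :> 'I_n.+1); last exact/val_inj.
rewrite /U (@block_mxEur R 1 n 1 n) !mxE eqxx/= mul1r.
by case: eqVneq => // ki; rewrite jk ki eqxx in ji.
Qed.

End lebesgue_cV.

(** * Integrals of countable sums *)

Section integral_esum.
Context {R : realType} {d : measure_display} {X : measurableType d}.
Variable mu : {measure set X -> \bar R}.
Local Open Scope ereal_scope.

(** The enumeration is chosen before the family [a], so that a single reindexing serves for all [x]
    at once when the terms depend on [x]. The empty set is apart because the partial inverse needs a
    default point. *)
Lemma countable_esumE (T : choiceType) (A : set T) : countable A ->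
  A = set0 \/ exists e : nat -> T, exists P : set nat,
    (forall n, P n -> A (e n)) /\
    forall a : T -> \bar R, (forall x, A x -> 0 <= a x) ->
      \esum_(x in A) a x = \sum_(n <oo) (if n \in P then a (e n) else 0).
Proof.
have [->|/set0P[x0 Ax0]] := eqVneq A set0; first by left.
move=> /countable_injP[f fi]; right.
have eb := injpinv_bij (cst x0) fi.
exists ('pinv_(cst x0) A f), (f @` A); split.
  by move=> n Pn; have [h _ _] := eb; apply: h.
move=> a a0; rewrite (reindex_esum _ _ _ a eb) esum_mkcond nneseries_esumT// => n.
by case: ifPn => //; rewrite inE => Pn; apply: a0; have [h _ _] := eb; apply: h.
Qed.

Lemma measurable_esum (T : choiceType) (A : set T) (a : T -> X -> \bar R) :
  countable A -> (forall i, A i -> measurable_fun setT (a i)) ->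
  (forall i x, A i -> 0 <= a i x) ->
  measurable_fun setT (fun x => \esum_(i in A) a i x).
Proof.
move=> /countable_esumE[->|[e [P [PA H]]]] ma a0.
  by under eq_fun do rewrite esum_set0; exact: measurable_cst.
under eq_fun => x do rewrite (H (a^~ x) (fun i => a0 i x)).
apply: ge0_emeasurable_sum => [n x _ _|n _].
  by case: ifPn => //; rewrite inE => /PA /a0.
by have [Pn|] := boolP (n \in P); [apply: ma; apply: PA; rewrite inE in Pn|move=> _; exact: measurable_cst].
Qed.

Lemma integral_esum (T : choiceType) (A : set T) (a : T -> X -> \bar R) :
  countable A -> (forall i, A i -> measurable_fun setT (a i)) ->
  (forall i x, A i -> 0 <= a i x) ->
  \int[mu]_x (\esum_(i in A) a i x) = \esum_(i in A) \int[mu]_x a i x.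
Proof.
move=> /countable_esumE[->|[e [P [PA H]]]] ma a0.
  under eq_integral do rewrite esum_set0.
  by rewrite esum_set0 integral0.
under eq_integral => x _ do rewrite (H (a^~ x) (fun i => a0 i x)).
rewrite integral_nneseries//.
- rewrite H; last by move=> i Ai; apply: integral_ge0 => x _; exact: a0.
  apply: eq_eseriesr => n _; case: ifPn => // _.
  by rewrite integral0.
- by move=> n; have [Pn|] := boolP (n \in P); [apply: ma; apply: PA; rewrite inE in Pn|move=> _; exact: measurable_cst].
- by move=> n x _; case: ifPn => //; rewrite inE => /PA /a0.
Qed.

Lemma esumZl (T : choiceType) (A : set T) (a : T -> \bar R) (c : R) :
  (0 <= c)%R -> countable A -> (forall i, A i -> 0 <= a i) ->
  \esum_(i in A) (c%:E * a i) = c%:E * \esum_(i in A) a i.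
Proof.
move=> c0 /countable_esumE[->|[e [P [PA H]]]] a0; first by rewrite !esum_set0 mule0.
rewrite !H//; last by move=> i Ai; rewrite mule_ge0// ?lee_fin// a0.
rewrite -nneseriesZl//.
  by apply: eq_eseriesr => n _; case: ifPn => // _; rewrite mule0.
by move=> n _; case: ifPn => //; rewrite inE => /PA /a0.
Qed.

End integral_esum.

(** * Change of variables: from nonnegative to complex integrands *)

Section change_of_variables.
Context {R : realType} {d1 d2 : measure_display} {X : measurableType d1}
  {Y : measurableType d2}.
Variables (mu : {measure set X -> \bar R}) (nu : {measure set Y -> \bar R}).
Variables (phi : X -> Y) (c : R).
Hypothesis mphi : measurable_fun setT phi.
Hypothesis c0 : 0 < c.
Hypothesis H : (forall h : Y -> \bar R, measurable_fun setT h -> (forall y, 0 <= h y) ->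
    \int[nu]_y h y = c%:E * \int[mu]_x h (phi x))%E.
Implicit Types f : Y -> R[i].

Lemma cmeas_phi f : cmeas f -> cmeas (fun x => f (phi x)).
Proof. by move=> [f1 f2]; split; [exact: (measurableT_comp f1)|exact: (measurableT_comp f2)]. Qed.

Lemma nsq_cov f : cmeas f -> (nsq nu f = c%:E * nsq mu (fun x => f (phi x)))%E.
Proof.
move=> mf; rewrite /nsq H//; first exact: measurable_nsq.
by move=> y; rewrite lee_fin sqr_ge0.
Qed.

Lemma inL2_cov f : inL2 nu f -> inL2 mu (fun x => f (phi x)).
Proof.
move=> [mf foo]; split; first exact: cmeas_phi.
move: foo; rewrite nsq_cov//; case: (nsq mu _) (nsq_ge0 mu (fun x => f (phi x))) => [r| |]//.
  by move=> _ _; exact: ltry.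
by rewrite gt0_muley ?lte_fin// ltxx.
Qed.

Lemma cint_cov f : cint nu f -> cint mu (fun x => f (phi x)).
Proof.
move=> [mf foo]; split; first exact: cmeas_phi.
move: foo; rewrite (H (h := fun y => (cabs (f y))%:E)).
- have : (0 <= \int[mu]_x (cabs (f (phi x)))%:E)%E.
    by apply: integral_ge0 => x _; rewrite lee_fin cabs_ge0.
  case: (\int[mu]_x _)%E => [r| |]//; first by move=> _ _; exact: ltry.
  by rewrite gt0_muley ?lte_fin// ltxx.
- by apply/measurable_EFinP; exact: measurable_cabs.
- by move=> y; rewrite lee_fin cabs_ge0.
Qed.

Lemma cint_covV f : cmeas f -> cint mu (fun x => f (phi x)) -> cint nu f.
Proof.
move=> mf [_ foo]; split => //; rewrite (H (h := fun y => (cabs (f y))%:E)).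
- by rewrite lte_mul_pinfty// ?lee_fin ?ltW.
- by apply/measurable_EFinP; exact: measurable_cabs.
- by move=> y; rewrite lee_fin cabs_ge0.
Qed.

Lemma cI_cov f : cint nu f -> cI nu f = c%:C%C * cI mu (fun x => f (phi x)).
Proof.
move=> fi; have fi' := cint_cov fi.
have K (u : Y -> R) : measurable_fun setT u ->
    mu.-integrable setT (EFin \o (fun x => u (phi x))) ->
    (\int[nu]_y u y = c * \int[mu]_x u (phi x))%R.
  move=> mu' ui; rewrite -RintegralZl// /Rintegral; congr fine.
  have mE : measurable_fun setT (EFin \o u) by exact/measurable_EFinP.
  under [RHS]eq_integral do rewrite EFinM.
  rewrite integralZl// [in RHS]integralE [LHS]integralE.
  rewrite muleBr//; last first.
    by apply: fin_num_adde_defl; rewrite fin_numN; exact: integrable_neg_fin_num.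
  rewrite (H (h := (EFin \o u)^\+%E)) ?(H (h := (EFin \o u)^\-%E))//.
  - congr (_ * _ - _ * _)%E; apply: eq_integral => y _; first by rewrite !funeposE.
    by rewrite !funenegE.
  - exact: measurable_funeneg.
  - exact: measurable_funepos.
apply: Cext; rewrite ?ReZ ?ImZ /=.
- exact: K fi.1.1 (cint_Re fi').
- exact: K fi.1.2 (cint_Im fi').
Qed.

End change_of_variables.

Section cV.
Context {R : realType}.
Notation lam := (@lebesgue_measure R).
Notation mu := (lebesgue_cV R).

Lemma ge0_integral_affine_cV n (D : 'M[R]_n) (b : 'cV[R]_n) (h : 'cV[R]_n -> \bar R) :
  D \in unitmx -> measurable_fun setT h -> (forall x, 0 <= h x)%E ->
  (\int[mu n]_x h x = `|\det D|%:E * \int[mu n]_x h (D *m x + b)%R)%E.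
Proof.
move=> uD mh h0; rewrite (ge0_integral_shift b mh h0).
rewrite (scales_volume_unit uD (h := fun x => h (x + b)%R))//.
apply: (measurableT_comp mh); apply: measurable_cVD => //; exact: measurable_cst.
Qed.

Lemma det_gt0 n (D : 'M[R]_n) : D \in unitmx -> 0 < `|\det D|.
Proof. by move=> uD; rewrite normr_gt0; move: uD; rewrite unitmxE unitfE. Qed.

(** The factor [1%:E] gives the formula the shape expected by the change of variables lemmas. *)
Lemma ge0_integral_prod_cV n (h : 'cV[R]_n.+1 -> \bar R) :
  measurable_fun setT h -> (forall x, 0 <= h x)%E ->
  (\int[mu n.+1]_x h x = 1%:E * \int[lam \x mu n]_p h (cV_cons p))%E.
Proof.
move=> mh h0; rewrite mul1e /= /lebesgue_cV_step ge0_integral_pushforward//=; last exact: measurable_cV_cons.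
Qed.

Lemma cI_cVS n (f : 'cV[R]_n.+1 -> R[i]) : cint (mu n.+1) f ->
  cI (mu n.+1) f = cI lam (fun t => cI (mu n) (fun x => f (cV_cons (t, x)))).
Proof.
move=> fi; have fi' := cint_cov (mu := (lam \x mu n)%E) (@measurable_cV_cons R n) ltr01 (@ge0_integral_prod_cV n) fi.
rewrite (cI_cov (mu := (lam \x mu n)%E) (@measurable_cV_cons R n) ltr01 (@ge0_integral_prod_cV n) fi) mul1r.
exact: cI_fubini1 fi'.
Qed.

Lemma cmeas_cons n (f : 'cV[R]_n.+1 -> R[i]) : cmeas f ->
  cmeas (fun p : measurableTypeR R * 'cV[R]_n => f (cV_cons p)).
Proof. exact: (cmeas_phi (@measurable_cV_cons R n)). Qed.

Lemma cmeas_slice n (f : 'cV[R]_n.+1 -> R[i]) t : cmeas f -> cmeas (fun x => f (cV_cons (t, x))).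
Proof.
by move=> mf; apply: (@cmeas_pair2 R _ _ (measurableTypeR R) _ (fun p => f (cV_cons p))); exact: cmeas_cons.
Qed.

Lemma cmeas_cI_slice n (f : 'cV[R]_n.+1 -> R[i]) : cmeas f ->
  cmeas (fun t => cI (mu n) (fun x => f (cV_cons (t, x)))).
Proof.
move=> mf; apply: (@cmeas_cI2 R _ _ (measurableTypeR R) _ (mu n) (fun p => f (cV_cons p))).
exact: cmeas_cons.
Qed.

End cV.

(** * Parseval on the cube and Plancherel *)

Section vcons.
Context {T : Type}.

(** [cV_cons] over any type, so that integer frequencies and real vectors are split in the same
    way. *)
Definition vcons n (p : T * 'cV[T]_n) : 'cV[T]_n.+1 :=
  \col_i oapp (fun j => p.2 j 0) p.1 (unlift ord0 i).

Lemma vcons0 n (p : T * 'cV[T]_n) : vcons p ord0 0 = p.1.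
Proof. by rewrite mxE unlift_none. Qed.

Lemma vconsS n (p : T * 'cV[T]_n) i : vcons p (lift ord0 i) 0 = p.2 i 0.
Proof. by rewrite mxE liftK. Qed.

Lemma vcons_bij n : bijective (@vcons n).
Proof.
exists (fun v : 'cV[T]_n.+1 => (v ord0 0, \col_i v (lift ord0 i) 0)).
  move=> [a v]; rewrite vcons0; congr pair; apply/matrixP => i j.
  by rewrite mxE vconsS !ord1.
move=> v; apply/matrixP => i j; rewrite !ord1.
by have [k ->|->] := unliftP ord0 i; rewrite ?vconsS ?vcons0//= mxE.
Qed.

End vcons.

(** * Parseval on the unit cube *)

Section cube.
Context {R : realType}.
Notation lam := (@lebesgue_measure R).
Notation mu := (lebesgue_cV R).
Notation I1 := (@I1 R).

Lemma cV_consE n : @cV_cons R n = @vcons R n.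
Proof.
apply/funext => p; apply/matrixP => i j; rewrite !ord1.
have [k ->|->] := unliftP ord0 i; rewrite ?vconsS ?vcons0 /cV_cons.
  rewrite (_ : lift ord0 k = @rshift 1 n k); last exact/val_inj.
  by rewrite (@col_mxEd R 1 n 1).
rewrite (_ : ord0 = @lshift 1 n 0); last exact/val_inj.
by rewrite (@col_mxEu R 1 n 1) mxE eqxx mulr1n.
Qed.

Lemma dotp_cons n (p q : R * 'cV[R]_n) : dotp (vcons p) (vcons q) = p.1 * q.1 + dotp p.2 q.2.
Proof.
rewrite /dotp big_ord_recl !vcons0; congr (_ + _).
by apply: eq_bigr => i _; rewrite !vconsS.
Qed.

Lemma map_vcons n (p : int * 'cV[int]_n) :
  map_mx intr (vcons p) = vcons (p.1%:~R, map_mx intr p.2) :> 'cV[R]_n.+1.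
Proof.
apply/matrixP => i j; rewrite !ord1 mxE.
by have [k ->|->] := unliftP ord0 i; rewrite ?vconsS ?vcons0//= mxE.
Qed.

Lemma dotpDl n (x y z : 'cV[R]_n) : dotp (x + y) z = dotp x z + dotp y z.
Proof. by rewrite /dotp -big_split/=; apply: eq_bigr => i _; rewrite mxE mulrDl. Qed.

Lemma dotpC n (x y : 'cV[R]_n) : dotp x y = dotp y x.
Proof. by rewrite /dotp; apply: eq_bigr => i _; rewrite mulrC. Qed.

Lemma dotpDr n (x y z : 'cV[R]_n) : dotp z (x + y) = dotp z x + dotp z y.
Proof. by rewrite dotpC dotpDl !(dotpC z). Qed.

Lemma dotpZl n a (x z : 'cV[R]_n) : dotp (a *: x) z = a * dotp x z.
Proof. by rewrite /dotp mulr_sumr; apply: eq_bigr => i _; rewrite mxE mulrA. Qed.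

Lemma dotpNl n (x z : 'cV[R]_n) : dotp (- x) z = - dotp x z.
Proof. by rewrite -scaleN1r dotpZl mulN1r. Qed.

Lemma dotp_mulmx n (D : 'M[R]_n) x y : dotp x (D *m y) = dotp (D^T *m x) y.
Proof.
have dE (u v : 'cV[R]_n) : dotp u v = (u^T *m v) 0 0.
  by rewrite mxE; apply: eq_bigr => i _; rewrite mxE.
by rewrite !dE trmx_mul trmxK mulmxA.
Qed.

Lemma measurable_dotp d' (X : measurableType d') n (f g : X -> 'cV[R]_n) :
  measurable_fun setT f -> measurable_fun setT g ->
  measurable_fun setT (fun x => dotp (f x) (g x)).
Proof.
move=> mf mg; apply: measurable_sum => i; apply: measurable_funM.
- exact: (measurableT_comp (measurable_cV_coord i) mf).
- exact: (measurableT_comp (measurable_cV_coord i) mg).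
Qed.

Definition bx (J : set R) n : set 'cV[R]_n := [set x | forall i, J (x i 0)].

Arguments bx : clear implicits.

Lemma bx_cons J n (p : R * 'cV[R]_n) : bx J n.+1 (vcons p) <-> J p.1 /\ bx J n p.2.
Proof.
split=> [H|[H1 H2] i].
  split; first by have := H ord0; rewrite vcons0.
  by move=> i; have := H (lift ord0 i); rewrite vconsS.
by have [k ->|->] := unliftP ord0 i; rewrite ?vconsS ?vcons0.
Qed.

Lemma indic_bx_cons J n t (x : 'cV[R]_n) :
  \1_(bx J n.+1) (vcons (t, x)) = \1_J t * \1_(bx J n) x :> R.
Proof.
rewrite !indicE -natrM mulnb; congr (_%:R); congr nat_of_bool.
apply/idP/idP; first by rewrite inE => /bx_cons[/= h1 h2]; rewrite !mem_set.
by move=> /andP[]; rewrite !inE => h1 h2; apply/bx_cons.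
Qed.

Lemma measurable_bx J n : measurable J -> measurable (bx J n).
Proof.
move=> mJ; rewrite (_ : bx J n = \bigcap_(i in [set: 'I_n]) (cV_coord i @^-1` J)); last first.
  by apply/seteqP; split => x H i; [move=> _; exact: H|exact: H].
apply: fin_bigcap_measurable => // i _; rewrite -[X in measurable X]setTI.
exact: measurable_cV_coord.
Qed.

Lemma bxS J n : measurable J -> (mu n.+1 (bx J n.+1) = lam J * mu n (bx J n))%E.
Proof.
move=> mJ.
have E k : mu k (bx J k) = (\int[mu k]_x (\1_(bx J k) x)%:E)%E.
  by rewrite integral_indic ?setIT//; exact: measurable_bx.
rewrite E ge0_integral_cVS//; last first.
  by apply/measurable_EFinP; apply: measurable_indic; exact: measurable_bx.
under eq_integral do under eq_integral do rewrite cV_consE indic_bx_cons EFinM.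
under eq_integral => t _.
  rewrite ge0_integralZl//; last first.
    by apply/measurable_EFinP; apply: measurable_indic; exact: measurable_bx.
  rewrite -E; over.
rewrite /= ge0_integralZr//; last by apply/measurable_EFinP; exact: measurable_indic.
by rewrite integral_indic// setIT.
Qed.

Lemma bx_finite J n : measurable J -> (lam J < +oo)%E -> (mu n (bx J n) < +oo)%E.
Proof.
move=> mJ Joo; elim: n => [|n IH]; first by rewrite /= diracE; case: (_ \in _); rewrite ltry.
by rewrite bxS// lte_mul_pinfty// ge0_fin_numE.
Qed.

Lemma inL2_indic d' (X : measurableType d') (m : {measure set X -> \bar R}) (A : set X) :
  measurable A -> (m A < +oo)%E -> inL2 m (fun x => (\1_A x)%:C%C).
Proof.
move=> mA Aoo; split; first exact: cmeas_indic.
rewrite /nsq; under eq_integral do rewrite cabs_real ger0_norm// indic_sqr.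
by rewrite integral_indic// setIT.
Qed.

Lemma inL2_cint d' (X : measurableType d') (m : {measure set X -> \bar R}) (A : set X)
  (f : X -> R[i]) : measurable A -> (m A < +oo)%E -> (forall x, ~ A x -> f x = 0) ->
  inL2 m f -> cint m f.
Proof.
move=> mA Aoo fA f2; apply: cint_ext (cintM (inL2_indic mA Aoo) f2) => x.
have [Ax|nAx] := pselect (A x); first by rewrite indicE mem_set// mul1r.
by rewrite fA// mulr0.
Qed.

Definition Q n := bx I1 n.
Arguments Q : clear implicits.

Lemma Q_finite n : (mu n (Q n) < +oo)%E.
Proof. by apply: bx_finite; [exact: measurable_I1|rewrite lebesgue_I1 ltry]. Qed.

Lemma mu_Q n : mu n (Q n) = 1%E.
Proof.
elim: n => [|n IH]; last first.
  by rewrite /Q bxS; [rewrite lebesgue_I1 mul1e|exact: measurable_I1].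
by rewrite /= diracE mem_set// => -[].
Qed.

Lemma measurable_Q n : measurable (Q n).
Proof. by apply: measurable_bx; exact: measurable_I1. Qed.

Lemma esum_cV n (a : 'cV[int]_n.+1 -> \bar R) : (forall k, 0 <= a k)%E ->
  (\esum_(k in [set: 'cV[int]_n.+1]) a k =
   \esum_(k0 in [set: int]) \esum_(k in [set: 'cV[int]_n]) a (vcons (k0, k)))%E.
Proof.
move=> a0; rewrite esum_esum//.
have b : set_bij setT setT (@vcons int n) by rewrite setTT_bijective; exact: vcons_bij.
rewrite (reindex_esum _ _ _ a b); congr esum.
  by apply/esym/seteqP; split.
Qed.

Lemma cmeas_expi_dotp n (k : 'cV[R]_n) : cmeas (fun x => expi (- (2 * pi * dotp k x))).
Proof.
apply: cmeas_expi; apply: measurable_funN; apply: measurable_funM => //.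
exact: measurable_dotp.
Qed.

Lemma countable_Zn n : countable [set: 'cV[int]_n].
Proof. exact: countableP. Qed.

Lemma exchange_esum (S T : choiceType) (a : S -> T -> \bar R) :
  (forall i j, 0 <= a i j)%E ->
  (\esum_(i in [set: S]) \esum_(j in [set: T]) a i j =
   \esum_(j in [set: T]) \esum_(i in [set: S]) a i j)%E.
Proof.
move=> a0; rewrite !esum_esum//.
rewrite (_ : [set: S] `*`` (fun=> [set: T]) = [set: S * T]); last by apply/seteqP; split.
rewrite (_ : [set: T] `*`` (fun=> [set: S]) = [set: T * S]); last by apply/seteqP; split.
have b : set_bij [set: S * T] [set: T * S] (fun p => (p.2, p.1)).
  by rewrite setTT_bijective; exists (fun p => (p.2, p.1)) => -[].
by rewrite (reindex_esum _ _ _ _ b).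
Qed.

(** Induction on the dimension: each slice [fs t] is expanded in the last [n] variables, then each
    coefficient function [G k] in the first. Slices are square integrable for almost every [t] only,
    so the slice identities hold almost everywhere before being integrated. *)
Lemma parseval_cube n (f : 'cV[R]_n -> R[i]) : inL2 (mu n) f ->
  (forall x, ~ Q n x -> f x = 0) ->
  (\esum_(k in [set: 'cV[int]_n])
     (cabs (cI (mu n) (fun x => f x * expi (- (2 * pi * dotp (map_mx intr k) x)))) ^+ 2)%:E
   = nsq (mu n) f)%E.
Proof.
elim: n f => [|n IH] f f2 fQ.
  rewrite (_ : [set: 'cV[int]_0] = [set 0]); last first.
    by apply/seteqP; split => // x _ /=; apply/matrixP => -[].
  rewrite esum_set1 ?lee_fin ?sqr_ge0//.
  have m0 (u : 'cV[R]_0 -> \bar R) : measurable_fun setT u.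
    rewrite (_ : u = cst (u 0)); first exact: measurable_cst.
    by apply/funext => x; congr u; apply/matrixP => -[].
  have d0 (u : 'cV[R]_0 -> R) : (\int[mu 0]_x u x = u 0)%R.
    by rewrite /Rintegral ge0_integral_cV0.
  rewrite /nsq ge0_integral_cV0// /cI !d0.
  by rewrite /dotp big_ord0 mulr0 oppr0 expi0 mulr1; case: (f 0).
have mf := f2.1.
have fi : cint (mu n.+1) f by exact: (inL2_cint (@measurable_Q _) (Q_finite _) fQ f2).
pose fs t x := f (cV_cons (t, x)).
pose G (k : 'cV[int]_n) t := cI (mu n) (fun x => fs t x * expi (- (2 * pi * dotp (map_mx intr k) x))).
have mfs t : cmeas (fs t) by exact: cmeas_slice.
have nsqE : nsq (mu n.+1) f = (\int[lam]_t nsq (mu n) (fs t))%E.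
  by rewrite /nsq ge0_integral_cVS//; [exact: measurable_nsq|move=> x; rewrite lee_fin sqr_ge0].
have mnsq : measurable_fun setT (fun t => nsq (mu n) (fs t)).
  apply: (@measurable_fun_fubini_tonelli_F _ _ (measurableTypeR R) _ R (mu n)
    (fun p => (cabs (f (cV_cons p)) ^+ 2)%:E)) => //; last by move=> x; rewrite lee_fin sqr_ge0.
  by apply: measurable_nsq; exact: cmeas_cons.
have ae2 : {ae lam, forall t, inL2 (mu n) (fs t)}.
  have : lam.-integrable setT (fun t => nsq (mu n) (fs t)).
    apply/integrableP; split => //.
    under eq_integral do rewrite gee0_abs ?nsq_ge0//.
    by rewrite -nsqE; exact: f2.2.
  move/integrable_ae => /(_ measurableT); apply: filterS => t /(_ I) ft; split => //.
  by rewrite ltey_eq ft.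
have fsQ t x : ~ Q n x -> fs t x = 0.
  by move=> nQ; apply: fQ; rewrite cV_consE => /bx_cons[].
have fsI t x : ~ I1 t -> fs t x = 0.
  by move=> nI; apply: fQ; rewrite cV_consE => /bx_cons[].
have mG k : cmeas (G k).
  (* Frequency 0 in the first variable presents [G k] as a slice integral of a function measurable
     on the larger space. *)
  pose h x := f x * expi (- (2 * pi * dotp (vcons (0, map_mx intr k)) x)).
  rewrite (_ : G k = fun t => cI (mu n) (fun x => h (cV_cons (t, x)))).
    by apply: cmeas_cI_slice; apply: cmeasM => //; exact: cmeas_expi_dotp.
  apply/funext => t; apply: cI_ext => x.
  by rewrite /h /fs cV_consE dotp_cons /= mul0r add0r.
have aeG : {ae lam, forall t,
    \esum_(k in [set: 'cV[int]_n]) (cabs (G k t) ^+ 2)%:E = nsq (mu n) (fs t)}%E.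
  move: ae2; apply: (@filterS _ _ (ae_filter_ringOfSetsType _)) => t ft2; rewrite /G IH//.
  by move=> x; exact: fsQ.
have sumG : (\esum_(k in [set: 'cV[int]_n]) nsq lam (G k) = nsq (mu n.+1) f)%E.
  rewrite nsqE /nsq -integral_esum//.
  - apply: ge0_ae_eq_integral => //.
    + apply: measurable_esum => [|k _|k t _]; [exact: countable_Zn| |by rewrite lee_fin sqr_ge0].
      by apply: measurable_nsq; exact: mG.
    + by move=> t _; apply: esum_ge0 => k _; rewrite lee_fin sqr_ge0.
    + by move=> t _; exact: nsq_ge0.
    + by move: aeG; apply: (@filterS _ _ (ae_filter_ringOfSetsType _)) => t + _.
  - exact: countable_Zn.
  - by move=> k _; apply: measurable_nsq; exact: mG.
  - by move=> k t _; rewrite lee_fin sqr_ge0.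
have G2 k : inL2 lam (G k).
  split; first exact: mG.
  apply: le_lt_trans f2.2; rewrite -sumG.
  have := @seq_le_esum R _ setT (fun k => nsq lam (G k)) [:: k] isT.
  by rewrite big_seq1; apply.
have GI k t : ~ I1 t -> G k t = 0.
  move=> nI; rewrite /G -(cI0 (mu n)); apply: cI_ext => x; by rewrite fsI// mul0r.
rewrite esum_cV; last by move=> k; rewrite lee_fin sqr_ge0.
rewrite -sumG.
have -> : (\esum_(k in [set: 'cV[int]_n]) nsq lam (G k) = \esum_(k in [set: 'cV[int]_n])
   \esum_(k0 in [set: int]) (cabs (cI lam (fun t => (G k t * expi (- (2 * pi * (k0%:~R * t))))%R)) ^+ 2)%:E)%E.
  by apply: eq_esum => k _; rewrite parseval1// => t; exact: GI.
rewrite [RHS]exchange_esum; last by move=> k k0; rewrite lee_fin sqr_ge0.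
apply: eq_esum => k0 _; apply: eq_esum => k _; congr (cabs _ ^+ 2)%:E.
rewrite cI_cVS; last first.
  by under eq_fun do rewrite mulrC; apply: cint_expi => //; apply: measurable_funN;
    apply: measurable_funM => //; exact: measurable_dotp.
pose fe x := f x * expi (- (2 * pi * dotp (map_mx intr (vcons (k0, k))) x)).
apply: (@cI_ae _ _ _ lam (fun t => cI (mu n) (fun x => fe (cV_cons (t, x))))
  (fun t => G k t * expi (- (2 * pi * (k0%:~R * t))))).
- by apply: cmeas_cI_slice; apply: cmeasM => //; exact: cmeas_expi_dotp.
- apply: cmeasM; first exact: mG.
  apply: cmeas_expi; apply: measurable_funN.
  by apply: measurable_funM => //; exact: measurable_lin.
move: ae2; apply: (@filterS _ _ (ae_filter_ringOfSetsType _)) => t ft2.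
have fti : cint (mu n) (fs t) by exact: (inL2_cint (@measurable_Q _) (Q_finite _) (fsQ t) ft2).
rewrite /G -cIZr; last first.
  by under eq_fun do rewrite mulrC; apply: cint_expi => //; apply: measurable_funN;
    apply: measurable_funM => //; exact: measurable_dotp.
apply: cI_ext => x; rewrite /fe cV_consE map_vcons dotp_cons /=.
rewrite -[RHS]mulrA -[X in _ = _ * X]expiD.
by congr (_ * expi _); rewrite /fs ?cV_consE//; ring.
Qed.

End cube.

Arguments bx {R} J n _.
Arguments Q {R} n _.

(** * Periodisation and Plancherel for compactly supported functions *)

Section plancherel.
Context {R : realType}.
Notation lam := (@lebesgue_measure R).
Notation mu := (lebesgue_cV R).
Notation I1 := (@I1 R).
Notation Q := (@Q R).

Lemma fourierE n (f : 'cV[R]_n -> R[i]) xi :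
  fourier f xi = cI (mu n) (fun x => expi (- (2 * pi * dotp x xi)) * f x).
Proof. by []. Qed.

Definition zR n (m : 'cV[int]_n) : 'cV[R]_n := map_mx intr m.

(** The index of the lattice translate of [Q] that contains [x]: nearest integers, halves rounded
    up. *)
Definition cell n (x : 'cV[R]_n) : 'cV[int]_n := \col_i Num.floor (x i 0 + 2^-1).

Lemma cellP n (x : 'cV[R]_n) (m : 'cV[int]_n) : Q n (x - zR m) <-> m = cell x.
Proof.
split=> [H|-> i].
  apply/matrixP => i j; rewrite !ord1 mxE; apply/esym.
  have := H i; rewrite /I1 /= in_itv/= !mxE => /andP[h1 h2].
  apply: floor_def; rewrite intrD; apply/andP; split; lra.
rewrite /I1 /= in_itv/= !mxE.
have := floor_itv (x i 0 + 2^-1); rewrite intrD => /andP[h1 h2].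
apply/andP; split; lra.
Qed.

Lemma measurable_cVDr n (m : 'cV[R]_n) : measurable_fun setT (fun x : 'cV[R]_n => x + m).
Proof. by apply: measurable_cVD => //; exact: measurable_cst. Qed.

Lemma measurable_Qshift n (m : 'cV[R]_n) : measurable [set x | Q n (x - m)].
Proof.
rewrite -[X in measurable X]setTI.
exact: (measurable_cVDr (- m) measurableT (@measurable_Q R n)).
Qed.

Lemma measurable_indic_Q n (m : 'cV[R]_n) :
  measurable_fun setT (fun x : 'cV[R]_n => (\1_(Q n) (x - m) : R)).
Proof.
rewrite (_ : (fun x : 'cV[R]_n => _) = \1_[set x | Q n (x - m)]); last exact/funext.
exact: measurable_indic (measurable_Qshift m).
Qed.

Lemma integral_cells n (h : 'cV[R]_n -> \bar R) : measurable_fun setT h ->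
  (forall x, 0 <= h x)%E ->
  (\int[mu n]_x h x =
   \esum_(m in [set: 'cV[int]_n]) \int[mu n]_x (h x * (\1_(Q n) (x - zR m))%:E))%E.
Proof.
move=> mh h0; rewrite -integral_esum.
- apply: eq_integral => x _.
  rewrite (esumID [set cell x])//; last by move=> m _; rewrite mule_ge0// lee_fin.
  rewrite setTI esum_set1; last by rewrite mule_ge0// lee_fin.
  rewrite esum1 ?adde0.
    by rewrite indicE mem_set ?mule1//; exact/cellP.
  move=> m /= [_ mx]; rewrite indicE memNset ?mule0// => /cellP mE.
  by apply: mx; rewrite mE.
- exact: countable_Zn.
- move=> m _; apply: emeasurable_funM => //; apply/measurable_EFinP.
  exact: measurable_indic_Q.
- by move=> m x _; rewrite mule_ge0// lee_fin.
Qed.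

Lemma integral_cells_shift n (h : 'cV[R]_n -> \bar R) : measurable_fun setT h ->
  (forall x, 0 <= h x)%E ->
  (\int[mu n]_x h x =
   \int[mu n]_x \esum_(m in [set: 'cV[int]_n]) (h (x + zR m)%R * (\1_(Q n) x)%:E))%E.
Proof.
move=> mh h0; rewrite integral_cells// integral_esum.
- apply: eq_esum => m _.
  rewrite (ge0_integral_shift (zR m)).
  + by apply: eq_integral => x _; rewrite addrK.
  + apply: emeasurable_funM => //; apply/measurable_EFinP.
    exact: measurable_indic_Q.
  + by move=> x; rewrite mule_ge0// lee_fin.
- exact: countable_Zn.
- move=> m _; apply: emeasurable_funM; first exact: (measurableT_comp mh (measurable_cVDr _)).
  by apply/measurable_EFinP; apply: measurable_indic; exact: measurable_Q.
- by move=> m x _; rewrite mule_ge0// lee_fin.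
Qed.

Lemma cmeas_fourier n (f : 'cV[R]_n -> R[i]) : cmeas f -> cmeas (fourier f).
Proof.
move=> mf; rewrite (_ : fourier f = fun xi => cI (mu n) (fun x => expi (- (2 * pi * dotp x xi)) * f x)); last exact/funext.
apply: (cmeas_cI2 (mu n) (f := fun p : 'cV[R]_n * 'cV[R]_n => expi (- (2 * pi * dotp p.2 p.1)) * f p.2)).
apply: cmeasM; last exact: (cmeas_phi measurable_snd mf).
apply: cmeas_expi; apply: measurable_funN; apply: measurable_funM => //.
exact: measurable_dotp.
Qed.

Lemma cint_fourier n (f : 'cV[R]_n -> R[i]) xi : cint (mu n) f ->
  cint (mu n) (fun x => expi (- (2 * pi * dotp x xi)) * f x).
Proof.
move=> fi; apply: cint_expi => //; apply: measurable_funN; apply: measurable_funM => //.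
exact: measurable_dotp.
Qed.

Lemma fourier_bounded n (f : 'cV[R]_n -> R[i]) : cint (mu n) f ->
  exists2 C : R, 0 <= C & forall xi, cabs (fourier f xi) <= C.
Proof.
move=> fi; exists (fine (\int[mu n]_x (cabs (f x))%:E)).
  by apply/fine_ge0/integral_ge0 => x _; rewrite lee_fin cabs_ge0.
move=> xi; rewrite -lee_fin fineK; last first.
  by rewrite ge0_fin_numE; [exact: fi.2|apply: integral_ge0 => x _; rewrite lee_fin cabs_ge0].
rewrite fourierE (le_trans (cabs_cI (cint_fourier xi fi)))//.
by under eq_integral do rewrite cabsM cabs_expi mul1r.
Qed.

Lemma fourierD n (f g : 'cV[R]_n -> R[i]) xi : cint (mu n) f -> cint (mu n) g ->
  fourier (fun x => f x + g x) xi = fourier f xi + fourier g xi.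
Proof.
move=> fi gi; rewrite !fourierE -cID; try exact: cint_fourier.
by apply: cI_ext => x; rewrite mulrDr.
Qed.

Lemma fourierZ n z (f : 'cV[R]_n -> R[i]) xi : cint (mu n) f ->
  fourier (fun x => z * f x) xi = z * fourier f xi.
Proof.
move=> fi; rewrite !fourierE -cIZ; last exact: cint_fourier.
by apply: cI_ext => x; rewrite mulrCA.
Qed.

Lemma integral_Q n : (\int[mu n]_x (\1_(Q n) x)%:E = 1)%E.
Proof.
rewrite integral_indic//; last exact: measurable_Q.
by rewrite setIT; exact: mu_Q.
Qed.

(* On the cube, Parseval holds for each shifted lattice [zR m + u]; integrating
   over [u] gives Plancherel. *)
Lemma plancherel_cube n (f : 'cV[R]_n -> R[i]) : inL2 (mu n) f ->
  (forall x, ~ Q n x -> f x = 0) -> nsq (mu n) (fourier f) = nsq (mu n) f.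
Proof.
move=> f2 fQ; have mf := f2.1.
rewrite /nsq integral_cells_shift; last 2 first.
- by apply: measurable_nsq; exact: cmeas_fourier.
- by move=> x; rewrite lee_fin sqr_ge0.
have key u : (\esum_(m in [set: 'cV[int]_n]) (cabs (fourier f (u + zR m)) ^+ 2)%:E = nsq (mu n) f)%E.
  (* Modulation by [u] shifts the transform by [u] and leaves the modulus of [f] unchanged. *)
  pose g x := expi (- (2 * pi * dotp x u)) * f x.
  have mg : cmeas (fun x : 'cV[R]_n => expi (- (2 * pi * dotp x u))).
    apply: cmeas_expi; apply: measurable_funN; apply: measurable_funM => //.
    exact: measurable_dotp.
  have g2 : inL2 (mu n) g.
    by apply: (inL2_mulb (M := 1)) f2 => // x; rewrite cabs_expi.
  have -> : nsq (mu n) f = nsq (mu n) g.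
    by rewrite /nsq; apply: eq_integral => x _; rewrite /g cabsM cabs_expi mul1r.
  rewrite -(parseval_cube g2); last by move=> x nQ; rewrite /g fQ// mulr0.
  apply: eq_esum => m _; congr (cabs _ ^+ 2)%:E; rewrite fourierE; apply: cI_ext => x.
  rewrite /g [RHS]mulrAC -[X in _ = X * _]expiD; congr (expi _ * _).
  by rewrite dotpDr (dotpC x (zR m)) /zR; ring.
transitivity (\int[mu n]_x (nsq (mu n) f * (\1_(Q n) x)%:E))%E.
  apply: eq_integral => u _; rewrite -(key u).
  have [uQ|uQ] := pselect (Q n u).
    by rewrite indicE mem_set// mule1; apply: eq_esum => m _; rewrite mule1.
  by rewrite indicE memNset// mule0 esum1// => m _; rewrite mule0.
rewrite ge0_integralZl//; last 2 first.
- by apply/measurable_EFinP; apply: measurable_indic; exact: measurable_Q.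
- exact: nsq_ge0.
by rewrite integral_Q mule1.
Qed.

(** The strict inequality lets a dilation carry the open cube into the half-open [Q]. *)
Definition supp n (f : 'cV[R]_n -> R[i]) (r : R) :=
  forall x : 'cV[R]_n, ~ (forall i, `|x i 0| < r) -> f x = 0.

Definition box (r : R) n : set 'cV[R]_n := bx `[- r, r]%classic n.

Arguments box : clear implicits.

Lemma supp_box n (f : 'cV[R]_n -> R[i]) r : supp f r ->
  forall x, ~ box r n x -> f x = 0.
Proof.
move=> fr x nx; apply: fr => H; apply: nx => i.
by rewrite /= in_itv/= -ler_norml ltW.
Qed.

Lemma bx_itv_finite n (r : R) : (mu n (box r n) < +oo)%E.
Proof.
apply: bx_finite; first exact: measurable_itv.
by rewrite lebesgue_measure_itv; case: ifPn => _; rewrite ?ltry.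
Qed.

Lemma measurable_bx_itv n (r : R) : measurable (box r n).
Proof. by apply: measurable_bx; exact: measurable_itv. Qed.

Lemma supp_cint n (f : 'cV[R]_n -> R[i]) r : supp f r -> inL2 (mu n) f -> cint (mu n) f.
Proof.
move=> fr f2.
exact: (inL2_cint (@measurable_bx_itv n r) (@bx_itv_finite n r) (supp_box fr) f2).
Qed.

(** Dilation by [2 * r] reduces to the cube. The transform gains a factor [c], squared in the norm:
    one [c] is absorbed by the substitution in frequency, the other by the one in space. *)
Lemma plancherel n (f : 'cV[R]_n -> R[i]) r : inL2 (mu n) f -> 0 < r -> supp f r ->
  nsq (mu n) (fourier f) = nsq (mu n) f.
Proof.
move=> f2 r0 fr; have fi := supp_cint fr f2.
pose D : 'M[R]_n := (2 * r)%:M.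
have uD : D \in unitmx.
  by rewrite unitmxE det_scalar unitfE expf_neq0// mulf_neq0// gt_eqF.
have c0 := det_gt0 uD; set c := `|\det D| in c0.
have H h := @ge0_integral_affine_cV R n D 0 h uD.
have mphi := @measurable_cV_affine R n n D 0.
pose g x := f (D *m x + 0).
have g2 : inL2 (mu n) g := inL2_cov mphi c0 H f2.
have gQ x : ~ Q n x -> g x = 0.
  move=> nQ; apply: fr => L; apply: nQ => i; have := L i.
  rewrite addr0 mul_scalar_mx mxE normrM gtr0_norm ?mulr_gt0//.
  rewrite /I1 /= in_itv/= => h.
  have : `|x i 0| < 2^-1 by rewrite -(ltr_pM2l r0); lra.
  by rewrite ltr_norml => /andP[h1 h2]; rewrite h2 ltW.
have gi : cint (mu n) g by exact: (inL2_cint (@measurable_Q _ _) (Q_finite _) gQ g2).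
have fE xi : fourier f xi = c%:C%C * fourier g (D *m xi + 0).
  rewrite fourierE (cI_cov mphi c0 H); last exact: cint_fourier.
  congr (_ * _); apply: cI_ext => x; rewrite /g !addr0.
  by rewrite dotp_mulmx /D tr_scalar_mx.
rewrite (_ : fourier f = fun xi => c%:C%C * fourier g (D *m xi + 0)); last exact/funext.
have mg := cmeas_fourier g2.1.
rewrite nsqZ; last exact: (cmeas_phi mphi mg).
rewrite cabs_real ger0_norm ?(ltW c0)// expr2 EFinM -muleA.
rewrite -(nsq_cov (f := fourier g) H)// plancherel_cube//.
exact: (esym (nsq_cov H f2.1)).
Qed.

Lemma nsqD_ip n (f g : 'cV[R]_n -> R[i]) : inL2 (mu n) f -> inL2 (mu n) g ->
  (nsq (mu n) (fun x => (f x + g x)%R) =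
   nsq (mu n) f + nsq (mu n) g + (2 * complex.Re (ip (mu n) f g))%:E)%E.
Proof.
move=> f2 g2; rewrite !nsqE//; last exact: inL2D.
rewrite -!EFinD; congr EFin.
rewrite ipDl// ?ipDr//; try exact: inL2D.
by rewrite (ip_conj f2 g2) !ReD Re_conjc; ring.
Qed.

(** Polarisation: real parts come from the squared norm of [f + g] before and after the transform,
    imaginary parts from the same argument with [-i f] in place of [f]. *)
Lemma ip_fourier n (f g : 'cV[R]_n -> R[i]) r : 0 < r -> supp f r -> supp g r ->
  inL2 (mu n) f -> inL2 (mu n) g ->
  ip (mu n) f g = ip (mu n) (fourier f) (fourier g).
Proof.
move=> r0 fr gr f2 g2.
have ff2 h : supp h r -> inL2 (mu n) h -> inL2 (mu n) (fourier h).
  move=> hr h2; split; first exact: cmeas_fourier h2.1.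
  by rewrite (plancherel h2 r0 hr); exact: h2.2.
have key h : supp h r -> inL2 (mu n) h ->
    complex.Re (ip (mu n) h g) = complex.Re (ip (mu n) (fourier h) (fourier g)).
  move=> hr h2; have hg2 := inL2D h2 g2.
  have hgr : supp (fun x => h x + g x) r by move=> x nx; rewrite hr// gr// addr0.
  have A := nsqD_ip h2 g2; have B := nsqD_ip (ff2 _ hr h2) (ff2 _ gr g2).
  have hi := supp_cint hr h2; have gi := supp_cint gr g2.
  have E : fourier (fun x => h x + g x) = fun xi => fourier h xi + fourier g xi.
    by apply/funext => xi; rewrite fourierD.
  rewrite -E (plancherel hg2 r0 hgr) (plancherel h2 r0 hr) (plancherel g2 r0 gr) A in B.
  by move: B; rewrite (nsq_fin h2) (nsq_fin g2) -!EFinD => -[] /addrI /mulfI; apply; rewrite pnatr_eq0.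
have ifr : supp (fun x => Complex 0 (-1) * f x) r by move=> x nx; rewrite fr// mulr0.
have if2 : inL2 (mu n) (fun x => Complex 0 (-1) * f x) by exact: inL2Z.
have := key _ ifr if2.
have -> : fourier (fun x => Complex 0 (-1) * f x) = fun xi => Complex 0 (-1) * fourier f xi.
  by apply/funext => xi; rewrite fourierZ//; exact: supp_cint fr f2.
rewrite !ipZl//; try exact: ff2.
rewrite !ReM !mul0r !sub0r !mulN1r !opprK => im.
by apply: Cext; [exact: key|exact: im].
Qed.

End plancherel.

Arguments box {R} r n _.

(** * Frame bounds for a single tile *)

Section almost_orthogonality.
Context {R : realType} {n : nat}.
Notation mu := (lebesgue_cV R n).
Notation Qm m x := ((\1_(@Q R n) (x - @zR R n m) : R)%:C%C).
Notation ek k x := (expi (- (2 * pi * dotp (@zR R n k) x))).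
Implicit Types (h H G : 'cV[R]_n -> R[i]) (m k : 'cV[int]_n).

Lemma cmeas_Qm m : cmeas (fun x : 'cV[R]_n => Qm m x).
Proof. by apply: cmeas_real; exact: measurable_indic_Q. Qed.

Lemma cabs_Qm m (x : 'cV[R]_n) : cabs (Qm m x) = \1_(@Q R n) (x - @zR R n m) :> R.
Proof. by rewrite cabs_real ger0_norm. Qed.

Lemma cabs_Qm1 m (x : 'cV[R]_n) : cabs (Qm m x) <= 1.
Proof. by rewrite cabs_Qm indicE; case: (_ \in _). Qed.

Lemma cint_Qm m h : cint mu h -> cint mu (fun x => Qm m x * h x).
Proof. exact: (cint_mulb (cmeas_Qm m) (cabs_Qm1 m)). Qed.

Lemma inL2_Qm m h : inL2 mu h -> inL2 mu (fun x => Qm m x * h x).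
Proof. exact: (inL2_mulb (cmeas_Qm m) (cabs_Qm1 m)). Qed.

Lemma Qm_cell m (x : 'cV[R]_n) : Qm m x = (m == cell x)%:R :> R[i].
Proof.
have [E|nE] := eqVneq m (cell x).
  by rewrite indicE mem_set//; exact/cellP.
by rewrite indicE memNset// => /cellP E; rewrite E eqxx in nE.
Qed.

(** The infinite triangle inequality by exhaustion: finitely many cells carry the integral of the
    modulus up to [eps], and the rest [r] of [h] is estimated by that [eps]. *)
Lemma cI_cells_tri h : cint mu h ->
  ((cabs (cI mu h))%:E <=
   \esum_(m in [set: 'cV[int]_n]) (cabs (cI mu (fun x => (Qm m x * h x)%R)))%:E)%E.
Proof.
move=> hi; have [mh hoo] := hi.
have mch := measurable_cabs mh.
pose J := (\int[mu]_x (cabs (h x))%:E)%E.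
have JE : J = (\esum_(m in [set: 'cV[int]_n]) \int[mu]_x (cabs (Qm m x * h x)%R)%:E)%E.
  rewrite /J integral_cells.
  - apply: eq_esum => m _; apply: eq_integral => x _.
    by rewrite cabsM cabs_Qm EFinM muleC.
  - exact/measurable_EFinP.
  - by move=> x; rewrite lee_fin cabs_ge0.
have J0 : (0 <= J)%E by apply: integral_ge0 => x _; rewrite lee_fin cabs_ge0.
have Jfin : J \is a fin_num by rewrite ge0_fin_numE.
apply/lee_addgt0Pr => eps e0.
have : (J - eps%:E < J)%E by rewrite lteBlDr// lteDl// lte_fin.
rewrite {2}JE => /ereal_sup_gt[_ [X [finX _] <-]].
rewrite fsbig_finite//; set s := finmap.enum_fset _ => Hs.
have us : uniq s by exact: finmap.fset_uniq.
pose r x := h x - \sum_(m <- s) Qm m x * h x.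
have ri : cint mu r.
  have -> : r = fun x => h x + (-1) * \sum_(m <- s) Qm m x * h x.
    by apply/funext => x; rewrite mulN1r.
  apply: cintD => //; apply: cintZ; apply: cint_sum => m; exact: cint_Qm.
have hE : cI mu h = \sum_(m <- s) cI mu (fun x => Qm m x * h x) + cI mu r.
  rewrite -cI_sum; last by move=> m; exact: cint_Qm.
  rewrite -cID//; last by apply: cint_sum => m; exact: cint_Qm.
  by apply: cI_ext => x; rewrite /r addrC subrK.
have cr x : cabs (r x) + \sum_(m <- s) cabs (Qm m x * h x) = cabs (h x).
  rewrite /r; have [xs|xs] := boolP (cell x \in s).
    have z m : m != cell x -> Qm m x * h x = 0 by move=> /negbTE mx; rewrite Qm_cell mx mul0r.
    rewrite (bigD1_seq (cell x))//= big1 ?addr0; last by move=> m /z.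
    rewrite (bigD1_seq (cell x))//= big1 ?addr0; last by move=> m /z ->; rewrite cabs0.
    by rewrite Qm_cell eqxx mul1r subrr cabs0 add0r.
  have z m : m \in s -> Qm m x * h x = 0.
    by move=> ms; rewrite Qm_cell; case: eqVneq => [E|_]; [rewrite -E ms in xs|rewrite mul0r].
  rewrite big1_seq ?subr0; last by move=> m /= /z.
  by rewrite big1_seq ?addr0// => m /= /z ->; rewrite cabs0.
have JrE : (\int[mu]_x (cabs (r x))%:E + \sum_(m <- s) \int[mu]_x (cabs (Qm m x * h x)%R)%:E = J)%E.
  rewrite -ge0_integral_sum//; last 2 first.
  - by move=> m; apply/measurable_EFinP; apply: measurable_cabs; exact: (cint_Qm m hi).1.
  - by move=> m x _; rewrite lee_fin cabs_ge0.
  rewrite -ge0_integralD//.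
  - by apply: eq_integral => x _; rewrite sumEFin -EFinD cr.
  - by move=> x _; rewrite lee_fin cabs_ge0.
  - by apply/measurable_EFinP; apply: measurable_cabs; exact: ri.1.
  - by move=> x _; rewrite sume_ge0// => m _; rewrite lee_fin cabs_ge0.
  - by apply: emeasurable_sum => m; apply/measurable_EFinP; apply: measurable_cabs; exact: (cint_Qm m hi).1.
have re : ((cabs (cI mu r))%:E <= eps%:E)%E.
  rewrite (le_trans (cabs_cI ri))//.
  have S0 : (0 <= \sum_(m <- s) \int[mu]_x (cabs (Qm m x * h x)%R)%:E)%E.
    by rewrite sume_ge0// => m _; apply: integral_ge0 => x _; rewrite lee_fin cabs_ge0.
  move: Hs JrE Jfin; case: (\sum_(m <- s) _)%E S0 => [S| |]//.
  - move=> _ Hs JrE; rewrite -JrE; move: Hs; rewrite -JrE.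
    have : (0 <= \int[mu]_x (cabs (r x))%:E)%E by apply: integral_ge0 => x _; rewrite lee_fin cabs_ge0.
    case: (\int[mu]_x (cabs (r x))%:E)%E => [y| |]//=.
    by rewrite -!EFinD lte_fin !lee_fin => _ + _; lra.
  - move=> _ _ <-; rewrite addey//.
    by rewrite gt_eqF// (lt_le_trans ltNy0)// integral_ge0// => x _; rewrite lee_fin cabs_ge0.
rewrite hE; apply: (@le_trans _ _ (\sum_(m <- s) (cabs (cI mu (fun x => (Qm m x * h x)%R)))%:E + eps%:E)%E).
  rewrite sumEFin -EFinD lee_fin (le_trans (cabsD _ _))// lerD//.
  exact: cabs_sum.
by apply: leeD => //; exact: seq_le_esum.
Qed.

Lemma ek_shift k m (x : 'cV[R]_n) : ek k (x + @zR R n m) = ek k x.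
Proof.
rewrite dotpDr mulrDr opprD expiD.
have -> : dotp (@zR R n k) (@zR R n m) = (\sum_(i < n) k i 0 * m i 0)%:~R.
  by rewrite /dotp rmorph_sum/=; apply: eq_bigr => i _; rewrite !mxE rmorphM.
move: (\sum_(i < n) _) => z.
have -> : - (2 * pi * z%:~R) = 2 * pi * (- z)%:~R :> R by rewrite mulrNz mulrN.
by rewrite expi_2piz mulr1.
Qed.

Lemma cint_ek k h : cint mu h -> cint mu (fun x => h x * ek k x).
Proof.
move=> hi; under eq_fun do rewrite mulrC; apply: cint_expi => //.
by apply: measurable_funN; apply: measurable_funM => //; exact: measurable_dotp.
Qed.

Lemma shift_hyp (b : 'cV[R]_n) (h : 'cV[R]_n -> \bar R) :
  measurable_fun setT h -> (forall x, 0 <= h x)%E ->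
  (\int[mu]_y h y = 1%:E * \int[mu]_x h (x + b)%R)%E.
Proof. by move=> mh h0; rewrite mul1e; exact: ge0_integral_shift. Qed.

(** Translation by [zR m] moves the cell to [Q] and, the frequencies being integers, fixes the
    characters. *)
Lemma parseval_cell m H : inL2 mu H ->
  (\esum_(k in [set: 'cV[int]_n])
     (cabs (cI mu (fun x => (Qm m x * H x * ek k x)%R)) ^+ 2)%:E
   = nsq mu (fun x => (Qm m x * H x)%R))%E.
Proof.
move=> H2; have QH2 := inL2_Qm m H2.
have mphi := @measurable_cVDr R n (@zR R n m).
pose g x := Qm m (x + @zR R n m) * H (x + @zR R n m).
have g2 : inL2 mu g := inL2_cov mphi ltr01 (shift_hyp (@zR R n m)) QH2.
have gQ x : ~ Q n x -> g x = 0.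
  by move=> nx; rewrite /g addrK indicE memNset// mul0r.
have QHi : cint mu (fun x => Qm m x * H x).
  apply: (cint_covV ltr01 (shift_hyp (@zR R n m)) QH2.1).
  exact: (inL2_cint (@measurable_Q R n) (@Q_finite R n) gQ g2).
rewrite (nsq_cov (shift_hyp (@zR R n m)) QH2.1) mul1e -(parseval_cube g2 gQ).
apply: eq_esum => k _; congr (cabs _ ^+ 2)%:E.
rewrite (cI_cov mphi ltr01 (shift_hyp (@zR R n m))); last exact: cint_ek.
by rewrite mul1r; apply: cI_ext => x; rewrite ek_shift.
Qed.

(* Parseval in each cell bounds its coefficients by [W m] times the norm of [G] there;
   Cauchy-Schwarz with the weights [W] then sums over the cells. *)
Lemma esum_almost_orthogonal H G (W : 'cV[int]_n -> R) (Dl : R) :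
  inL2 mu H -> cint mu H -> inL2 mu G -> 0 < Dl -> (forall m, 0 < W m) ->
  (\esum_(m in [set: 'cV[int]_n]) (W m)%:E <= Dl%:E)%E ->
  (forall x, cabs (H x) <= W (cell x) * cabs (G x)) ->
  (\esum_(k in [set: 'cV[int]_n]) (cabs (cI mu (fun x => (H x * ek k x)%R)) ^+ 2)%:E
   <= (Dl ^+ 2)%:E * nsq mu G)%E.
Proof.
move=> H2 Hi G2 D0 W0 WD HG.
pose c m k := cabs (cI mu (fun x => Qm m x * H x * ek k x)).
have c0 m k : 0 <= c m k by exact: cabs_ge0.
have WDm m : W m <= Dl.
  rewrite -lee_fin (le_trans _ WD)//.
  have := @seq_le_esum R _ setT (fun m => (W m)%:E) [:: m] isT.
  by rewrite big_seq1; apply.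
have step1 k : ((cabs (cI mu (fun x => (H x * ek k x)%R)) ^+ 2)%:E <=
    Dl%:E * \esum_(m in [set: 'cV[int]_n]) ((W m)^-1 * c m k ^+ 2)%:E)%E.
  set y := cabs _; have y0 : 0 <= y by exact: cabs_ge0.
  have S0 : (0 <= \esum_(m in [set: 'cV[int]_n]) ((W m)^-1 * c m k ^+ 2)%:E)%E.
    by apply: esum_ge0 => m _; rewrite lee_fin mulr_ge0 ?invr_ge0 ?(ltW (W0 m))// sqr_ge0.
  have [->|yn0] := eqVneq y 0.
    by rewrite expr0n mule_ge0// lee_fin ltW.
  have yp : 0 < y by rewrite lt_neqAle eq_sym yn0.
  have tri : (y%:E <= \esum_(m in [set: 'cV[int]_n]) (c m k)%:E)%E.
    rewrite (le_trans (cI_cells_tri (cint_ek k Hi)))//; apply: le_esum => m _.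
    rewrite /c (_ : cI mu _ = cI mu (fun x => Qm m x * H x * ek k x))//.
    by apply: cI_ext => x; rewrite mulrA.
  (* AM-GM: [2 c <= (y / Dl) W + (Dl / y) c^2 / W] *)
  have amgm : (2%:E * y%:E <= (y / Dl)%:E * Dl%:E + (Dl / y)%:E * \esum_(m in [set: 'cV[int]_n]) ((W m)^-1 * c m k ^+ 2)%:E)%E.
    apply: (@le_trans _ _ (2%:E * \esum_(m in [set: 'cV[int]_n]) (c m k)%:E)%E).
      by apply: lee_wpmul2l => //; rewrite lee_fin.
    apply: (@le_trans _ _ (((y / Dl)%:E * \esum_(m in [set: 'cV[int]_n]) (W m)%:E) + ((Dl / y)%:E * \esum_(m in [set: 'cV[int]_n]) ((W m)^-1 * c m k ^+ 2)%:E))%E); last first.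
      apply: leeD => //; apply: lee_wpmul2l => //.
      by rewrite lee_fin divr_ge0// ltW.
    have cZ := countable_Zn n.
    rewrite -!esumZl//; try by move=> m _; rewrite lee_fin ?c0 ?(ltW (W0 m))//.
    - rewrite -esumD.
      + apply: le_esum => m _; rewrite -!EFinM -EFinD lee_fin.
        have w0 := W0 m; have e0 : 0 < y / Dl by rewrite divr_gt0.
        rewrite -subr_ge0.
        have -> : y / Dl * W m + Dl / y * ((W m)^-1 * c m k ^+ 2) - 2 * c m k =
          (y / Dl * W m)^-1 * (y / Dl * W m - c m k) ^+ 2.
          by field; rewrite !gt_eqF.
        by rewrite mulr_ge0 ?sqr_ge0// invr_ge0 ltW// mulr_gt0.
      + by move=> m _; rewrite -EFinM lee_fin mulr_ge0 ?divr_ge0 ?(ltW (W0 m))// ltW.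
      + move=> m _; rewrite -EFinM lee_fin mulr_ge0//; first by rewrite divr_ge0// ltW.
        by rewrite mulr_ge0 ?sqr_ge0// invr_ge0 ltW.
    - by rewrite divr_ge0// ltW.
    - by move=> m _; rewrite lee_fin mulr_ge0 ?sqr_ge0// invr_ge0 ltW.
    - by rewrite divr_ge0// ltW.
  move: amgm S0; case: (\esum_(m in [set: _]) ((W m)^-1 * c m k ^+ 2)%:E)%E => [S| |]//.
    rewrite -!EFinM -EFinD !lee_fin divfK ?gt_eqF// => h S0.
    have : y <= Dl / y * S by lra.
    by rewrite mulrAC ler_pdivlMr// expr2 => h2.
  by move=> _ _; rewrite gt0_muley ?lte_fin// leey.
apply: (@le_trans _ _ (Dl%:E * \esum_(m in [set: 'cV[int]_n]) (Dl%:E * nsq mu (fun x => (Qm m x * G x)%R)))%E); last first.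
  rewrite esumZl; [|exact: ltW|exact: countable_Zn|by move=> *; exact: nsq_ge0].
  rewrite muleA -EFinM -expr2; apply: lee_wpmul2l; first by rewrite lee_fin sqr_ge0.
  rewrite [leRHS]/nsq integral_cells.
  - apply: le_esum => m _; rewrite /nsq le_eqVlt; apply/orP; left; apply/eqP.
    apply: eq_integral => x _; rewrite cabsM cabs_Qm exprMn indic_sqr EFinM.
    by rewrite muleC.
  - exact: measurable_nsq G2.1.
  - by move=> x; rewrite lee_fin sqr_ge0.
apply: (@le_trans _ _ (\esum_(k in [set: 'cV[int]_n]) (Dl%:E * \esum_(m in [set: 'cV[int]_n]) ((W m)^-1 * c m k ^+ 2)%:E)))%E.
  by apply: le_esum => k _; exact: step1.
have t0 m k : 0 <= (W m)^-1 * c m k ^+ 2.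
  by rewrite mulr_ge0 ?sqr_ge0// invr_ge0 ltW.
rewrite esumZl; [|exact: ltW|exact: countable_Zn|by move=> k _; apply: esum_ge0 => m _; rewrite lee_fin].
apply: lee_wpmul2l; first by rewrite lee_fin ltW.
rewrite exchange_esum; last by move=> k m; rewrite lee_fin.
apply: le_esum => m _.
under eq_esum do rewrite EFinM.
rewrite esumZl; [|by rewrite invr_ge0 ltW|exact: countable_Zn|by move=> k _; rewrite lee_fin sqr_ge0].
rewrite /c parseval_cell//.
apply: (@le_trans _ _ ((W m)^-1%:E * ((W m ^+ 2)%:E * nsq mu (fun x => (Qm m x * G x)%R))))%E.
  apply: lee_wpmul2l; first by rewrite lee_fin invr_ge0 ltW.
  have Wm : W m = cabs (W m)%:C%C by rewrite cabs_real gtr0_norm.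
  rewrite {1}Wm -nsqZ; last exact: (inL2_Qm m G2).1.
  apply: nsq_le; first exact: (inL2_Qm m H2).1.
    by apply: cmeasM; [exact: cmeas_cst|exact: (inL2_Qm m G2).1].
  move=> x; rewrite Qm_cell; case: eqVneq => [->|_]; last by rewrite !mul0r mulr0.
  by rewrite !mul1r cabsM cabs_real gtr0_norm.
(* One factor [W m] survives; as a single term of the sum of the weights it is at most [Dl]. *)
rewrite muleA -EFinM; apply: lee_wpmul2r; first exact: nsq_ge0.
by rewrite lee_fin expr2 mulrA mulVf ?mul1r// gt_eqF.
Qed.

End almost_orthogonality.

(** * Upper and lower estimates for one tile *)

Section per_tile.
Context {R : realType} {n : nat}.
Notation mu := (lebesgue_cV R n).
Notation ek k x := (expi (- (2 * pi * dotp (@zR R n k) x))).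
Notation Zn := [set: 'cV[int]_n].
Implicit Types (f g h H G psi : 'cV[R]_n -> R[i]) (m k : 'cV[int]_n).

Lemma esum_cabs_sqrD (s : R) (I : choiceType) (A : set I) (a b : I -> R[i]) :
  0 < s -> countable A ->
  (\esum_(k in A) (cabs (a k + b k) ^+ 2)%:E <=
   (1 + s)%:E * (\esum_(k in A) (cabs (a k) ^+ 2)%:E) +
   (1 + s^-1)%:E * (\esum_(k in A) (cabs (b k) ^+ 2)%:E))%E.
Proof.
move=> s0 cA; have si0 : 0 < s^-1 by rewrite invr_gt0.
rewrite -!esumZl//; try (by move=> k _; rewrite lee_fin sqr_ge0); try (by rewrite addr_ge0// ltW).
rewrite -esumD.
- by apply: le_esum => k _; rewrite -!EFinM -EFinD lee_fin; exact: cabs_sqrD.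
- by move=> k _; rewrite -EFinM lee_fin mulr_ge0 ?sqr_ge0// addr_ge0// ltW.
- by move=> k _; rewrite -EFinM lee_fin mulr_ge0 ?sqr_ge0// addr_ge0// ltW.
Qed.

Lemma nsq_ext f g : (forall x, cabs (f x) = cabs (g x)) -> nsq mu f = nsq mu g.
Proof. by move=> fg; apply: eq_integral => x _; rewrite fg. Qed.

Section core.
Variables (G h : 'cV[R]_n -> R[i]) (W : 'cV[int]_n -> R) (Dl : R).
Hypotheses (G2 : inL2 mu G) (mh : cmeas h) (h1 : forall x, cabs (h x) <= 1).
Let H x := h x * G x.
Hypotheses (Hi : cint mu H) (D0 : 0 < Dl) (W0 : forall m, 0 < W m).
Hypothesis WD : (\esum_(m in Zn) (W m)%:E <= Dl%:E)%E.
Hypothesis hW : forall x, cell x != 0 -> cabs (h x) <= W (cell x).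

(* [c0] and [c1] are the contributions of the cell [Q] and of all the others. *)
Let q x : R[i] := (\1_(@Q R n) (x - zR 0) : R)%:C%C.
Let H0 x := q x * H x.
Let H1 x := (1 - q x) * H x.
Let c0 k := cI mu (fun x => H0 x * ek k x).
Let c1 k := cI mu (fun x => H1 x * ek k x).
Let c k := cI mu (fun x => H x * ek k x).

Let q01 x : q x = (cell x == 0)%:R.
Proof. by rewrite /q Qm_cell eq_sym. Qed.

Let mq : cmeas q. Proof. exact: cmeas_Qm. Qed.
Let m1q : cmeas (fun x => 1 - q x).
Proof. by apply: cmeasD; [exact: cmeas_cst|exact: cmeasN]. Qed.
Let b1q x : cabs (1 - q x) <= 1.
Proof. by rewrite q01; case: eqP => _; rewrite ?subrr ?subr0 ?cabs0 ?cabs1. Qed.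

Let H2 : inL2 mu H. Proof. exact: inL2_mulb mh h1 G2. Qed.
Let H1i : cint mu H1. Proof. exact: cint_mulb m1q b1q Hi. Qed.
Let H0i : cint mu H0. Proof. exact: cint_Qm. Qed.

Let cE k : c k = c0 k + c1 k.
Proof.
rewrite /c /c0 /c1 -cID; [|exact: cint_ek|exact: cint_ek].
by apply: cI_ext => x; rewrite -mulrDl /H0 /H1 -mulrDl addrC subrK mul1r.
Qed.

Let sum0 : (\esum_(k in Zn) (cabs (c0 k) ^+ 2)%:E = nsq mu H0)%E.
Proof. exact: (parseval_cell 0 H2). Qed.

Let sum1 : (\esum_(k in Zn) (cabs (c1 k) ^+ 2)%:E <= (Dl ^+ 2)%:E * nsq mu G)%E.
Proof.
apply: (esum_almost_orthogonal _ H1i G2 D0 W0 WD).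
  exact: inL2_mulb m1q b1q H2.
move=> x; rewrite /H1 /H mulrA cabsM ler_wpM2r ?cabs_ge0// cabsM q01.
case: eqVneq => [E|/hW hx]; first by rewrite subrr cabs0 mul0r ltW.
by rewrite subr0 cabs1 mul1r.
Qed.

Let H0G : (nsq mu H0 <= nsq mu G)%E.
Proof.
apply: nsq_le; [by apply: cmeasM => //; exact: H2.1|exact: G2.1|].
move=> x; rewrite /H0 /H mulrA cabsM ler_piMl ?cabs_ge0// cabsM mulr_ile1 ?cabs_ge0//.
exact: cabs_Qm1.
Qed.

(** Young's inequality with [s = Dl] is calibrated so that [(1 + Dl) + (1 + Dl^-1) * Dl ^+ 2 = (1 +
    Dl) ^+ 2]. *)
Lemma core_upper :
  (\esum_(k in Zn) (cabs (cI mu (fun x => (H x * ek k x)%R)) ^+ 2)%:E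
   <= ((1 + Dl) ^+ 2)%:E * nsq mu G)%E.
Proof.
apply: (@le_trans _ _ (\esum_(k in Zn) (cabs (c0 k + c1 k) ^+ 2)%:E)%E).
  by apply: le_esum => k _; rewrite -cE.
apply: (le_trans (esum_cabs_sqrD c0 c1 D0 (countable_Zn n))).
rewrite sum0.
apply: (@le_trans _ _ ((1 + Dl)%:E * nsq mu G + (1 + Dl^-1)%:E * ((Dl ^+ 2)%:E * nsq mu G))%E).
  by apply: leeD; apply: lee_wpmul2l => //; rewrite lee_fin addr_ge0// ?invr_ge0 ltW.
rewrite muleA -EFinM -ge0_muleDl ?lee_fin.
- rewrite -EFinD le_eqVlt; apply/orP; left; apply/eqP; congr (_%:E * _)%E.
  by field; rewrite gt_eqF.
- by rewrite addr_ge0// ltW.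
- by rewrite mulr_ge0 ?sqr_ge0// addr_ge0// invr_ge0 ltW.
Qed.

(** The splitting is read backwards, [c0 = c - c1]: Parseval bounds the part over [P], where [h] is
    at least [kappa], by the sum of the [c0], hence by the full coefficients plus the error of the
    other cells. *)
Lemma core_lower (P : set 'cV[R]_n) (kappa : R) : measurable P -> 0 <= kappa ->
  (forall x, P x -> cell x = 0) -> (forall x, P x -> kappa <= cabs (h x)) ->
  ((kappa ^+ 2)%:E * nsq mu (fun x => ((\1_P x)%:C%C * G x)%R) <=
   (1 + Dl)%:E * (\esum_(k in Zn) (cabs (cI mu (fun x => (H x * ek k x)%R)) ^+ 2)%:E)
   + (Dl ^+ 2 + Dl)%:E * nsq mu G)%E.
Proof.
move=> mP k0 P0 Pk.
have mPG : cmeas (fun x => (\1_P x)%:C%C * G x).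
  by apply: cmeasM; [exact: cmeas_indic|exact: G2.1].
apply: (@le_trans _ _ (nsq mu H0)).
  have kE : kappa = cabs kappa%:C%C by rewrite cabs_real ger0_norm.
  rewrite kE -nsqZ//; apply: nsq_le.
  - by apply: cmeasM => //; exact: cmeas_cst.
  - by apply: cmeasM => //; exact: H2.1.
  - move=> x; rewrite !cabsM -kE /H0 q01 cabs_real ger0_norm// indicE.
    have [xP|_] := boolP (x \in P); last by rewrite mul0r mulr0 !mulr_ge0// cabs_ge0.
    have Px : P x by exact: set_mem.
    rewrite (P0 _ Px) eqxx cabs1 !mul1r.
    by rewrite ler_wpM2r ?cabs_ge0// Pk.
rewrite -sum0.
apply: (@le_trans _ _ (\esum_(k in Zn) (cabs (c k + (- c1 k)) ^+ 2)%:E)%E).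
  by apply: le_esum => k _; rewrite cE addrK.
apply: (le_trans (esum_cabs_sqrD c (fun k => - c1 k) D0 (countable_Zn n))).
apply: leeD => //.
under eq_esum do rewrite cabsN.
apply: (@le_trans _ _ ((1 + Dl^-1)%:E * ((Dl ^+ 2)%:E * nsq mu G))%E).
  by apply: lee_wpmul2l => //; rewrite lee_fin addr_ge0// ?invr_ge0 ltW.
rewrite muleA -EFinM le_eqVlt; apply/orP; left; apply/eqP; congr (_%:E * _)%E.
by field; rewrite gt_eqF.
Qed.

End core.

Lemma supp_le f r r' : r <= r' -> supp f r -> supp f r'.
Proof. by move=> rr' sf x nx; apply: sf => h; apply: nx => i; exact: lt_le_trans (h i) rr'. Qed.

Section wave.
Variables (psi : 'cV[R]_n -> R[i]) (r : R) (D : 'M[R]_n) (xi k : 'cV[R]_n).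
Hypotheses (psi2 : inL2 mu psi) (psir : supp psi r) (Du : D \in unitmx).
Let w := wave psi (D, xi) k.
Let s := Num.sqrt `|\det D|.

Lemma wave_covariance (h : 'cV[R]_n -> \bar R) : measurable_fun setT h ->
  (forall x, 0 <= h x)%E ->
  (\int[mu]_y h y = `|\det D|%:E * \int[mu]_x h (D^T *m x + k)%R)%E.
Proof.
move=> mh h0; rewrite -det_tr; apply: ge0_integral_affine_cV => //.
by rewrite unitmx_tr.
Qed.

Lemma inL2_wave : inL2 mu w.
Proof.
apply: (@inL2_mulb _ _ _ _ (fun x => expi (2 * pi * dotp xi x) * s%:C%C)
   (fun x => psi (k + D^T *m x)) `|s|).
- apply: cmeasM; last exact: cmeas_cst.
  by apply: cmeas_expi; apply: measurable_funM => //; exact: measurable_dotp.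
- by move=> x; rewrite cabsM cabs_expi mul1r cabs_real.
- rewrite (_ : (fun x => _) = fun x => psi (D^T *m x + k)); last first.
    by apply/funext => x; rewrite addrC.
  apply: (inL2_cov (@measurable_cV_affine R n n D^T k) (det_gt0 Du) wave_covariance psi2).
Qed.

Lemma supp_wave : exists2 r', 0 < r' & supp w r'.
Proof.
(* From [x = D^-T (y - k)] with [|y j| < r]. Summing over all rows bounds every coordinate at once,
   and the 1 makes the inequality strict. *)
pose r' := 1 + \sum_i \sum_j `|invmx D^T i j| * (`|r| + `|k j 0|).
have s0 i : 0 <= \sum_j `|invmx D^T i j| * (`|r| + `|k j 0|).
  by apply: sumr_ge0 => j _; rewrite mulr_ge0// addr_ge0.
exists r'; first by rewrite ltr_pwDl// sumr_ge0.
move=> x nx; rewrite /w /wave psir ?mulr0// => hx; apply: nx => i.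
have -> : x = invmx D^T *m (k + D^T *m x - k).
  by rewrite addrC addKr mulKmx// unitmx_tr.
rewrite /r' (bigD1 i)//= mxE; apply: (@le_lt_trans _ _ (\sum_j `|invmx D^T i j| * (`|r| + `|k j 0|))).
  rewrite (le_trans (ler_norm_sum _ _ _))//; apply: ler_sum => j _.
  rewrite normrM ler_wpM2l// (_ : (k + _ - k) j 0 = (k + D^T *m x) j 0 - k j 0); last by rewrite !mxE.
  rewrite (le_trans (ler_normB _ _))// lerD2r.
  exact: le_trans (ltW (hx j)) (ler_norm r).
by rewrite addrA ltr_wpDr ?sumr_ge0// ltrDr.
Qed.

(** Substitution [y = D^T x + k]: the modulation recentres the frequencies at [xi], the shift [k]
    becomes a character, and the constant is [|det D|^(-1/2)]. *)
Lemma fourier_wave u : fourier w (D *m u + xi) =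
  (s / `|\det D|)%:C%C * expi (2 * pi * dotp k u) * fourier psi u.
Proof.
have d0 := det_gt0 Du.
pose F y := expi (- (2 * pi * dotp (y - k) u)) * psi y.
have Fi : cint mu F.
  rewrite (_ : F = fun y => expi (2 * pi * dotp k u) * (expi (- (2 * pi * dotp y u)) * psi y)).
    by apply: cintZ; apply: cint_fourier; exact: supp_cint psir psi2.
  apply/funext => y; rewrite /F mulrA -expiD; congr (expi _ * _).
  by rewrite dotpDl dotpNl; ring.
have E1 : cI mu F = expi (2 * pi * dotp k u) * fourier psi u.
  rewrite fourierE -cIZ; last by apply: cint_fourier; exact: supp_cint psir psi2.
  apply: cI_ext => y; rewrite /F mulrA -expiD; congr (expi _ * _).
  by rewrite dotpDl dotpNl; ring.
rewrite -mulrA -E1 (cI_cov (@measurable_cV_affine R n n D^T k) d0 wave_covariance Fi).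
rewrite mulrA -[_ * `|_|%:C%C]rmorphM divfK ?gt_eqF// -cIZ; last first.
  exact: (cint_cov (@measurable_cV_affine R n n D^T k) d0 wave_covariance Fi).
rewrite fourierE; apply: cI_ext => x; rewrite /w /wave /F addrK /= (addrC k).
rewrite !mulrA -expiD -/s [s%:C%C * _]mulrC; congr (expi _ * _ * _).
by rewrite dotpDr dotp_mulmx (dotpC xi); ring.
Qed.

Lemma inner_wave f rf : inL2 mu f -> supp f rf ->
  inner f w = s%:C%C * cI mu (fun u =>
    fourier f (D *m u + xi) * conjc (fourier psi u) * expi (- (2 * pi * dotp k u))).
Proof.
move=> f2 fr; have d0 := det_gt0 Du.
have [r' r'0 wr'] := supp_wave.
have m0 : 0 < Num.max rf r' by rewrite lt_max r'0 orbT.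
have fm : supp f (Num.max rf r') by apply: supp_le fr; rewrite le_max lexx.
have wm : supp w (Num.max rf r') by apply: supp_le wr'; rewrite le_max lexx orbT.
have w2 := inL2_wave.
have Ff2 : inL2 mu (fourier f).
  by split; [apply: cmeas_fourier f2.1|rewrite (plancherel f2 m0 fm) f2.2].
have Fw2 : inL2 mu (fourier w).
  by split; [apply: cmeas_fourier w2.1|rewrite (plancherel w2 m0 wm) w2.2].
rewrite -[LHS]/(ip mu f w) (ip_fourier m0 fm wm f2 w2) /ip.
have Hc := fun h : 'cV[R]_n -> \bar R => @ge0_integral_affine_cV R n D xi h Du.
rewrite (cI_cov (@measurable_cV_affine R n n D xi) d0 Hc (cint_ip Ff2 Fw2)).
have i2 := cint_cov (@measurable_cV_affine R n n D xi) d0 Hc (cint_ip Ff2 Fw2).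
have s0 : s != 0 by rewrite gt_eqF// sqrtr_gt0.
have ss : s * s = `|\det D| by rewrite -expr2 sqr_sqrtr// normr_ge0.
pose K u := fourier f (D *m u + xi) * conjc (fourier psi u) * expi (- (2 * pi * dotp k u)).
have KE u : s%:C%C * (fourier f (D *m u + xi) * conjc (fourier w (D *m u + xi))) = K u.
  rewrite fourier_wave !conjcM conjc_real conjc_expi /K.
  have sE : s%:C%C * (s / `|\det D|)%:C%C = 1 :> R[i].
    by rewrite -rmorphM mulrA ss divff// gt_eqF.
  rewrite -[RHS]mul1r -sE; ring.
have Ki : cint mu K by apply: (cint_ext KE); exact: cintZ.
rewrite -/(cI mu K) -(cI_ext mu KE) cIZ// mulrA; congr (_ * _).
by rewrite -rmorphM ss.
Qed.

End wave.

(** The coordinate [u] straightens every tile to one and the same cube; this is why a single window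
    can serve all tiles. *)
Lemma tile_setE (t : R) (D : 'M[R]_n) (xi u : 'cV[R]_n) : 0 < t -> D \in unitmx ->
  tile_set (scale_tile t (D, xi)) (D *m u + xi) <-> bx `[- (t / 2), t / 2]%classic n u.
Proof.
move=> t0 Du; rewrite /tile_set /= addrK.
have -> : invmx (t *: D) *m (D *m u) = t^-1 *: u.
  rewrite invmxZ; last by rewrite unitmxZ ?unitfE ?gt_eqF.
  by rewrite -scalemxAl mulKmx.
rewrite -[bx _ _ _]/(forall i, _).
have E i : (`|(t^-1 *: u) i 0| <= 2^-1) = (`[- (t / 2), t / 2]%classic (u i 0) : Prop) :> Prop.
  rewrite propeqE mxE normrM gtr0_norm ?invr_gt0// mulrC ler_pdivrMr//.
  by rewrite (mulrC _ t) /= in_itv /= ler_norml.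
split=> [H i|H].
  rewrite -E; apply: le_trans H; rewrite [leRHS]/Num.norm/= mx_normrE.
  exact: (le_bigmax _ (fun ij : 'I_n * 'I_1 => `|(t^-1 *: u) ij.1 ij.2|) (i, 0)).
rewrite [leLHS]/Num.norm/= mx_normrE; apply: bigmax_le; first by rewrite invr_ge0.
by case=> i j _ /=; rewrite ord1 E.
Qed.

Lemma measurable_tile_set (t : R) (D : 'M[R]_n) (xi : 'cV[R]_n) : 0 < t -> D \in unitmx ->
  measurable (tile_set (scale_tile t (D, xi))).
Proof.
move=> t0 uT.
rewrite (_ : tile_set _ = (fun eta => invmx D *m eta + invmx D *m (- xi)) @^-1`
    bx `[- (t / 2), t / 2]%classic n).
  by rewrite -[X in measurable X]setTI; apply: measurable_cV_affine => //; exact: measurable_bx.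
apply/seteqP; split => eta; rewrite /= -mulmxDr.
  by rewrite -{1}[eta](subrK xi) -{1}(mulKVmx uT (eta - xi)) => /(tile_setE xi _ t0 uT).
by rewrite -{2}[eta](subrK xi) -{2}(mulKVmx uT (eta - xi)) => ?; apply/(tile_setE xi _ t0 uT).
Qed.

Section tile.
Variables (g psi h : 'cV[R]_n -> R[i]) (W : 'cV[int]_n -> R) (Dl r theta kappa : R).
Hypotheses (g2 : inL2 mu g) (gr : supp g r).
Hypotheses (psi2 : inL2 mu psi) (psir : supp psi r).
Hypothesis psiE : forall u, fourier psi u = fourier g u * h u.
Hypotheses (mh : cmeas h) (h1 : forall x, cabs (h x) <= 1).
Hypotheses (D0 : 0 < Dl) (W0 : forall m, 0 < W m).
Hypothesis WD : (\esum_(m in Zn) (W m)%:E <= Dl%:E)%E.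
Hypothesis hW : forall x, cell x != 0 -> cabs (h x) <= W (cell x).
Hypotheses (th0 : 0 < theta < 1) (k0 : 0 <= kappa).
Hypothesis hk : forall x : 'cV[R]_n, (forall i, `|x i 0| <= (1 - theta) / 2) -> kappa <= cabs (h x).
Variables (f : 'cV[R]_n -> R[i]) (rf : R) (D : 'M[R]_n) (xi : 'cV[R]_n).
Let T : tile R n := (D, xi).
Hypotheses (f2 : inL2 mu f) (fr : supp f rf) (uT : D \in unitmx).

Let S := (\esum_(k in Zn) (cabs (inner f (wave psi T (map_mx intr k))) ^+ 2)%:E)%E.
Let X := nsq mu (fun eta => fourier f eta * adapt (fourier g) T eta).
Let Y := nsq mu (fun eta => (\1_(tile_set (scale_tile (1 - theta) T)) eta)%:C%C *
  (fourier f eta * adapt (fourier g) T eta)).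
Let G u := fourier f (D *m u + xi) * conjc (fourier g u).
Let P := bx `[- ((1 - theta) / 2), (1 - theta) / 2]%classic n.
Let d0 : 0 < `|\det D|. Proof. exact: det_gt0 uT. Qed.
Let Hc (F : 'cV[R]_n -> \bar R) mF F0 := @ge0_integral_affine_cV R n D xi F uT mF F0.
Let mphi := @measurable_cV_affine R n n D xi.

Let big_supp (f' : 'cV[R]_n -> R[i]) r' : inL2 mu f' -> supp f' r' -> inL2 mu (fourier f').
Proof.
move=> f'2 f'r; split; first exact: cmeas_fourier f'2.1.
have m0 : 0 < Num.max 1 r' by rewrite lt_max ltr01.
by rewrite (plancherel f'2 m0) ?f'2.2//; apply: supp_le f'r; rewrite le_max lexx orbT.
Qed.

Let ff2 : inL2 mu (fun u => fourier f (D *m u + xi)).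
Proof. exact: (inL2_cov mphi d0 Hc (big_supp f2 fr)). Qed.

Let G2 : inL2 mu G.
Proof.
have [C C0 gC] := fourier_bounded (supp_cint gr g2).
rewrite (_ : G = fun u => conjc (fourier g u) * fourier f (D *m u + xi)); last first.
  by apply/funext => u; rewrite /G mulrC.
apply: (inL2_mulb (M := C)) => //.
  by apply: cmeas_conj; apply: cmeas_fourier g2.1.
by move=> u; rewrite cabs_conj.
Qed.

Let mX : cmeas (fun eta => fourier f eta * adapt (fourier g) T eta).
Proof.
apply: cmeasM; first exact: cmeas_fourier f2.1.
have mg := cmeas_fourier g2.1.
apply: (@cmeas_phi R _ _ 'cV[R]_n 'cV[R]_n (fun eta => invmx D *m (eta - xi)) _ (fourier g) mg).
rewrite (_ : (fun eta => _) = fun eta => invmx D *m eta + invmx D *m (- xi)).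
  exact: measurable_cV_affine.
by apply/funext => eta; rewrite mulmxDr.
Qed.

Let XE : X = (`|\det D|%:E * nsq mu G)%E.
Proof.
rewrite /X (nsq_cov Hc mX); apply/congr1/nsq_ext => u.
by rewrite /adapt /G addrK mulKmx// !cabsM cabs_conj.
Qed.

Let mP : measurable P. Proof. exact: measurable_bx. Qed.

Let th1 : 0 < 1 - theta. Proof. by case/andP: th0 => *; rewrite subr_gt0. Qed.

Let YE : Y = (`|\det D|%:E * nsq mu (fun u => ((\1_P u)%:C%C * G u)%R))%E.
Proof.
rewrite /Y (nsq_cov Hc); last first.
  refine (cmeasM (cmeas_indic _) mX).
  exact: measurable_tile_set.
apply/congr1/nsq_ext => u.
rewrite /adapt /G addrK mulKmx// !cabsM cabs_conj; congr (cabs (_%:C)%C * _).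
suff E : tile_set (scale_tile (1 - theta) T) (D *m u + xi) = P u by rewrite !indicE !/(_ \in _) /= !/(in_set _ _) E.
by rewrite propeqE; exact: tile_setE.
Qed.

Let SE : S = (`|\det D|%:E * \esum_(k in Zn)
  (cabs (cI mu (fun u => (conjc (h u) * G u * ek k u)%R)) ^+ 2)%:E)%E.
Proof.
rewrite -esumZl; [|exact: ltW|exact: countable_Zn|by move=> k _; rewrite lee_fin sqr_ge0].
apply: eq_esum => k _; rewrite -EFinM; congr _%:E.
rewrite (inner_wave _ _ psi2 psir uT f2 fr) cabsM exprMn cabs_real.
rewrite ger0_norm ?sqrtr_ge0// sqr_sqrtr ?normr_ge0//; congr (_ * cabs _ ^+ 2).
by apply: cI_ext => u; rewrite psiE conjcM /G; ring.
Qed.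

Let ch := fun u => conjc (h u).
Let Hi : cint mu (fun u => ch u * G u).
Proof.
have := cintM ff2 (inL2_conj (big_supp psi2 psir)).
by apply: cint_ext => u; rewrite psiE conjcM /ch /G; ring.
Qed.
Let mch : cmeas ch. Proof. exact: cmeas_conj. Qed.
Let ch1 x : cabs (ch x) <= 1. Proof. by rewrite /ch cabs_conj. Qed.
Let chW x : cell x != 0 -> cabs (ch x) <= W (cell x).
Proof. by move=> cx; rewrite /ch cabs_conj hW. Qed.

Lemma tile_upper : (S <= ((1 + Dl) ^+ 2)%:E * X)%E.
Proof.
rewrite SE XE muleCA; apply: lee_wpmul2l; first by rewrite lee_fin.
exact: (core_upper G2 mch ch1 Hi D0 W0 WD chW).
Qed.

Lemma tile_lower : ((kappa ^+ 2)%:E * Y <= (1 + Dl)%:E * S + (Dl ^+ 2 + Dl)%:E * X)%E.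
Proof.
rewrite SE XE YE muleCA [(_ * (_ * nsq mu G))%E]muleCA [((1 + Dl)%:E * _)%E]muleCA.
rewrite -ge0_muleDr.
- apply: lee_wpmul2l; first by rewrite lee_fin.
  apply: (core_lower G2 mch ch1 Hi D0 W0 WD chW mP k0).
  (* The closed cube [P] fits into the half-open [Q] because [theta > 0]. *)
  + move=> x Px; apply/esym/cellP => i; have := Px i; have := th0.
    rewrite /zR !mxE subr0 /I1 /= !in_itv /= => /andP[p0 _] /andP[p1 p2].
    by apply/andP; split; lra.
  + move=> x Px; rewrite /ch cabs_conj hk// => i.
    by have := Px i; rewrite /= in_itv /= ler_norml.
- by rewrite mule_ge0 ?lee_fin ?addr_ge0 ?(ltW D0)// esum_ge0// => k _; rewrite lee_fin sqr_ge0.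
- by rewrite mule_ge0 ?nsq_ge0// lee_fin addr_ge0 ?sqr_ge0// ltW.
Qed.

End tile.

End per_tile.

(** * Summation over the tiles *)

Section frame.
Context {R : realType} {n : nat}.
Notation mu := (lebesgue_cV R n).
Notation Zn := [set: 'cV[int]_n].
Variables (g psi h : 'cV[R]_n -> R[i]) (W : 'cV[int]_n -> R) (Dl r theta : R).
Hypotheses (g2 : inL2 mu g) (gr : supp g r).
Hypotheses (psi2 : inL2 mu psi) (psir : supp psi r).
Hypothesis psiE : forall u, fourier psi u = fourier g u * h u.
Hypotheses (mh : cmeas h) (h1 : forall x, cabs (h x) <= 1).
Hypotheses (D0 : 0 < Dl) (D1 : Dl <= 1) (W0 : forall m, 0 < W m).
Hypothesis WD : (\esum_(m in Zn) (W m)%:E <= Dl%:E)%E.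
Hypothesis hW : forall x, cell x != 0 -> cabs (h x) <= W (cell x).
Hypothesis th0 : 0 < theta < 1.
Hypothesis hk : forall x : 'cV[R]_n, (forall i, `|x i 0| <= (1 - theta) / 2) -> 1 - Dl <= cabs (h x).
Variables (Ts : set (tile R n)) (A B : R).
Hypotheses (A0 : 0 < A) (B0 : 0 < B).
Hypotheses (cTs : countable Ts) (uTs : forall T, Ts T -> is_tile T).
Hypothesis cov : covering_condition Ts g A B theta.

Let X (f : 'cV[R]_n -> R[i]) (T : tile R n) :=
  nsq mu (fun eta => fourier f eta * adapt (fourier g) T eta).
Let Y (f : 'cV[R]_n -> R[i]) (T : tile R n) :=
  nsq mu (fun eta => (\1_(tile_set (scale_tile (1 - theta) T)) eta)%:C%C *
  (fourier f eta * adapt (fourier g) T eta)).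
Let S (f : 'cV[R]_n -> R[i]) (T : tile R n) :=
  (\esum_(k in Zn) (cabs (inner f (wave psi T (map_mx intr k))) ^+ 2)%:E)%E.

Let cmeas_adapt T : is_tile T -> cmeas (adapt (fourier g) T).
Proof.
move=> _; apply: (@cmeas_phi R _ _ 'cV[R]_n 'cV[R]_n (fun eta => invmx T.1 *m (eta - T.2)) _
  (fourier g) (cmeas_fourier g2.1)).
rewrite (_ : (fun eta => _) = fun eta => invmx T.1 *m eta + invmx T.1 *m (- T.2)).
  exact: measurable_cV_affine.
by apply/funext => eta; rewrite mulmxDr.
Qed.

Let cmeas_ts T : is_tile T ->
  cmeas (fun eta : 'cV[R]_n => (\1_(tile_set (scale_tile (1 - theta) T)) eta : R)%:C%C).
Proof.
move=> uT; have th1 : 0 < 1 - theta by case/andP: th0 => *; rewrite subr_gt0.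
apply: cmeas_indic; case: T uT => D xi uT.
exact: measurable_tile_set.
Qed.

(** * Frame bounds for compactly supported f *)

Section compact.
Variables (f : 'cV[R]_n -> R[i]) (rf : R).
Hypotheses (f2 : inL2 mu f) (fr : supp f rf).

Let ff : nsq mu (fourier f) = nsq mu f.
Proof.
have m0 : 0 < Num.max 1 rf by rewrite lt_max ltr01.
by rewrite (plancherel f2 m0)//; apply: supp_le fr; rewrite le_max lexx orbT.
Qed.

Let mff := cmeas_fourier f2.1.

Let sumX : (\esum_(T in Ts) X f T <= B%:E * nsq mu f)%E.
Proof.
rewrite -ff -integral_esum//; last 2 first.
- by move=> T /uTs uT; apply: measurable_nsq; apply: cmeasM => //; exact: cmeas_adapt.
- by move=> T x _; rewrite lee_fin sqr_ge0.
rewrite /nsq -ge0_integralZl//; last 3 first.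
- exact: measurable_nsq.
- by move=> x _; rewrite lee_fin sqr_ge0.
- by rewrite lee_fin ltW.
apply: ae_ge0_le_integral => //.
- by move=> x _; apply: esum_ge0 => T _; rewrite lee_fin sqr_ge0.
- apply: measurable_esum => //.
    by move=> T /uTs uT; apply: measurable_nsq; apply: cmeasM => //; exact: cmeas_adapt.
  by move=> T x _; rewrite lee_fin sqr_ge0.
- by move=> x _; rewrite mule_ge0// lee_fin ?sqr_ge0// ltW.
- by apply: emeasurable_funM => //; exact: measurable_nsq.
apply: filterS cov => x [_ _ H] _.
under eq_esum do rewrite cabsM exprMn EFinM.
rewrite esumZl ?sqr_ge0//; last by move=> T _; rewrite lee_fin sqr_ge0.
by rewrite muleC; apply: lee_wpmul2r => //; rewrite lee_fin sqr_ge0.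
Qed.

Let sumY : (A%:E * nsq mu f <= \esum_(T in Ts) Y f T)%E.
Proof.
rewrite -ff -integral_esum//; last 2 first.
- move=> T /uTs uT; apply: measurable_nsq; apply: cmeasM; first exact: cmeas_ts.
  by apply: cmeasM => //; exact: cmeas_adapt.
- by move=> T x _; rewrite lee_fin sqr_ge0.
rewrite /nsq -ge0_integralZl//; last 3 first.
- exact: measurable_nsq.
- by move=> x _; rewrite lee_fin sqr_ge0.
- by rewrite lee_fin ltW.
apply: ae_ge0_le_integral => //.
- by move=> x _; rewrite mule_ge0// lee_fin ?sqr_ge0// ltW.
- by apply: emeasurable_funM => //; exact: measurable_nsq.
- by move=> x _; apply: esum_ge0 => T _; rewrite lee_fin sqr_ge0.
- apply: measurable_esum => //.
    move=> T /uTs uT; apply: measurable_nsq; apply: cmeasM; first exact: cmeas_ts.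
    by apply: cmeasM => //; exact: cmeas_adapt.
  by move=> T x _; rewrite lee_fin sqr_ge0.
apply: filterS cov => x [H _ _] _.
rewrite (_ : (\esum_(T in Ts) _)%E = (\esum_(T in Ts) ((cabs (fourier f x) ^+ 2)%:E *
    (cabs (adapt (fourier g) T x) ^+ 2 * \1_(tile_set (scale_tile (1 - theta) T)) x)%:E))%E); last first.
  apply: eq_esum => T _; rewrite !cabsM !exprMn cabs_real ger0_norm// indic_sqr -EFinM.
  by congr _%:E; ring.
rewrite esumZl ?sqr_ge0//; last by move=> T _; rewrite lee_fin mulr_ge0 ?sqr_ge0.
by rewrite muleC; apply: lee_wpmul2l => //; rewrite lee_fin sqr_ge0.
Qed.

Let S0 T : (0 <= S f T)%E.
Proof. by apply: esum_ge0 => k _; rewrite lee_fin sqr_ge0. Qed.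

Lemma frame_upper_supp : (frame_sum Ts psi f <= ((1 + Dl) ^+ 2 * B)%:E * nsq mu f)%E.
Proof.
apply: (@le_trans _ _ (\esum_(T in Ts) (((1 + Dl) ^+ 2)%:E * X f T))%E).
  apply: le_esum => -[D xi] /uTs uT.
  exact: (tile_upper g2 gr psi2 psir psiE mh h1 D0 W0 WD hW xi f2 fr uT).
rewrite esumZl ?sqr_ge0//; last by move=> *; exact: nsq_ge0.
by rewrite (EFinM _ B) -muleA; apply: lee_wpmul2l => //; rewrite lee_fin sqr_ge0.
Qed.

(** The error term collects frequencies from all cells, so it is governed by the sum of the [X f T]
    and not by its cut-off version; this is how [B] enters a lower bound. *)
Lemma frame_lower_supp :
  (((1 - Dl) ^+ 2 * A)%:E * nsq mu f <=
   (1 + Dl)%:E * frame_sum Ts psi f + ((Dl ^+ 2 + Dl) * B)%:E * nsq mu f)%E.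
Proof.
have d0 := ltW D0.
have k0 : 0 <= 1 - Dl by rewrite subr_ge0.
apply: (@le_trans _ _ (((1 - Dl) ^+ 2)%:E * \esum_(T in Ts) Y f T)%E).
  by rewrite (EFinM _ A) -muleA; apply: lee_wpmul2l => //; rewrite lee_fin sqr_ge0.
apply: (@le_trans _ _ ((1 + Dl)%:E * frame_sum Ts psi f + (Dl ^+ 2 + Dl)%:E * \esum_(T in Ts) X f T)%E); last first.
  apply: leeD => //; rewrite (EFinM _ B) -muleA; apply: lee_wpmul2l => //.
  by rewrite lee_fin addr_ge0// sqr_ge0.
have e0 : 0 <= Dl ^+ 2 + Dl by rewrite addr_ge0// sqr_ge0.
have e1 : 0 <= 1 + Dl by rewrite addr_ge0.
rewrite -!esumZl ?sqr_ge0//; try (by move=> *; exact: nsq_ge0); try (by move=> T _; exact: S0).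
rewrite -esumD; last 2 first.
- by move=> T _; rewrite mule_ge0 ?lee_fin//; exact: S0.
- by move=> T _; rewrite mule_ge0 ?lee_fin// nsq_ge0.
apply: le_esum => -[D xi] /uTs uT.
exact: (tile_lower g2 gr psi2 psir psiE mh h1 D0 W0 WD hW th0 k0 hk xi f2 fr uT).
Qed.

End compact.

(** * Truncation of a general f *)

Section general.
Variable f : 'cV[R]_n -> R[i].
Hypothesis f2 : inL2 mu f.
Let fN (N : nat) x := (\1_(box N%:R n) x)%:C%C * f x.

Lemma trunc_L2 N : inL2 mu (fN N).
Proof.
apply: (inL2_mulb (M := 1)) => //; first by apply: cmeas_indic; exact: measurable_bx_itv.
by move=> x; rewrite cabs_real ger0_norm// indicE; case: (_ \in _).
Qed.

Lemma trunc_supp N : supp (fN N) (N%:R + 1).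
Proof.
move=> x nx; rewrite /fN indicE memNset ?mul0r// => bx.
by apply: nx => i; have := bx i; rewrite /= in_itv /= -ler_norml => /le_lt_trans; apply; rewrite ltrDl.
Qed.

Lemma trunc_nsq_le N : (nsq mu (fN N) <= nsq mu f)%E.
Proof.
apply: nsq_le; [exact: (trunc_L2 N).1|exact: f2.1|] => x.
by rewrite cabsM cabs_real ger0_norm// indicE; case: (_ \in _); rewrite ?mul1r ?mul0r ?cabs_ge0.
Qed.

(** The wave has compact support, so its inner product sees only a bounded part of [f]. *)
Lemma inner_trunc T k : is_tile T -> exists N0 : nat, forall N : nat, (N0 <= N)%N ->
  inner f (wave psi T k) = inner (fN N) (wave psi T k).
Proof.
case: T => D xi uT; have [r' r'0 wr] := supp_wave xi k psir uT.
exists (Num.trunc r').+1 => N N0; apply: (cI_ext mu) => x; rewrite /fN.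
have [bx|nbx] := pselect (box N%:R n x); first by rewrite indicE mem_set// mul1r.
rewrite wr ?conjc0 ?mulr0// => hx; apply: nbx => i.
rewrite /= in_itv /= -ler_norml (le_trans (ltW (hx i)))//.
have := truncnS_gt r'; move/ltW/le_trans; apply.
by rewrite ler_nat.
Qed.

(** A finite part of the frame sum involves finitely many waves, which do not distinguish [f] from a
    far enough truncation; the bound for truncations is uniform in [N]. *)
Lemma frame_upper : (frame_sum Ts psi f <= ((1 + Dl) ^+ 2 * B)%:E * nsq mu f)%E.
Proof.
rewrite /frame_sum esum_esum; last by move=> *; rewrite lee_fin sqr_ge0.
apply: esum_le_seq; first by move=> *; rewrite lee_fin sqr_ge0.
move=> s us sA.
have [N HN] : exists N : nat, forall p, p \in s ->
    inner f (wave psi p.1 (map_mx intr p.2)) = inner (fN N) (wave psi p.1 (map_mx intr p.2)).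
  suff [N HN] : exists N0 : nat, forall N : nat, (N0 <= N)%N -> forall p, p \in s ->
      inner f (wave psi p.1 (map_mx intr p.2)) = inner (fN N) (wave psi p.1 (map_mx intr p.2)).
    by exists N; exact: HN.
  elim: (s) sA => [|p s' IH] sA; first by exists 0%N.
  have [|N1 H1] := IH; first by move=> q qs; apply: sA; rewrite inE qs orbT.
  have [|N2 H2] := @inner_trunc p.1 (map_mx intr p.2).
    by have [pT _] := sA p (mem_head _ _); exact: uTs.
  exists (maxn N1 N2) => N; rewrite geq_max => /andP[n1 n2] q.
  by rewrite inE => /orP[/eqP ->|qs]; [exact: H2|exact: H1].
have C0 : 0 <= (1 + Dl) ^+ 2 * B by rewrite mulr_ge0 ?sqr_ge0// ltW.
apply: (@le_trans _ _ (frame_sum Ts psi (fN N))).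
  rewrite /frame_sum esum_esum; last by move=> *; rewrite lee_fin sqr_ge0.
  rewrite big_seq (eq_bigr (fun p => (cabs (inner (fN N) (wave psi p.1 (map_mx intr p.2))) ^+ 2)%:E)).
    by rewrite -big_seq; apply: seq_le_esum => //= *; rewrite lee_fin sqr_ge0.
  by move=> p ps; rewrite HN.
apply: (le_trans (frame_upper_supp (trunc_L2 N) (@trunc_supp N))).
apply: lee_wpmul2l; first by rewrite lee_fin.
exact: trunc_nsq_le.
Qed.

Lemma trunc_cvg (e : R) : 0 < e ->
  exists N, (nsq mu (fun x => (f x - fN N x)%R) <= e%:E)%E.
Proof.
move=> e0; suff : \forall N \near \oo, (nsq mu (fun x => (f x - fN N x)%R) <= e%:E)%E.
  by move=> [N _ HN]; exists N; apply: HN => /=.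
apply: (L2_dominated (h := fun x => cabs (f x))) => //.
- exact: f2.1.
- by move=> N; exact: (trunc_L2 N).1.
- exact: measurable_cabs f2.1.
- move=> N x; rewrite /fN indicE.
  by case: (_ \in _); rewrite ?mul1r ?subrr ?cabs0 ?cabs_ge0// mul0r subr0.
- exact: f2.2.
- apply: nearW => x; apply: cvg_near_cst.
  exists (Num.trunc (\sum_i `|x i 0|)).+1 => // N /= N0.
  rewrite /fN indicE mem_set ?mul1r ?subrr ?cabs0// => i.
  rewrite /= in_itv /= -ler_norml (@le_trans _ _ (\sum_i `|x i 0|))//.
    by rewrite (bigD1 i)//= lerDl sumr_ge0.
  by have := truncnS_gt (\sum_i `|x i 0|); move/ltW/le_trans; apply; rewrite ler_nat.
Qed.

End general.

Lemma inL2N (f : 'cV[R]_n -> R[i]) : inL2 mu f -> inL2 mu (fun x => - f x).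
Proof.
move=> f2; rewrite (_ : (fun x => _) = fun x => (-1) * f x); first exact: inL2Z.
by apply/funext => x; rewrite mulN1r.
Qed.

Lemma frame_sumD (s : R) (f1 f2 : 'cV[R]_n -> R[i]) : 0 < s -> inL2 mu f1 -> inL2 mu f2 ->
  (frame_sum Ts psi (fun x => (f1 x + f2 x)%R) <=
   (1 + s)%:E * frame_sum Ts psi f1 + (1 + s^-1)%:E * frame_sum Ts psi f2)%E.
Proof.
move=> s0 f12 f22; have E (f : 'cV[R]_n -> R[i]) : frame_sum Ts psi f =
    (\esum_(p in Ts `*`` (fun=> Zn)) (cabs (inner f (wave psi p.1 (map_mx intr p.2))) ^+ 2)%:E)%E.
  by rewrite /frame_sum esum_esum// => *; rewrite lee_fin sqr_ge0.
rewrite !E; apply: le_trans (esum_cabs_sqrD _ _ s0 _); last first.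
  by apply: countableXR => // T _; exact: countable_Zn.
apply: le_esum => -[[D xi] k] [/uTs uT _]; rewrite lee_fin [_.1]/= [_.2]/=.
by rewrite -[inner _ _]/(ip mu _ _) ipDl//; exact: (inL2_wave xi (map_mx intr k) psi2 uT).
Qed.

(** Finite parts of the frame sum cannot give a lower bound. Instead the upper bound, applied to the
    remainder [f - fN], shows that truncation changes both sides little. The second hypothesis is
    the compactly supported estimate solved for [L]. *)
Lemma frame_lower (L : R) (f : 'cV[R]_n -> R[i]) : 0 < L ->
  (1 - Dl) ^+ 2 * A >= (1 + Dl) * L + (Dl ^+ 2 + Dl) * B -> inL2 mu f ->
  (L%:E * nsq mu f <= frame_sum Ts psi f)%E.
Proof.
move=> L0 hL f2.
pose C := (1 + Dl) ^+ 2 * B.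
have C0 : 0 <= C by rewrite mulr_ge0 ?sqr_ge0// ltW.
have up u : inL2 mu u -> (frame_sum Ts psi u <= C%:E * nsq mu u)%E by exact: frame_upper.
have fs0 u : (0 <= frame_sum Ts psi u)%E.
  by apply: esum_ge0 => T _; apply: esum_ge0 => k _; rewrite lee_fin sqr_ge0.
have fin u : inL2 mu u -> frame_sum Ts psi u = (fine (frame_sum Ts psi u))%:E.
  move=> u2; rewrite fineK// ge0_fin_numE// (le_lt_trans (up u u2))//.
  by rewrite (nsq_fin u2) -EFinM ltry.
have lo N u2 := frame_lower_supp (trunc_L2 f2 N) u2.
set a := fine (nsq mu f); set b := fine (frame_sum Ts psi f).
have b0 : 0 <= b by rewrite fine_ge0.
rewrite (nsq_fin f2) (fin f f2) -EFinM lee_fin -/a -/b.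
(* [e] bounds the squared norm of the remainder; the Young parameter [s] is spent twice, on the
   frame sum and on the norm. Next [e] tends to 0 with [s] fixed, and only then [s]. *)
have key (s e : R) : 0 < s -> 0 < e -> L * a <= (1 + s) ^+ 2 * b + (1 + s^-1) * ((1 + s) * C + L) * e.
  move=> s0 e0; have [N HN] := trunc_cvg f2 e0.
  pose fN := fun x : 'cV[R]_n => (\1_(box N%:R n) x)%:C%C * f x.
  have fN2 : inL2 mu fN := trunc_L2 f2 N.
  have r2 : inL2 mu (fun x => f x - fN x) by apply: inL2D => //; exact: inL2N.
  have s1 : 0 <= 1 + s^-1 by rewrite addr_ge0// invr_ge0 ltW.
  have := lo _ _ (@trunc_supp f N); rewrite -/fN (fin _ fN2) (nsq_fin fN2).
  set SN := fine (frame_sum _ _ _); set FN := fine (nsq _ _).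
  rewrite -!EFinM -EFinD lee_fin => lN.
  have u1 : SN <= (1 + s) * b + (1 + s^-1) * (C * e).
    rewrite -lee_fin -(fin _ fN2) EFinD !EFinM -[b%:E](fin f f2).
    rewrite (_ : fN = fun x => f x + - (f x - fN x)); last first.
      by apply/funext => x; rewrite opprB addrC subrK.
    apply: (le_trans (frame_sumD s0 f2 (inL2N r2))); apply: leeD => //.
    rewrite -EFinM; apply: lee_wpmul2l; first by rewrite lee_fin.
    apply: (le_trans (up _ (inL2N r2))); rewrite EFinM; apply: lee_wpmul2l; first by rewrite lee_fin.
    by rewrite (nsq_ext (g := fun x => f x - fN x))// => x; rewrite cabsN.
  have u2 : a <= (1 + s) * FN + (1 + s^-1) * e.
    rewrite -lee_fin -(nsq_fin f2) EFinD !EFinM -(nsq_fin fN2).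
    rewrite [in leLHS](_ : f = fun x => fN x + (f x - fN x)); last first.
      by apply/funext => x; rewrite addrC subrK.
    apply: (@le_trans _ _ ((1 + s)%:E * nsq mu fN + (1 + s^-1)%:E * nsq mu (fun x => (f x - fN x)%R))%E).
      exact: (nsqD mu s0 fN2.1 r2.1).
    apply: leeD => //.
    by apply: lee_wpmul2l; first by rewrite lee_fin.
  have FN0 : 0 <= FN by rewrite fine_ge0// nsq_ge0.
  have u3 : L * FN <= SN.
    rewrite -(@ler_pM2l _ (1 + Dl)); last by rewrite ltr_wpDr// ltW.
    have := ler_wpM2r FN0 hL; rewrite mulrDl => h3; lra.
  have := ler_wpM2l (ltW L0) u2.
  have s2 : 0 <= 1 + s by rewrite addr_ge0// ltW.
  have := ler_wpM2l s2 (le_trans u3 u1).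
  lra.
have key2 (s : R) : 0 < s -> L * a <= (1 + s) ^+ 2 * b.
  move=> s0; apply/ler_addgt0Pr => e e0.
  have K0 : 0 < (1 + s^-1) * ((1 + s) * C + L).
    apply: mulr_gt0; first by rewrite addr_gt0 ?invr_gt0.
    by rewrite ltr_wpDl// mulr_ge0// addr_ge0// ltW.
  have := key s (e / ((1 + s^-1) * ((1 + s) * C + L))) s0 (divr_gt0 e0 K0).
  by rewrite [_ * (e / _)]mulrC divfK// gt_eqF.
apply/ler_addgt0Pr => e e0.
have b1 : 0 < 3 * b + 1 by rewrite ltr_wpDl// mulr_ge0.
(* For [s <= 1] the loss [(1 + s) ^+ 2 - 1] is at most [3 * s]; the added 1 keeps the denominator
   positive when [b = 0]. *)
pose s := Num.min 1 (e / (3 * b + 1)).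
have s0 : 0 < s by rewrite lt_min ltr01 divr_gt0.
have s1 : s <= 1 by rewrite /s ge_min lexx.
apply: (le_trans (key2 s s0)).
have : s * (3 * b + 1) <= e by rewrite -ler_pdivlMr// /s ge_min lexx orbT.
have sq : (1 + s) ^+ 2 <= 1 + 3 * s by nra.
have := ler_wpM2r b0 sq; lra.
Qed.

End frame.

(** * A one-dimensional window *)

Section derivatives.
Context {R : realType}.

(** A quadratic remainder bound survives products and integration against [g], so this criterion
    replaces differentiation under the integral sign; it also settles the flat point of the bump. *)
Lemma is_derive_quad (V : normedModType R) (u : V -> R) (x v : V) (l C : R) :
  (forall h : R, `|u (h *: v + x) - u x - h * l| <= C * h ^+ 2) ->
  is_derive x v u l.
Proof.
move=> H; have C0 : 0 <= C.
  by have := le_trans (normr_ge0 _) (H 1); rewrite expr1n mulr1.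
have cv : h^-1 *: (u (h *: v + x) - u x) @[h --> 0^'] --> l.
  apply/cvgrPdist_le => e e0; near=> h.
  have h0 : h != 0 by near: h; exact: nbhs_dnbhs_neq.
  have -> : l - h^-1 *: (u (h *: v + x) - u x) = - (h^-1 * (u (h *: v + x) - u x - h * l)).
    by rewrite /GRing.scale /=; field.
  rewrite normrN normrM normfV ler_pdivrMl ?normr_gt0//.
  rewrite (le_trans (H h))// -normr_id -(real_normK (num_real h)) mulrC expr2 normr_id -mulrA ler_wpM2l//.
  have : `|h| <= e / (C + 1).
    near: h; apply: (@cvgr0_norm_le _ _ _ _ (dnbhs_filter 0) id); last by rewrite divr_gt0// ltr_wpDl.
    exact: cvg_within.
  rewrite ler_pdivlMr ?ltr_wpDl// => /(le_trans _); apply.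
  by rewrite ler_wpM2l// lerDl.
have dv : derivable u x v by apply/cvg_ex; exists l.
by split=> //; apply/cvg_lim.
Unshelve. all: by end_near.
Qed.

Lemma is_derive_continuous (u du : R -> R) : (forall x : R, is_derive x (1 : R) u (du x)) -> continuous u.
Proof. by move=> d x; apply: differentiable_continuous; apply/derivable1_diffP. Qed.

Lemma MVT_between (u du : R -> R) (t h : R) : (forall x : R, is_derive x (1 : R) u (du x)) ->
  exists2 c, `|c - t| <= `|h| & u (t + h) - u t = h * du c.
Proof.
move=> d; have cu := is_derive_continuous d.
have [h0|/ltW h0] := leP 0 h.
  have th : t <= t + h by rewrite lerDl.
  have [c] := MVT_segment th (fun x _ => d x) (continuous_subspaceT cu).
  rewrite in_itv /= => /andP[c1 c2] ->; exists c; last by ring.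
  by rewrite !ger0_norm ?subr_ge0// lerBlDl.
have th : t + h <= t by rewrite gerDl.
have [c] := MVT_segment th (fun x _ => d x) (continuous_subspaceT cu).
rewrite in_itv /= => /andP[c1 c2] e; exists c; last by rewrite -opprB e; ring.
by rewrite !ler0_norm ?subr_le0// opprB lerBlDl -lerBlDr opprK.
Qed.

(** The mean value theorem applied twice, with no attempt at the sharp constant [K / 2]. *)
Lemma taylor2 (u du ddu : R -> R) (K t h : R) :
  (forall x : R, is_derive x (1 : R) u (du x)) ->
  (forall x : R, is_derive x (1 : R) du (ddu x)) -> (forall x, `|ddu x| <= K) ->
  `|u (t + h) - u t - h * du t| <= K * h ^+ 2.
Proof.
move=> d1 d2 K2; have [c ct ->] := MVT_between t h d1.
rewrite -mulrBr; have [c' _] := MVT_between t (c - t) d2.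
rewrite subrKC => ->; rewrite !normrM mulrC -(real_normK (num_real h)) expr2 mulrA.
by rewrite ler_wpM2r// mulrC ler_pM.
Qed.

End derivatives.

(** * A smooth bump together with all its derivatives *)

Section bump.
Context {R : realType}.

(** The classical [exp (-1/x)] with negative powers of [x] in front: the span of these functions is
    stable under differentiation, so all orders are treated at once. *)
Definition flat n (x : R) : R := if 0 < x then x^-1 ^+ n * expR (- x^-1) else 0.

Lemma flat_ge0 n x : 0 <= flat n x.
Proof.
rewrite /flat; case: ltP => // x0.
by rewrite mulr_ge0 ?expR_ge0// exprn_ge0// invr_ge0 ltW.
Qed.

(** [expR y] exceeds [y^(n+2) / (n+2)!] at [y = 1/x]. A quadratic bound is what differentiability at
    0, with derivative 0, requires. *)
Lemma flat_quad n : exists2 C : R, 0 <= C & forall x, flat n x <= C * x ^+ 2.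
Proof.
exists ((n.+2)`!%:R) => // x; rewrite /flat; case: ltP => x0; last by rewrite mulr_ge0// sqr_ge0.
have y0 : 0 < x^-1 by rewrite invr_gt0.
have := expR_ge1Dxn n.+1 (ltW y0) => h.
have h1 : x^-1 ^+ n.+2 / (n.+2)`!%:R <= expR x^-1.
  by apply: le_trans h; rewrite lerDr.
rewrite expRN ler_pdivrMr ?expR_gt0//.
rewrite -ler_pdivrMl; last by rewrite mulr_gt0 ?exprn_gt0// ltr0n fact_gt0.
apply: le_trans h1; rewrite le_eqVlt; apply/orP; left; apply/eqP.
rewrite !exprS exprVn; field; rewrite expf_neq0 ?gt_eqF//= pnatr_eq0 -lt0n fact_gt0//.
Qed.

Lemma flat0 n (x : R) : x <= 0 -> flat n x = 0.
Proof. by rewrite /flat leNgt => /negbTE ->. Qed.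

Lemma is_derive_flat n (x : R) :
  is_derive x (1 : R) (flat n) (- n%:R * flat n.+1 x + flat n.+2 x).
Proof.
have [x0|x0] := leP x 0.
  have [C C0 HC] := flat_quad n.
  apply: (@is_derive_quad R _ _ _ _ _ C) => h; rewrite (flat0 n x0) (flat0 n.+1 x0) (flat0 n.+2 x0) mulr0 addr0 mulr0 !subr0.
  rewrite ger0_norm ?flat_ge0//; have [h0|h0] := leP (h *: 1 + x) 0.
    by rewrite flat0// mulr_ge0// sqr_ge0.
  rewrite (le_trans (HC _))// ler_wpM2l//; move: h0; rewrite /GRing.scale /= mulr1 => h0.
  nra.
apply: (@near_eq_is_derive R R R (fun y : R => y^-1 ^+ n * expR (- y^-1)) (flat n) x 1).
  near=> y; have y0 : 0 < y by near: y; exact: lt_nbhsr.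
  by rewrite /flat y0.
have dV : is_derive x (1 : R) (fun y : R => y^-1) (- x ^- 2).
  have := @is_deriveV R id x 1 1; rewrite gt_eqF// => /(_ isT _).
  by rewrite scaler1; apply.
have dX : is_derive x (1 : R) (fun y : R => y^-1 ^+ n) (- n%:R * x^-1 ^+ n.+1).
  have -> : (fun y : R => y^-1 ^+ n) = (fun y : R => y^-1) ^+ n.
    by apply/funext => y; rewrite exprfctE.
  apply: (is_derive_eq (@is_deriveX R R (fun y : R => y^-1) n x 1 _ dV)).
  rewrite /GRing.scale /=; case: n => [|m] /=; first by rewrite !mul0r oppr0 mul0r.
  by rewrite -exprVn !exprS; ring.
have dE : is_derive x (1 : R) (fun y : R => expR (- y^-1)) (expR (- x^-1) * x ^- 2).
  have dN : is_derive x (1 : R) (fun y : R => - y^-1) (x ^- 2).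
    by have := @is_deriveN R R R (fun y : R => y^-1) x 1 _ dV; rewrite opprK; apply.
  by have := @is_derive1_comp R expR (fun y : R => - y^-1) x _ _ (is_derive_expR _) dN; apply.
apply: is_derive_eq.
rewrite -exprVn /flat x0 /GRing.scale /= !exprS; ring.
Unshelve. all: by end_near.
Qed.

(** A smooth function carried with all its derivatives: [phi m] is the derivative of order [m] of
    [phi 0]. *)
Definition chain (phi : nat -> R -> R) :=
  forall m (x : R), is_derive x (1 : R) (phi m) (phi m.+1 x).

(* The linear span of the products [flat a (1 + x) * flat b (1 - x)] is closed under
   differentiation; a triple [(c, a, b)] stands for such a product with coefficient [c]. *)
Definition span_eval (s : seq (R * nat * nat)) (x : R) : R :=
  \sum_(p <- s) p.1.1 * (flat p.1.2 (1 + x) * flat p.2 (1 - x)).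

Definition span_deriv (s : seq (R * nat * nat)) : seq (R * nat * nat) :=
  flatten [seq (let: (c, a, b) := p in
    [:: (- (c * a%:R), a.+1, b); (c, a.+2, b); (c * b%:R, a, b.+1); (- c, a, b.+2)]) | p <- s].

Lemma is_derive_span s (x : R) :
  is_derive x (1 : R) (span_eval s) (span_eval (span_deriv s) x).
Proof.
elim: s => [|[[c a] b] s IH].
  rewrite /span_eval /span_deriv /= big_nil.
  rewrite (_ : (fun x => _) = cst 0); first exact: is_derive_cst.
  by apply/funext => y; rewrite big_nil.
rewrite (_ : span_eval _ = fun y => c * (flat a (1 + y) * flat b (1 - y)) + span_eval s y); last first.
  by apply/funext => y; rewrite /span_eval big_cons.
rewrite /span_eval /span_deriv /= !big_cons -/(span_deriv s) -/(span_eval (span_deriv s) x) /=.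
have d1 : is_derive x (1 : R) (fun y : R => 1 + y) 1.
  by apply: (is_derive_eq (is_deriveD (is_derive_cst (1 : R) x 1) (is_derive_id x 1))); rewrite add0r.
have d2 : is_derive x (1 : R) (fun y : R => 1 - y) (-1).
  by apply: (is_derive_eq (is_deriveB (is_derive_cst (1 : R) x 1) (is_derive_id x 1))); rewrite sub0r.
have e1 := @is_derive1_comp R (flat a) _ x _ _ (is_derive_flat a _) d1.
have e2 := @is_derive1_comp R (flat b) _ x _ _ (is_derive_flat b _) d2.
have e3 : is_derive x (1 : R) (fun y => flat a (1 + y) * flat b (1 - y)) _ := is_deriveM e1 e2.
have e4 : is_derive x (1 : R) (fun y => c * (flat a (1 + y) * flat b (1 - y))) _ :=
  is_deriveM (is_derive_cst c x 1) e3.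
have e5 := is_deriveD e4 IH.
apply: (is_derive_eq e5).
rewrite /GRing.scale /=; ring.
Qed.

Lemma bump_chain : exists phi : nat -> R -> R, exists2 c : R, 0 < c &
  [/\ chain phi, forall m x, 1 <= `|x| -> phi m x = 0, forall x, 0 <= phi 0 x &
      forall x, `|x| <= 2^-1 -> c <= phi 0 x].
Proof.
exists (fun m => span_eval (iter m span_deriv [:: (1, 0%N, 0%N)])).
(* For [|x| <= 1/2] both [1 + x] and [1 - x] are at least [1/2], and [flat 0] is increasing. *)
exists (flat 0 2^-1 * flat 0 2^-1).
  by rewrite /flat invr_gt0 ltr0n /= !expr0 !mul1r mulr_gt0// expR_gt0.
have mono x : 2^-1 <= x -> flat 0 2^-1 <= flat 0 x.
  move=> hx; have x0 : 0 < x by apply: lt_le_trans hx; rewrite invr_gt0.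
  rewrite /flat x0 invr_gt0 ltr0n /= !expr0 !mul1r ler_expR lerN2.
  by rewrite lef_pV2 ?posrE// invr_gt0.
have E0 x : span_eval [:: (1, 0%N, 0%N)] x = flat 0 (1 + x) * flat 0 (1 - x).
  by rewrite /span_eval big_seq1 mul1r.
split => /=.
- by move=> m x; rewrite iterS; exact: is_derive_span.
- move=> m x; rewrite ler_normr => /orP[] hx; rewrite /span_eval big1// => -[[a b] c] _ /=.
    by rewrite [flat c _]flat0 ?subr_le0// !mulr0.
  by rewrite [flat b _]flat0 ?mul0r ?mulr0//; lra.
- by move=> x; rewrite E0 mulr_ge0 ?flat_ge0.
- move=> x; rewrite ler_norml => /andP[x1 x2]; rewrite E0.
  by apply: ler_pM; rewrite ?flat_ge0//; apply: mono; lra.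
Qed.

End bump.

(** * One-dimensional transforms and mollifiers *)

Section fourier1.
Context {R : realType}.
Notation lam := (@lebesgue_measure R).
Implicit Types (phi : nat -> R -> R) (F D k : R -> R[i]) (r t x : R).

Definition ft1 k t : R[i] := cI lam (fun x => expi (- (2 * pi * (x * t))) * k x).

Definition vanish {T : nmodType} (r : R) (k : R -> T) := forall x, r <= `|x| -> k x = 0.

Lemma integral_vanish (u : R -> R) r : vanish r u ->
  (\int[lam]_x (u x)%:E = \int[lam]_(x in `[(- r)%R, r]) (u x)%:E)%E.
Proof.
move=> ur; rewrite [RHS]integral_mkcond; apply: eq_integral => x _.
rewrite patchE; case: ifPn => //; rewrite notin_setE /= in_itv /= -ler_norml => /negP.
by rewrite -ltNge => /ltW/ur ->.
Qed.

Lemma integral_derivative (u du : R -> R) r : 0 < r -> vanish r u -> vanish r du ->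
  (forall x : R, is_derive x (1 : R) u (du x)) -> continuous du ->
  (\int[lam]_x du x = 0)%R.
Proof.
move=> r0 ur dur d cdu; rewrite /Rintegral (integral_vanish dur).
rewrite (@FTC2_derive R u du (- r) r)//; last by rewrite gtrN.
by rewrite !ur ?subrr// ?normrN ger0_norm// ltW.
Qed.

Lemma vanish_cint F r (K : R) : cmeas F -> (forall x, cabs (F x) <= K) -> vanish r F -> cint lam F.
Proof.
move=> mF FK Fr.
have fin : (lam `[(- r)%R, r]%classic < +oo)%E by rewrite lebesgue_measure_itv /=; case: ifP => _; rewrite ?ltry.
have i1 : cint lam (fun x => (\1_(`[- r, r]%classic) x)%:C%C).
  have mI : measurable (`[- r, r]%classic : set (measurableTypeR R)) by exact: measurable_itv.
  apply: (inL2_cint mI fin _ (inL2_indic mI fin)).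
  by move=> x nx; rewrite indicE memNset.
rewrite (_ : F = fun x => F x * (\1_(`[- r, r]%classic) x)%:C%C).
  exact: (@cint_mulb R _ (measurableTypeR R) lam F _ K mF FK i1).
apply/funext => x; rewrite indicE.
have [xr|xr] := leP r `|x|; first by rewrite Fr// mul0r.
by rewrite mem_set ?mulr1//= in_itv /= -ler_norml ltW.
Qed.

Lemma cI_derivative F D r : 0 < r -> vanish r F -> vanish r D ->
  (forall x : R, is_derive x (1 : R) (fun y => complex.Re (F y)) (complex.Re (D x))) ->
  (forall x : R, is_derive x (1 : R) (fun y => complex.Im (F y)) (complex.Im (D x))) ->
  continuous (fun x => complex.Re (D x)) -> continuous (fun x => complex.Im (D x)) ->
  cI lam D = 0.
Proof.
move=> r0 Fr Dr d1 d2 c1 c2; apply: Cext => /=.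
- by apply: (integral_derivative r0) d1 c1 => x xr; rewrite ?Fr ?Dr.
- by apply: (integral_derivative r0) d2 c2 => x xr; rewrite ?Fr ?Dr.
Qed.

Section chain.
Variables (phi : nat -> R -> R) (r : R).
Hypotheses (r0 : 0 < r) (dphi : chain phi) (vphi : forall m, vanish r (phi m)).

Lemma chain_continuous m : continuous (phi m).
Proof. exact: is_derive_continuous (dphi m). Qed.

Lemma chain_measurable m : measurable_fun setT (phi m).
Proof. by apply: continuous_measurable_fun; exact: chain_continuous. Qed.

Lemma chain_bounded m : exists2 K : R, 0 <= K & forall x, `|phi m x| <= K.
Proof.
have rr : - r <= r by rewrite (@le_trans _ _ 0)// ?oppr_le0 ltW.
have cn : {within `[- r, r], continuous (fun x => `|phi m x|)}.
  apply: continuous_subspaceT => x.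
  by apply: (@continuous_comp _ _ _ (phi m) Num.norm); [exact: chain_continuous|exact: norm_continuous].
have [c _ Hc] := EVT_max rr cn.
exists `|phi m c|%R => // x; have [xr|xr] := leP r `|x|; first by rewrite vphi// normr0.
by apply: Hc; rewrite in_itv /= -ler_norml ltW.
Qed.

Lemma chain_cmeas m : cmeas (fun x => (phi m x)%:C%C).
Proof. by apply: cmeas_real; exact: chain_measurable. Qed.

Lemma chain_cint m : cint lam (fun x => (phi m x)%:C%C).
Proof.
have [K _ HK] := chain_bounded m; apply: (vanish_cint (K := K) (r := r)).
- exact: chain_cmeas.
- by move=> x; rewrite cabs_real.
- by move=> x xr; rewrite vphi.
Qed.

Lemma cmeas_char t : cmeas (fun x : R => expi (- (2 * pi * (x * t))) : R[i]).
Proof.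
apply: cmeas_expi; apply: measurable_funN; apply: measurable_funM => //.
exact: measurable_funM.
Qed.

Lemma cint_char t k : cint lam k -> cint lam (fun x => expi (- (2 * pi * (x * t))) * k x).
Proof. by apply: cint_mulb; [exact: cmeas_char|move=> x; rewrite cabs_expi]. Qed.

(** Integration by parts: the derivative [D] of the compactly supported [F] integrates to 0. *)
Lemma ft1_deriv m t :
  ft1 (fun x => (phi m.+1 x)%:C%C) t =
  Complex 0 (2 * pi * t) * ft1 (fun x => (phi m x)%:C%C) t.
Proof.
pose E x : R[i] := expi (- (2 * pi * (x * t))).
pose F x := E x * (phi m x)%:C%C.
pose D x := E x * (phi m.+1 x)%:C%C + (- Complex 0 (2 * pi * t)) * F x.
have dl x : is_derive x (1 : R) (fun y : R => - (2 * pi * (y * t))) (- (2 * pi * t)).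
  apply: (is_derive_eq (is_deriveN (is_deriveM (is_derive_cst (2 * pi : R) x 1)
    (is_deriveM (is_derive_id x 1) (is_derive_cst (t : R) x 1))))).
  by rewrite /GRing.scale /=; ring.
have dc x : is_derive x (1 : R) (fun y : R => cos (- (2 * pi * (y * t)))) _ :=
  is_derive1_comp (is_derive_cos _) (dl x).
have ds x : is_derive x (1 : R) (fun y : R => sin (- (2 * pi * (y * t)))) _ :=
  is_derive1_comp (is_derive_sin _) (dl x).
have cE : continuous (fun x : R => cos (- (2 * pi * (x * t)))).
  exact: is_derive_continuous dc.
have sE : continuous (fun x : R => sin (- (2 * pi * (x * t)))).
  exact: is_derive_continuous ds.
have D0 : cI lam D = 0.
  apply: (@cI_derivative F D r r0).
  - by move=> x xr; rewrite /F vphi// mulr0.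
  - by move=> x xr; rewrite /D /F !vphi// !mulr0 addr0.
  - move=> x; rewrite (_ : (fun y => _) = fun y => cos (- (2 * pi * (y * t))) * phi m y); last first.
      by apply/funext => y; rewrite /F ReM /= mulr0 subr0.
    apply: (is_derive_eq (is_deriveM (dc x) (dphi m x))).
    rewrite /D /F ReD !ReM ReN ImN ImM /= /GRing.scale /=; ring.
  - move=> x; rewrite (_ : (fun y => _) = fun y => sin (- (2 * pi * (y * t))) * phi m y); last first.
      by apply/funext => y; rewrite /F ImM /= mulr0 add0r.
    apply: (is_derive_eq (is_deriveM (ds x) (dphi m x))).
    rewrite /D /F ImD !ImM ReN ImN ReM /= /GRing.scale /=; ring.
  - have -> : (fun x => complex.Re (D x)) = fun x => cos (- (2 * pi * (x * t))) * phi m.+1 x +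
        2 * pi * t * (sin (- (2 * pi * (x * t))) * phi m x).
      apply/funext => x; rewrite /D /F ReD !ReM ReN ImN ImM /=; ring.
    move=> x; apply: cvgD; first by apply: cvgM; [exact: cE|exact: chain_continuous].
    by apply: cvgM; [exact: cvg_cst|apply: cvgM; [exact: sE|exact: chain_continuous]].
  - have -> : (fun x => complex.Im (D x)) = fun x => sin (- (2 * pi * (x * t))) * phi m.+1 x -
        2 * pi * t * (cos (- (2 * pi * (x * t))) * phi m x).
      apply/funext => x; rewrite /D /F ImD !ImM ReN ImN ReM /=; ring.
    move=> x; apply: cvgB; first by apply: cvgM; [exact: sE|exact: chain_continuous].
    by apply: cvgM; [exact: cvg_cst|apply: cvgM; [exact: cE|exact: chain_continuous]].
have i1 := cint_char t (chain_cint m.+1); have i0 := cint_char t (chain_cint m).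
move: D0; rewrite /D cID//; last exact: cintZ.
by rewrite cIZ// mulNr => /eqP; rewrite subr_eq0 => /eqP.
Qed.

Lemma ft1_bounded m : exists2 K : R, 0 <= K &
  forall t, cabs (ft1 (fun x => (phi m x)%:C%C) t) <= K.
Proof.
have ci := chain_cint m; have [mc oo] := ci.
have J0 : (0 <= \int[lam]_x (cabs (phi m x)%:C%C)%:E)%E.
  by apply: integral_ge0 => x _; rewrite lee_fin cabs_ge0.
exists (fine (\int[lam]_x (cabs (phi m x)%:C%C)%:E)%E); first exact: fine_ge0.
move=> t; rewrite -lee_fin fineK ?ge0_fin_numE// (le_trans (cabs_cI (cint_char t ci)))//.
by rewrite le_eqVlt; apply/orP; left; apply/eqP; apply: eq_integral => x _; rewrite cabsM cabs_expi mul1r.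
Qed.

(** Three derivatives are spent: two powers of [|t|] give the quadratic decay of the window, and the
    third provides its small constant far out. *)
Lemma ft1_decay : exists2 K : R, 0 < K &
  forall t, `|t| ^+ 3 * cabs (ft1 (fun x => (phi 0 x)%:C%C) t) <= K.
Proof.
have [K K0 HK] := ft1_bounded 3.
have p0 : 0 < 2 * pi :> R by rewrite mulr_gt0// pi_gt0.
exists (K / (2 * pi) ^+ 3 + 1); first by rewrite ltr_wpDl// divr_ge0// exprn_ge0// ltW.
move=> t; have := HK t; rewrite !ft1_deriv !cabsM.
have -> : cabs (Complex 0 (2 * pi * t)) = 2 * pi * `|t|.
  by rewrite /cabs /= expr0n add0r sqrtr_sqr normrM gtr0_norm.
set z := cabs (ft1 _ t) => h.
rewrite (@le_trans _ _ (K / (2 * pi) ^+ 3)) ?lerDl// ler_pdivlMr ?exprn_gt0//.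
apply: le_trans h; rewrite le_eqVlt; apply/orP; left; apply/eqP; ring.
Qed.

End chain.

Lemma chain_dilate (phi : nat -> R -> R) (c s r : R) : 0 < s -> chain phi ->
  (forall m, vanish r (phi m)) ->
  chain (fun m x => c * (s^-1 ^+ m * phi m (s^-1 * x))) /\
  forall m, vanish (s * r) (fun x => c * (s^-1 ^+ m * phi m (s^-1 * x))).
Proof.
move=> s0 d v; split.
  move=> m x.
  have h := @is_derive_comp_lin R (phi m) (phi m.+1) s^-1 x (d m).
  have h2 : is_derive x (1 : R) (fun y => s^-1 ^+ m * phi m (s^-1 * y)) _ :=
    is_deriveM (is_derive_cst (s^-1 ^+ m : R) x 1) h.
  apply: (is_derive_eq (is_deriveM (is_derive_cst (c : R) x 1) h2)).
  rewrite /GRing.scale /= exprS; ring.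
move=> m x xr; rewrite v ?mulr0// normrM gtr0_norm ?invr_gt0//.
by rewrite ler_pdivlMl// mulrC.
Qed.

Lemma mollifier (s : R) : 0 < s -> exists phi : nat -> R -> R,
  [/\ chain phi, forall m, vanish s (phi m), forall x, 0 <= phi 0 x & (\int[lam]_x phi 0 x = 1)%R].
Proof.
move=> s0; have [phi [c c0 [d v p0 pc]]] := @bump_chain R.
have [d1 v1] := chain_dilate 1 s0 d v.
pose psi m x := 1 * (s^-1 ^+ m * phi m (s^-1 * x)).
have v1' m : vanish s (psi m) by have := v1 m; rewrite mulr1.
have psi0 x : 0 <= psi 0 x by rewrite /psi expr0 !mul1r.
have mpsi : measurable_fun setT (psi 0 : measurableTypeR R -> R) by exact: (chain_measurable d1).
have ci := chain_cint s0 d1 v1' 0.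
pose I := (\int[lam]_x psi 0 x)%R.
have fin : ((\int[lam]_x (psi 0 x)%:E) \is a fin_num)%E.
  by have := integrable_fin_num _ (cint_Re ci); apply.
have I0 : 0 < I.
  have mI : measurable (`[- (s / 2), s / 2]%classic : set (measurableTypeR R)) by exact: measurable_itv.
  rewrite -lte_fin /I /Rintegral fineK//.
  (* The interval [|x| <= s / 2] alone contributes at least [c * s]. *)
  apply: (@lt_le_trans _ _ (\int[lam]_x (c * \1_(`[- (s / 2), s / 2]%classic) x)%:E)%E).
    under eq_integral do rewrite EFinM.
    rewrite ge0_integralZl//; last 2 first.
    - by apply/measurable_EFinP; exact: measurable_indic.
    - by rewrite lee_fin ltW.
    have lI : lam `[(- (s / 2))%R, (s / 2)%R]%classic = s%:E.
      by rewrite lebesgue_measure_itv /= lte_fin gtrN ?divr_gt0// -EFinD opprK -splitr.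
    have -> : (\int[lam]_x (\1_(`[- (s / 2), s / 2]%classic) x)%:E = s%:E)%E.
      by rewrite integral_indic// setIT; exact: lI.
    by rewrite -EFinM lte_fin mulr_gt0.
  apply: ge0_le_integral => //.
  - by move=> x _; rewrite lee_fin mulr_ge0// ltW.
  - by apply/measurable_EFinP; apply: measurable_funM => //; exact: measurable_indic.
  - exact/measurable_EFinP.
  - move=> x _; rewrite lee_fin indicE; case: (boolP (x \in _)) => [|_]; last by rewrite mulr0.
    rewrite inE /= in_itv /= -ler_norml mulr1 /psi expr0 !mul1r => hx; apply: pc.
    by rewrite normrM gtr0_norm ?invr_gt0// ler_pdivrMl// mulrC.
have [d2 v2] := chain_dilate I^-1 s0 d v.
exists (fun m x => I^-1 * (s^-1 ^+ m * phi m (s^-1 * x))); split=> //.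
- by move=> m; have := v2 m; rewrite mulr1.
- by move=> x; rewrite mulr_ge0// ?invr_ge0 ?(ltW I0)//; have := psi0 x; rewrite /psi mul1r.
- under eq_Rintegral do rewrite -[_ * phi _ _]mul1r -/(psi 0 _).
  rewrite RintegralZl//; first by rewrite mulVf// gt_eqF.
  exact: (cint_Re ci).
Qed.

Section mollifier_transform.
Variables (phi : nat -> R -> R) (s : R).
Hypotheses (s0 : 0 < s) (dphi : chain phi) (vphi : forall m, vanish s (phi m)).
Hypotheses (phi0 : forall x, 0 <= phi 0 x) (phi1 : (\int[lam]_x phi 0 x = 1)%R).
Let k x : R[i] := (phi 0 x)%:C%C.
Let ki : cint lam k. Proof. exact: chain_cint s0 dphi vphi 0. Qed.

Let int1 : (\int[lam]_x (phi 0 x)%:E = 1)%E.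
Proof.
have := integrable_fin_num measurableT (cint_Re ki) => fin.
by rewrite -(@fineK _ (\int[lam]_x (phi 0 x)%:E)%E)//; congr EFin; exact: phi1.
Qed.

Lemma ft1_le1 t : cabs (ft1 k t) <= 1.
Proof.
rewrite -lee_fin (le_trans (cabs_cI (cint_char t ki)))// -int1 le_eqVlt; apply/orP; left; apply/eqP.
by apply: eq_integral => x _; rewrite cabsM cabs_expi mul1r cabs_real ger0_norm.
Qed.

(** The unit mass sits in [|x| <= s], where the character differs from 1 by at most [2 pi s |t|]. *)
Lemma ft1_near1 t : cabs (ft1 k t - 1) <= 2 * pi * s * `|t|.
Proof.
have p0 : 0 < pi :> R := pi_gt0 R.
have -> : ft1 k t - 1 = cI lam (fun x => (expi (- (2 * pi * (x * t))) - 1) * k x).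
  have E1 : cI lam k = 1 by rewrite /k cI_real phi1.
  rewrite -{1}E1 -mulN1r -cIZ// -cID//; [|exact: cint_char|exact: cintZ].
  by apply: cI_ext => x; rewrite [RHS]mulrDl.
have i1 : cint lam (fun x => (expi (- (2 * pi * (x * t))) - 1) * k x).
  apply: (@cint_ext _ _ _ lam (fun x => expi (- (2 * pi * (x * t))) * k x + (-1) * k x)).
    by move=> x; rewrite [RHS]mulrDl.
  by apply: cintD; [exact: cint_char|exact: cintZ].
have C0 : 0 <= 2 * pi * s * `|t| by rewrite !mulr_ge0// ltW.
have mp : measurable_fun setT (phi 0 : measurableTypeR R -> R) by exact: chain_measurable dphi 0.
rewrite -lee_fin (le_trans (cabs_cI i1))// -[leRHS]mule1 -int1 -ge0_integralZl//.
- apply: ge0_le_integral => //.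
  + by move=> x _; rewrite lee_fin cabs_ge0.
  + by apply/measurable_EFinP; apply: measurable_cabs; exact: i1.1.
  + by apply: emeasurable_funM => //; exact/measurable_EFinP.
  + move=> x _; rewrite -EFinM lee_fin cabsM /k cabs_real (ger0_norm (phi0 x)).
    have [xs|xs] := leP s `|x|; first by rewrite vphi// !mulr0.
    rewrite ler_wpM2r// (le_trans (cabs_expi_sub1 _))// normrN !normrM.
    rewrite (gtr0_norm p0) normr_nat !mulrA ler_wpM2r// ler_wpM2l ?(ltW xs)//.
    by rewrite mulr_ge0// ltW.
- exact/measurable_EFinP.
- by move=> x _; rewrite lee_fin.
Qed.

End mollifier_transform.

End fourier1.

(** * The one-dimensional kernel *)

Section kernel1.
Context {R : realType}.
Notation lam := (@lebesgue_measure R).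

Lemma ft1_shift (k : R -> R[i]) (b t : R) : cint lam k ->
  cint lam (fun x => k (x + b)) /\
  ft1 (fun x => k (x + b)) t = expi (2 * pi * (b * t)) * ft1 k t.
Proof.
move=> ki.
have mphi : measurable_fun setT (fun x : measurableTypeR R => x + b : measurableTypeR R).
  have := @measurable_affine R 1 b; rewrite (_ : (fun t => _) = fun x => x + b)//.
  by apply/funext => x; rewrite mul1r.
have Hc : forall h : measurableTypeR R -> \bar R, measurable_fun setT h -> (forall y, 0 <= h y)%E ->
    (\int[lam]_y h y = 1%:E * \int[lam]_x h (x + b)%R)%E.
  move=> h mh h0; rewrite (@ge0_integral_affine R 1 b (oner_neq0 R) h mh h0) normr1.
  by congr (_ * _)%E; apply: eq_integral => x _; rewrite mul1r.
split; first exact: (cint_cov mphi ltr01 Hc ki).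
pose F y := expi (2 * pi * (b * t)) * (expi (- (2 * pi * (y * t))) * k y).
have Fi : cint lam F by apply: cintZ; exact: cint_char.
rewrite /ft1 -cIZ; last exact: cint_char.
rewrite -/(cI lam F) (cI_cov mphi ltr01 Hc Fi) mul1r; apply: cI_ext => x.
rewrite /F [RHS]mulrA -expiD; congr (expi _ * _); ring.
Qed.

Lemma ft1_sum (s : seq (int * R[i])) (k : int * R[i] -> R -> R[i]) t :
  (forall q, cint lam (k q)) ->
  ft1 (fun x => \sum_(q <- s) q.2 * k q x) t = \sum_(q <- s) q.2 * ft1 (k q) t.
Proof.
move=> ki; rewrite /ft1.
rewrite (_ : (fun x => _) = fun x => \sum_(q <- s) q.2 * (expi (- (2 * pi * (x * t))) * k q x)); last first.
  by apply/funext => x; rewrite big_distrr; apply: eq_bigr => q _; rewrite /= mulrCA.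
rewrite cI_sum; last by move=> q; apply: cintZ; exact: cint_char.
by apply: eq_bigr => q _; rewrite cIZ//; exact: cint_char.
Qed.

Definition cchain (k : nat -> R -> R[i]) :=
  chain (fun m x => complex.Re (k m x)) /\ chain (fun m x => complex.Im (k m x)).

Lemma chain_sum (I : Type) (s : seq I) (f : I -> nat -> R -> R) :
  (forall i, chain (f i)) -> chain (fun m x => \sum_(i <- s) f i m x).
Proof.
move=> d m x; elim: s => [|i s IH].
  rewrite big_nil (_ : (fun x => _) = cst 0); first exact: is_derive_cst.
  by apply/funext => y; rewrite big_nil.
rewrite big_cons (_ : (fun x => _) = fun x => f i m x + \sum_(j <- s) f j m x); last first.
  by apply/funext => y; rewrite big_cons.
exact: (is_deriveD (d i m x) IH).
Qed.

Lemma chain_scale_shift (phi : nat -> R -> R) (c b : R) : chain phi ->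
  chain (fun m x => c * phi m (x + b)).
Proof.
move=> d m x.
have d1 : is_derive x (1 : R) (fun y : R => y + b) 1.
  by apply: (is_derive_eq (is_deriveD (is_derive_id x 1) (is_derive_cst (b : R) x 1))); rewrite addr0.
have d2 : is_derive x (1 : R) (fun y => phi m (y + b)) _ := 
  @is_derive1_comp R (phi m) (fun y => y + b) x _ _ (d m (x + b)) d1.
apply: (is_derive_eq (is_deriveM (is_derive_cst (c : R) x 1) d2)).
by rewrite /GRing.scale /= mulr0 addr0 mulr1.
Qed.

Lemma expr_small (q e : R) : 0 <= q < 1 -> 0 < e -> exists N, forall n, (N <= n)%N -> q ^+ n <= e.
Proof.
move=> q01 e0; have /cvgrPdist_le/(_ e e0) := @cvg_geom0 R q q01.
case=> N _ HN; exists N => n Nn; have := HN n Nn.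
by rewrite sub0r normrN; exact: le_trans (ler_norm _).
Qed.

(* The transform is [tau (t / M)] times that of a bump. As [tau] is 1-periodic, it is small
   only up to [|t| = M - 1/2]; beyond [M / 2] the decay of the second factor takes over. *)
Lemma kernel1 (dl sg th : R) : 0 < dl < 1 -> 0 < sg -> 0 < th < 1 ->
  exists r : R, exists2 k : nat -> R -> R[i], 0 < r /\ cchain k & 
  [/\ forall m, vanish r (k m), forall t, cabs (ft1 (k 0%N) t) <= 1,
      forall t, `|t| <= (1 - th) / 2 -> 1 - dl <= cabs (ft1 (k 0%N) t) &
      forall t, 2^-1 <= `|t| -> cabs (ft1 (k 0%N) t) <= sg / t ^+ 2].
Proof.
move=> /andP[dl0 dl1] sg0 /andP[th0 th1].
have p0 : 0 < pi :> R := pi_gt0 R.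
(* Makes [2 pi s = dl / 2], so that the transform of the bump stays within [dl / 2] of 1 for
   [|t| <= 1]. *)
pose s : R := dl / 2 / (2 * pi).
have s0 : 0 < s by rewrite !divr_gt0// mulr_gt0.
have [phi [dphi vphi phi0 phi1]] := mollifier s0.
pose k0 x : R[i] := (phi 0%N x)%:C%C.
have k0i : cint lam k0 := chain_cint s0 dphi vphi 0.
have [K K0 HK] := ft1_decay s0 dphi vphi.
(* [M >= 2 K / sg] makes cubic decay stronger than [sg / t ^+ 2] once [|t| >= M / 2]; [M >= 2] keeps
   [v1] at most [1/4]. *)
pose M : R := (Num.trunc (2 * K / sg)).+2%:R.
have M2 : 2 <= M by rewrite ler_nat.
have M0 : 0 < M by apply: lt_le_trans M2.
have MK : 2 * K / sg <= M.
  by apply/ltW/(lt_le_trans (truncnS_gt _)); rewrite ler_nat.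
(* In the variable [t] the switch is at [(1 - th / 2) / 2], midway between [(1 - th) / 2] and [1/2];
   [v0] and [v1] are these two edges divided by [M]. *)
pose a := (1 - th / 2) / (2 * M).
have M20 : 0 < 2 * M by rewrite mulr_gt0.
have a0 : 0 < a by rewrite divr_gt0//; lra.
pose v0 := (1 - th) / (2 * M); pose v1 := 1 / (2 * M).
have va : v0 < a by rewrite ltr_pM2r ?invr_gt0//; lra.
have av : a < v1 by rewrite ltr_pM2r ?invr_gt0//; lra.
have v4 : v1 <= 1 / 4 by rewrite /v1 !div1r lef_pV2 ?posrE//; lra.
have a01 : 0 < a < 1 by apply/andP; split; lra.
have sa0 : 0 < sin (pi * a) by exact: sin_pi_gt0.
have v00 : 0 < v0 by rewrite divr_gt0//; lra.
have sv0 : 0 < sin (pi * v0) by apply: sin_pi_gt0; apply/andP; split; lra.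
have sv1 : 0 < sin (pi * v1) by apply: sin_pi_gt0; apply/andP; split; lra.
pose q1 := (sin (pi * v0) / sin (pi * a)) ^+ 2.
pose q2 := (sin (pi * v1) / sin (pi * a)) ^+ 2.
have q1E : q1 * sin (pi * a) ^+ 2 = sin (pi * v0) ^+ 2.
  by rewrite -exprMn divfK// gt_eqF.
have q2E : q2 * sin (pi * a) ^+ 2 = sin (pi * v1) ^+ 2.
  by rewrite -exprMn divfK// gt_eqF.
have q11 : 0 <= q1 < 1.
  rewrite sqr_ge0 /= exprn_ilt1//; first by rewrite divr_ge0 ?(ltW sa0)// ltW.
  by rewrite ltr_pdivrMr// mul1r; apply: sin_pi_lt; lra.
have q21 : 1 < q2.
  by rewrite exprn_egt1// ltr_pdivlMr// mul1r; apply: sin_pi_lt; lra.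
have q20 : 0 < q2 := lt_trans ltr01 q21.
have q2i : 0 <= q2^-1 < 1 by rewrite invr_ge0 (ltW q20) /= invf_lt1.
have dl20 : 0 < dl / 2 by rewrite divr_gt0.
(* [4 * sg / M ^+ 2] is the least value of [sg / t ^+ 2] on [0 < |t| <= M / 2]. *)
have e20 : 0 < 4 * sg / M ^+ 2 by rewrite divr_gt0 ?mulr_gt0// exprn_gt0.
have [N1 HN1] := expr_small q11 dl20.
have [N2 HN2] := expr_small q2i e20.
pose n := maxn N1 N2.
pose tau t := stepp a n t.
have tau01 t : 0 <= tau t <= 1 := stepp01 a n t.
have [sq Hsq] := trig_stepp a n 0.
(* Moving the bump by [- q.1 / M] multiplies its transform by the character of frequency [q.1 / M],
   so this finite sum of translates realises the factor [tau (t / M)]. *)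
pose k m x : R[i] := \sum_(q <- sq) q.2 * (phi m (x + q.1%:~R / M))%:C%C.
have ftk t : ft1 (k 0%N) t = (tau (t / M))%:C%C * ft1 k0 t.
  rewrite /k (ft1_sum sq (k := fun q x => k0 (x + q.1%:~R / M))); last first.
    by move=> q; have [] := @ft1_shift k0 (q.1%:~R / M) 0 k0i.
  have -> : (tau (t / M))%:C%C = \sum_(q <- sq) q.2 * expi (2 * pi * (q.1%:~R * (t / M))).
    by rewrite -Hsq subr0.
  rewrite mulr_suml.
  apply: eq_bigr => q _; have [_ ->] := @ft1_shift k0 (q.1%:~R / M) t k0i.
  rewrite mulrA; congr (_ * expi _ * _); ring.
have ck t : cabs (ft1 (k 0%N) t) = tau (t / M) * cabs (ft1 k0 t).
  by rewrite ftk cabsM cabs_real ger0_norm//; case/andP: (tau01 (t / M)).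
have k01 t : cabs (ft1 k0 t) <= 1 by exact: ft1_le1 s0 dphi vphi phi0 phi1 t.
pose r := s + \sum_(q <- sq) `|q.1%:~R / M| + 1.
have S0 : 0 <= \sum_(q <- sq) `|q.1%:~R / M| by exact: sumr_ge0.
exists r, k.
  split; first by rewrite /r; lra.
  have kE (F : R[i] -> R) (FD : {morph F : x y / x + y}) (F0 : F 0 = 0)
      (FZ : forall z (y : R), F (z * y%:C%C) = F z * y) m x :
      F (k m x) = \sum_(q <- sq) F q.2 * phi m (x + q.1%:~R / M).
    by rewrite /k (big_morph F FD F0); apply: eq_bigr => q _; rewrite FZ.
  have FZ1 z (y : R) : complex.Re (z * y%:C%C) = complex.Re z * y by rewrite mulrC ReZ mulrC.
  have FZ2 z (y : R) : complex.Im (z * y%:C%C) = complex.Im z * y by rewrite mulrC ImZ mulrC.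
  split.
  - rewrite (_ : (fun m x => _) = fun m x => \sum_(q <- sq) complex.Re q.2 * phi m (x + q.1%:~R / M)).
      by apply: chain_sum => q; exact: chain_scale_shift.
    by apply/funext => m; apply/funext => x; apply: kE => //; exact: ReD.
  - rewrite (_ : (fun m x => _) = fun m x => \sum_(q <- sq) complex.Im q.2 * phi m (x + q.1%:~R / M)).
      by apply: chain_sum => q; exact: chain_scale_shift.
    by apply/funext => m; apply/funext => x; apply: kE => //; exact: ImD.
have q1n : q1 ^+ n <= dl / 2 by apply: HN1; rewrite leq_maxl.
have q2n : q2^-1 ^+ n <= 4 * sg / M ^+ 2 by apply: HN2; rewrite leq_maxr.
split.
- move=> m x xr; rewrite /k big1_seq// => q /= qs; rewrite vphi ?mulr0//.
  have : `|q.1%:~R / M| <= \sum_(q <- sq) `|q.1%:~R / M|.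
    rewrite (big_rem q)//= lerDl; exact: sumr_ge0.
  have := lerB_normD x (q.1%:~R / M); move: xr; rewrite /r; lra.
- move=> t; rewrite ck mulr_ile1 ?cabs_ge0//; by case/andP: (tau01 (t / M)).
- move=> t ht; rewrite ck.
  have tM : `|t / M| <= v0.
    rewrite normrM normfV (gtr0_norm M0) ler_pdivrMr// (le_trans ht)//.
    by rewrite /v0 le_eqVlt; apply/orP; left; apply/eqP; field; rewrite gt_eqF.
  have h1 : 1 - dl / 2 <= tau (t / M).
    apply: (@le_trans _ _ (1 - q1 ^+ n)); first by rewrite lerD2l lerN2.
    apply: stepp_ge => //; rewrite q1E sin_pi_norm.
    have t0 := normr_ge0 (t / M).
    have sle : sin (pi * `|t / M|) <= sin (pi * v0).
      by apply: sin_pi_le => //; move: tM (lt_trans va av) v4; clear; lra.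
    have sge : 0 <= sin (pi * `|t / M|).
      have [->|tn] := eqVneq `|t / M| 0; first by rewrite mulr0 sin0.
      apply/ltW/sin_pi_gt0; rewrite lt_neqAle eq_sym tn t0 /=.
      by move: tM (lt_trans va av) v4; clear; lra.
    by rewrite ler_pXn2r ?nnegrE// ltW.
  have h2 : 1 - dl / 2 <= cabs (ft1 k0 t).
    have h3 : cabs (ft1 k0 t - 1) <= dl / 2.
      apply: (le_trans (ft1_near1 s0 dphi vphi phi0 phi1 t)).
      have -> : 2 * pi * s = dl / 2 by rewrite /s mulrC divfK// gt_eqF// mulr_gt0.
      by rewrite -[leRHS]mulr1 ler_wpM2l ?(ltW dl20)//; lra.
    have := cabsD (ft1 k0 t) (- (ft1 k0 t - 1)).
    by rewrite opprB addrC subrK cabs1 -opprB cabsN; move: h3; clear; lra.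
  by move: h1 h2 dl0 dl1; clear; nra.
- move=> t ht; rewrite ck.
  have t0 : 0 < `|t| by lra.
  have t20 : 0 < t ^+ 2 by rewrite -real_normK ?num_real// exprn_gt0.
  have [/andP[tau0 tau1]] := tau01 (t / M).
  have [tM|tM] := leP `|t| (M / 2).
    rewrite -[leRHS]mulr1; apply: ler_pM; rewrite ?cabs_ge0//.
    apply: (@le_trans _ _ (q2^-1 ^+ n)).
      apply: stepp_le => //; rewrite q2E (sin_pi_norm (t / M)).
      have h1 : v1 <= `|t / M|.
        rewrite normrM normfV (gtr0_norm M0) ler_pdivlMr//.
        suff -> : v1 * M = 2^-1 by [].
        by rewrite /v1; field; rewrite gt_eqF.
      have h2 : `|t / M| <= 1 / 2.
        by rewrite normrM normfV (gtr0_norm M0) ler_pdivrMr//; move: tM; clear; lra.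
      have v10 : 0 <= v1 := ltW (lt_trans a0 av).
      rewrite ler_pXn2r ?nnegrE ?(ltW sv1)//.
        by apply: sin_pi_le => //; move: h2 v4; clear; lra.
      by apply/ltW/sin_pi_gt0; move: h1 h2 (lt_trans a0 av); clear; lra.
    apply: (le_trans q2n); rewrite ler_pdivrMr ?exprn_gt0// mulrAC ler_pdivlMr//.
    rewrite -(real_normK (num_real t)).
    have sqM : 4 * `|t| ^+ 2 <= M ^+ 2 by move: t0 tM; clear; nra.
    by have := ler_wpM2l (ltW sg0) sqM; clear; lra.
  rewrite -[leRHS]mul1r; apply: ler_pM; rewrite ?cabs_ge0//.
  rewrite ler_pdivlMr// -(ler_pM2l t0) (le_trans _ (_ : K <= _))//.
    apply: le_trans (HK t); rewrite -/k0 -(real_normK (num_real t)).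
    by rewrite le_eqVlt; apply/orP; left; apply/eqP; rewrite !exprS; ring.
  move: MK; rewrite ler_pdivrMr// => MK.
  have := ler_wpM2r (ltW sg0) (ltW tM); lra.
Qed.

End kernel1.

(** * Convolution with a product kernel *)

Section fubini2.
Context {R : realType} {d1 d2 : measure_display} {T1 : measurableType d1}
  {T2 : measurableType d2}.
Variables (m1 : {sigma_finite_measure set T1 -> \bar R})
  (m2 : {sigma_finite_measure set T2 -> \bar R}).
Implicit Types f : T1 * T2 -> R[i].

Lemma measurable_Rintegral1 (u : T1 * T2 -> R) : measurable_fun setT u ->
  measurable_fun setT (fun y => \int[m1]_x u (x, y))%R.
Proof.
move=> mu; apply: (@measurable_Rintegral2 R d2 d1 T2 T1 m1 (fun p => u (p.2, p.1))).
exact: (measurableT_comp mu (measurable_fun_pair (@measurable_snd _ _ T2 T1) measurable_fst)).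
Qed.

Lemma cI_fubini2 f : cint (m1 \x m2)%E f ->
  cI (m1 \x m2)%E f = cI m2 (fun y => cI m1 (fun x => f (x, y))).
Proof.
move=> fi; apply: Cext => /=.
- rewrite /Rintegral -integral21_prod_meas1; last exact: cint_Re.
  congr fine; apply: ae_eq_integral => //.
  + exact: measurable_fubini_G (cint_Re fi).
  + apply/measurable_EFinP.
    exact: (@measurable_Rintegral1 (fun p => complex.Re (f p)) fi.1.1).
  + have := ae_integrable2 (cint_Re fi); apply: filterS => x ix _ /=.
    by rewrite fineK//; exact: integrable_fin_num.
- rewrite /Rintegral -integral21_prod_meas1; last exact: cint_Im.
  congr fine; apply: ae_eq_integral => //.
  + exact: measurable_fubini_G (cint_Im fi).
  + apply/measurable_EFinP.
    exact: (@measurable_Rintegral1 (fun p => complex.Im (f p)) fi.1.2).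
  + have := ae_integrable2 (cint_Im fi); apply: filterS => x ix _ /=.
    by rewrite fineK//; exact: integrable_fin_num.
Qed.

Lemma cint_tensor (F : T1 -> R[i]) (G : T2 -> R[i]) : cint m1 F -> cint m2 G ->
  cint (m1 \x m2)%E (fun p => F p.1 * G p.2).
Proof.
move=> [mF Foo] [mG Goo].
have mFG : cmeas (fun p : T1 * T2 => F p.1 * G p.2).
  by apply: cmeasM; [exact: (cmeas_comp measurable_fst mF)|exact: (cmeas_comp measurable_snd mG)].
split => //.
rewrite (@fubini_tonelli1 _ _ T1 T2 R m1 m2 (fun p => (cabs (F p.1 * G p.2)%R)%:E)) /=; last 2 first.
- by apply/measurable_EFinP; exact: measurable_cabs.
- by move=> p; rewrite lee_fin cabs_ge0.
rewrite /fubini_F.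
pose I2 := (\int[m2]_y (cabs (G y))%:E)%E.
have I20 : (0 <= I2)%E by apply: integral_ge0 => y _; rewrite lee_fin cabs_ge0.
have I2f : I2 \is a fin_num by rewrite ge0_fin_numE.
under eq_integral => x _.
  under eq_integral do rewrite /= cabsM EFinM.
  rewrite ge0_integralZl_EFin ?cabs_ge0//; last 2 first.
    by move=> y _; rewrite lee_fin cabs_ge0.
    by apply/measurable_EFinP; exact: measurable_cabs.
  rewrite -/I2 muleC.
  over.
rewrite /= -(fineK I2f) ge0_integralZl_EFin ?fine_ge0//.
- by rewrite lte_mul_pinfty ?lee_fin ?fine_ge0.
- by move=> y _; rewrite lee_fin cabs_ge0.
- by apply/measurable_EFinP; exact: measurable_cabs.
Qed.

End fubini2.

(** * Tensor products of the one-dimensional kernel *)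

Section product_kernel.
Context {R : realType}.
Notation lam := (@lebesgue_measure R).
Notation mu := (lebesgue_cV R).
Variables (k : nat -> R -> R[i]) (r : R).
Hypotheses (r0 : 0 < r) (ck : cchain k) (vk : forall m, vanish r (k m)).

Lemma cchain_cmeas m : cmeas (k m : measurableTypeR R -> R[i]).
Proof. by split; [exact: (chain_measurable ck.1 m)|exact: (chain_measurable ck.2 m)]. Qed.

Lemma cchain_bounded : exists K : nat -> R, forall m, 1 <= K m /\ forall x, cabs (k m x) <= K m.
Proof.
suff : forall m, exists K : R, 1 <= K /\ forall x, cabs (k m x) <= K by move=> /choice[K HK]; exists K.
move=> m.
have v1 m' : vanish r (fun x => complex.Re (k m' x)) by move=> x xr; rewrite vk.
have v2 m' : vanish r (fun x => complex.Im (k m' x)) by move=> x xr; rewrite vk.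
have [K1 K10 H1] := chain_bounded r0 ck.1 v1 m.
have [K2 K20 H2] := chain_bounded r0 ck.2 v2 m.
exists (1 + (K1 + K2)); split; first by rewrite lerDl addr_ge0.
move=> x; rewrite (le_trans (cabs_ReIm _))// (@le_trans _ _ (K1 + K2)) ?lerDr//.
by rewrite lerD.
Qed.

(** The mixed partial derivative, of order [c i] in the coordinate [i], of the tensor power of
    [k 0]. *)
Definition prodk n (c : 'I_n -> nat) (x : 'cV[R]_n) : R[i] := \prod_i k (c i) (x i 0).

Lemma cchain_cint m : cint lam (k m).
Proof.
have [K HK] := cchain_bounded.
exact: vanish_cint (cchain_cmeas m) (HK m).2 (@vk m).
Qed.

Lemma cmeas_coord n m (i : 'I_n) : cmeas (fun x : 'cV[R]_n => k m (x i 0)).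
Proof.
exact: (@cmeas_phi R _ _ 'cV[R]_n (measurableTypeR R) (fun x : 'cV[R]_n => x i 0)
  (@measurable_cV_coord R n i) (k m) (cchain_cmeas m)).
Qed.

Lemma cmeas_prodk n (c : 'I_n -> nat) : cmeas (prodk c).
Proof. by apply: cmeas_prod => i; exact: cmeas_coord. Qed.

Lemma prodk_bounded n (c : 'I_n -> nat) : exists2 K : R, 0 <= K & forall x, cabs (prodk c x) <= K.
Proof.
have [K HK] := cchain_bounded; exists (\prod_(i < n) K (c i)).
  by apply: prodr_ge0 => i _; exact: le_trans ler01 (HK _).1.
move=> x; rewrite /prodk cabs_prod; apply: ler_prod => i _.
by rewrite cabs_ge0 (HK _).2.
Qed.

Lemma supp_prodk n (c : 'I_n -> nat) : supp (prodk c) r.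
Proof.
move=> x nx; have [i xi] : exists i, r <= `|x i 0|.
  by apply: contra_notP nx => H i; rewrite ltNge; apply/negP => ri; apply: H; exists i.
by rewrite /prodk (bigD1 i)//= vk// mul0r.
Qed.

Lemma bounded_supp_L2 n (f : 'cV[R]_n -> R[i]) (K s : R) : cmeas f ->
  (forall x, cabs (f x) <= K) -> supp f s -> inL2 (mu n) f.
Proof.
move=> mf fK fs.
rewrite (_ : f = fun x => f x * (\1_(box s n) x)%:C%C).
  apply: (inL2_mulb mf fK); apply: inL2_indic; first exact: measurable_bx_itv.
  exact: bx_itv_finite.
apply/funext => x; rewrite indicE; have [b|nb] := pselect (box s n x).
  by rewrite mem_set ?mulr1.
by rewrite (supp_box fs nb) mul0r.
Qed.

Lemma cint_prodk n (c : 'I_n -> nat) : cint (mu n) (prodk c).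
Proof.
have [K _ HK] := prodk_bounded c.
exact: supp_cint (supp_prodk c) (bounded_supp_L2 (cmeas_prodk c) HK (supp_prodk c)).
Qed.

Lemma fourier_prodk n (c : 'I_n -> nat) (u : 'cV[R]_n) :
  fourier (prodk c) u = \prod_i ft1 (k (c i)) (u i 0).
Proof.
elim: n c u => [|n IH] c u.
  rewrite big_ord0 fourierE.
  rewrite (_ : (fun x => _) = fun=> 1).
    have d0 (v : 'cV[R]_0 -> R) : (\int[mu 0]_x v x = v 0)%R.
      rewrite /Rintegral ge0_integral_cV0//.
        rewrite (_ : (fun x => _) = cst (v 0)%:E); first exact: measurable_cst.
        by apply/funext => x; congr (v _)%:E; apply/matrixP => -[].
    by rewrite /cI !d0.
  by apply/funext => x; rewrite /prodk /dotp !big_ord0 mulr0 oppr0 expi0 mulr1.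
rewrite fourierE cI_cVS; last by apply: cint_fourier; exact: cint_prodk.
pose c' i := c (lift ord0 i); pose u' : 'cV[R]_n := \col_i u (lift ord0 i) 0.
have uE : u = vcons (u 0 0, u').
  apply/matrixP => i j; rewrite ord1; case: (unliftP ord0 i) => [i' ->|->].
    by rewrite vconsS mxE.
  by rewrite vcons0.
rewrite big_ord_recl (_ : \prod_(i < n) _ = fourier (prodk c') u'); last first.
  by rewrite IH; apply: eq_bigr => i _; rewrite mxE.
rewrite /ft1 -cIZr; last by apply: cint_char; exact: cchain_cint.
apply: cI_ext => t; rewrite fourierE -cIZ; last by apply: cint_fourier; exact: cint_prodk.
apply: cI_ext => x.
rewrite cV_consE {1}uE dotp_cons /prodk big_ord_recl vcons0 [(_, _).1]/= [(_, _).2]/=.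
rewrite mulrDr opprD expiD -!mulrA; congr (_ * _); rewrite mulrCA; congr (_ * (_ * _)).
by apply: eq_bigr => i _; rewrite vconsS.
Qed.

End product_kernel.

(** * Convolution of g with a bounded kernel, and its transform *)

Section convolution.
Context {R : realType} {n : nat}.
Notation mu := (lebesgue_cV R n).
Variables (g : 'cV[R]_n -> R[i]) (rg : R).
Hypotheses (rg0 : 0 < rg) (g2 : inL2 mu g) (gr : supp g rg).
Implicit Types (K : 'cV[R]_n -> R[i]).

Definition conv K (x : 'cV[R]_n) : R[i] := cI mu (fun y => g y * K (x - y)).

Let gi : cint mu g. Proof. exact: supp_cint gr g2. Qed.

Section kernel.
Variables (K : 'cV[R]_n -> R[i]) (B r : R).
Hypotheses (r0 : 0 < r) (mK : cmeas K) (KB : forall x, cabs (K x) <= B) (Kr : supp K r).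

Let cK : cint mu K.
Proof. exact: supp_cint Kr (bounded_supp_L2 mK KB Kr). Qed.

Lemma cmeas_reflect x : cmeas (fun y : 'cV[R]_n => K (x - y)).
Proof.
apply: (@cmeas_phi R _ _ 'cV[R]_n 'cV[R]_n (fun y : 'cV[R]_n => x - y) _ K mK).
apply: measurable_cVD; first exact: measurable_cst.
exact: measurable_cVN.
Qed.

Lemma cint_conv x : cint mu (fun y => g y * K (x - y)).
Proof.
apply: (@cint_ext _ _ _ mu (fun y => K (x - y) * g y)); first by move=> y; rewrite mulrC.
exact: cint_mulb (cmeas_reflect x) _ gi.
Qed.

(** Stated for a separate [K'], since it is applied to Taylor remainders and to differences of
    kernels. *)
Lemma cabs_conv_le (C : R) K' x : cint mu (fun y => g y * K' (x - y)) -> 0 <= C ->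
  (forall z, cabs (K' z) <= C) ->
  cabs (conv K' x) <= C * fine (\int[mu]_y (cabs (g y))%:E)%E.
Proof.
move=> ci C0 KC.
have I0 : (0 <= \int[mu]_y (cabs (g y))%:E)%E by apply: integral_ge0 => y _; rewrite lee_fin cabs_ge0.
have mg : measurable_fun setT (fun y => (cabs (g y))%:E).
  by apply/measurable_EFinP; exact: measurable_cabs g2.1.
rewrite -lee_fin EFinM fineK; last by rewrite ge0_fin_numE//; exact: gi.2.
rewrite (le_trans (cabs_cI ci))// -ge0_integralZl//; last by move=> y _; rewrite lee_fin cabs_ge0.
apply: ge0_le_integral => //.
- by move=> y _; rewrite lee_fin cabs_ge0.
- by apply/measurable_EFinP; apply: measurable_cabs; exact: ci.1.
- by apply: emeasurable_funM.
- by move=> y _; rewrite -EFinM lee_fin cabsM mulrC ler_wpM2r ?cabs_ge0.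
Qed.

Let joint : cmeas (fun p : 'cV[R]_n * 'cV[R]_n => g p.2 * K (p.1 - p.2)).
Proof.
apply: cmeasM.
  exact: (@cmeas_phi R _ _ _ _ (snd : 'cV[R]_n * 'cV[R]_n -> 'cV[R]_n) measurable_snd g g2.1).
apply: (@cmeas_phi R _ _ _ _ (fun p : 'cV[R]_n * 'cV[R]_n => p.1 - p.2) _ K mK).
by apply: measurable_cVD => //; apply: measurable_cVN.
Qed.

Lemma cmeas_conv : cmeas (conv K).
Proof. exact: (cmeas_cI2 mu joint). Qed.

Lemma supp_conv : supp (conv K) (rg + r).
Proof.
move=> x nx; rewrite /conv (_ : (fun y => _) = fun=> 0); first exact: cI0.
apply/funext => y.
have [gy|ngy] := pselect (forall i, `|y i 0| < rg); last by rewrite gr// mul0r.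
rewrite Kr ?mulr0// => Ky; apply: nx => i.
rewrite -[x](subrK y) mxE (le_lt_trans (ler_normD _ _))// addrC ltrD//.
Qed.

Lemma inL2_conv : inL2 mu (conv K).
Proof.
have B0 : 0 <= B by exact: le_trans (cabs_ge0 _) (KB 0).
apply: (bounded_supp_L2 cmeas_conv _ supp_conv) => x.
exact: cabs_conv_le (cint_conv x) B0 KB.
Qed.

Lemma fourier_conv u : fourier (conv K) u = fourier g u * fourier K u.
Proof.
pose E (x : 'cV[R]_n) : R[i] := expi (- (2 * pi * dotp x u)).
have mE : cmeas E.
  by apply: cmeas_expi; apply: measurable_funN; apply: measurable_funM => //; exact: measurable_dotp.
pose F (p : 'cV[R]_n * 'cV[R]_n) := E p.1 * (g p.2 * K (p.1 - p.2)).
have i1 : cint mu (fun x : 'cV[R]_n => (\1_(box (rg + r) n) x)%:C%C).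
  apply: (supp_cint (r := rg + r + 1)); last first.
    by apply: inL2_indic; [exact: measurable_bx_itv|exact: bx_itv_finite].
  move=> x nx; rewrite indicE memNset// => bx; apply: nx => i; have := bx i.
  by rewrite /= in_itv /= -ler_norml => /le_lt_trans; apply; rewrite ltrDl.
(* [F] vanishes unless both variables are bounded, so it is a bounded function times the integrable
   tensor of a box indicator and [g]. *)
have Fi : cint (mu \x mu)%E F.
  pose P (p : 'cV[R]_n * 'cV[R]_n) := E p.1 * K (p.1 - p.2).
  have mP : cmeas P.
    apply: cmeasM; first exact: (@cmeas_phi R _ _ _ _ (fst : 'cV[R]_n * 'cV[R]_n -> 'cV[R]_n) measurable_fst E mE).
    apply: (@cmeas_phi R _ _ _ _ (fun p : 'cV[R]_n * 'cV[R]_n => p.1 - p.2) _ K mK).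
    by apply: measurable_cVD => //; apply: measurable_cVN.
  have PB p : cabs (P p) <= B by rewrite /P cabsM cabs_expi mul1r.
  have := cint_mulb mP PB (cint_tensor i1 gi); apply: cint_ext => -[x y].
  rewrite /F /P /= indicE; have [b|nb] := pselect (box (rg + r) n x).
    by rewrite mem_set// mul1r -!mulrA (mulrC (K _)).
  rewrite memNset// mul0r mulr0.
  have [gy|ngy] := pselect (forall i, `|y i 0| < rg); last by rewrite gr// mul0r mulr0.
  rewrite Kr ?mulr0// => Ky; apply: nb => i; rewrite /= in_itv /= -ler_norml.
  by rewrite -[x](subrK y) mxE (le_trans (ler_normD _ _))// addrC lerD// ltW.
rewrite !fourierE.
transitivity (cI (mu \x mu)%E F).
  rewrite cI_fubini1//; apply: cI_ext => x.
  by rewrite /conv -cIZ//; exact: cint_conv.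
rewrite cI_fubini2// -cIZr; last exact: cint_fourier.
apply: cI_ext => y.
pose G (x : 'cV[R]_n) := E x * K (x - y).
have Hc (h : 'cV[R]_n -> \bar R) mh h0 := @shift_hyp R n y h mh h0.
have EKi : cint mu (fun x => E y * (E x * K x)) by apply: cintZ; exact: cint_fourier.
have GE x : G (x + y) = E y * (E x * K x).
  by rewrite /G /E addrK mulrA -expiD; congr (expi _ * _); rewrite dotpDl; ring.
have Gi : cint mu G.
  apply: (cint_covV ltr01 Hc).
    apply: cmeasM => //; apply: (@cmeas_phi R _ _ 'cV[R]_n 'cV[R]_n (fun x : 'cV[R]_n => x - y) _ K mK).
    exact: measurable_cVDr.
  by apply: cint_ext EKi => x; rewrite GE.
rewrite (_ : (fun x => F (x, y)) = fun x => g y * G x); last first.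
  by apply/funext => x; rewrite /F /G /= mulrCA.
rewrite cIZ// (cI_cov (@measurable_cVDr R n y) ltr01 Hc Gi) mul1r.
rewrite (cI_ext mu GE) cIZ; last exact: cint_fourier.
by rewrite mulrA (mulrC (g y)).
Qed.

End kernel.

End convolution.

(** * Smoothness of the convolution *)

Section smooth_criterion.
Context {R : realType} {n : nat}.

(** A family that names a candidate for every iterated partial derivative reduces smoothness to
    first-order statements about its members. *)
Lemma smooth_real_family (U : seq 'I_n -> 'cV[R]_n -> R) :
  (forall s, continuous (U s)) ->
  (forall s i x, is_derive x (delta_mx i 0 : 'cV[R]_n) (U s) (U (i :: s) x)) ->
  smooth_real (U [::]).
Proof.
move=> cU dU; have E s : foldr (@partial R n) (U [::]) s = U s.
  elim: s => //= i s ->; apply/funext => x.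
  by have := dU s i x; rewrite /partial => d; exact: derive_val.
move=> s; rewrite E; split; first exact: cU.
by move=> i x; have := dU s i x => d; exact: ex_derive.
Qed.

Lemma le_mx_norm (x : 'cV[R]_n) i : `|x i 0| <= `|x|.
Proof.
rewrite [leRHS]/Num.norm/= mx_normrE.
exact: (le_bigmax _ (fun ij : 'I_n * 'I_1 => `|x ij.1 ij.2|) (i, 0)).
Qed.

Lemma lipschitz_continuous (u : 'cV[R]_n -> R) (L : R) : 0 <= L ->
  (forall x y, `|u x - u y| <= L * `|x - y|) -> continuous u.
Proof.
move=> L0 H x; apply/(@cvgrPdist_le _ _ _ (nbhs x) (nbhs_filter x) u (u x)) => e e0.
have L1 : 0 < L + 1 by rewrite ltr_wpDl.
have eL : 0 < e / (L + 1) by rewrite divr_gt0.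
have := @cvgr_dist_le _ _ _ (nbhs x) (nbhs_filter x) id x (@cvg_id _ (nbhs x)) _ eL.
apply: filterS => y xy; rewrite (le_trans (H x y))//.
rewrite (@le_trans _ _ ((L + 1) * `|x - y|))//; first by rewrite ler_wpM2r// lerDl.
by rewrite -ler_pdivlMl// mulrC.
Qed.

End smooth_criterion.

Section smooth_conv.
Context {R : realType} {n : nat}.
Notation mu := (lebesgue_cV R n).
Variables (g : 'cV[R]_n -> R[i]) (rg : R).
Hypotheses (rg0 : 0 < rg) (g2 : inL2 mu g) (gr : supp g rg).
Variables (k : nat -> R -> R[i]) (r : R).
Hypotheses (r0 : 0 < r) (ck : cchain k) (vk : forall m, vanish r (k m)).

Let kb := cchain_bounded r0 ck vk.

Lemma cchain_taylor m : exists2 C : R, 0 <= C & forall t h : R,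
  cabs (k m (t + h) - k m t - h%:C%C * k m.+1 t) <= C * h ^+ 2.
Proof.
have [K HK] := kb; have K1 := (HK m.+2).1; have K2 := (HK m.+2).2.
exists (K m.+2 *+ 2); first by rewrite mulrn_wge0// (le_trans ler01).
move=> t h; rewrite (le_trans (cabs_ReIm _))// mulrnAl mulr2n.
rewrite !ReD !ReN ReZ !ImD !ImN ImZ; apply: lerD.
- by apply: (taylor2 _ _ (ck.1 m) (ck.1 m.+1)) => x; rewrite (le_trans (cabs_Re _)).
- by apply: (taylor2 _ _ (ck.2 m) (ck.2 m.+1)) => x; rewrite (le_trans (cabs_Im _)).
Qed.

Lemma cchain_lipschitz m : exists2 C : R, 0 <= C & forall a b : R,
  cabs (k m a - k m b) <= C * `|a - b|.
Proof.
have [K HK] := kb; have K1 := (HK m.+1).1; have K2 := (HK m.+1).2.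
exists (K m.+1 *+ 2); first by rewrite mulrn_wge0// (le_trans ler01).
move=> a b; rewrite (le_trans (cabs_ReIm _))// mulrnAl mulr2n !ReD !ReN !ImD !ImN.
have [c1 _] := MVT_between b (a - b) (ck.1 m).
have [c2 _] := MVT_between b (a - b) (ck.2 m).
rewrite !subrKC => -> ->; rewrite !normrM ![_ * `|a - b|]mulrC.
apply: lerD; apply: ler_wpM2l => //.
- exact: le_trans (cabs_Re _) (K2 _).
- exact: le_trans (cabs_Im _) (K2 _).
Qed.

Lemma prodkD1 (c : 'I_n -> nat) i (x : 'cV[R]_n) :
  prodk k c x = k (c i) (x i 0) * \prod_(j < n | j != i) k (c j) (x j 0).
Proof. by rewrite /prodk (bigD1 i). Qed.

Lemma prodk_taylor (c c' : 'I_n -> nat) i : c' i = (c i).+1 -> (forall j, j != i -> c' j = c j) ->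
  exists2 C : R, 0 <= C & forall (z : 'cV[R]_n) (h : R),
    cabs (prodk k c (h *: delta_mx i 0 + z) - prodk k c z - h%:C%C * prodk k c' z) <= C * h ^+ 2.
Proof.
move=> ci cj; have [C C0 HC] := cchain_taylor (c i); have [K HK] := kb.
have P0 : 0 <= \prod_(j < n | j != i) K (c j).
  by apply: prodr_ge0 => j _; exact: le_trans ler01 (HK _).1.
exists (C * \prod_(j < n | j != i) K (c j)); first by rewrite mulr_ge0.
move=> z h; rewrite !(prodkD1 _ i) ci.
rewrite (eq_bigr (fun j => k (c j) (z j 0))); last first.
  by move=> j ji; rewrite !mxE (negbTE ji) mulr0 add0r.
rewrite [X in h%:C%C * (_ * X)](eq_bigr (fun j => k (c j) (z j 0))); last first.
  by move=> j ji; rewrite cj.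
rewrite !mxE !eqxx mulr1 (addrC h) mulrA -!mulrBl cabsM mulrAC.
apply: ler_pM; rewrite ?cabs_ge0//.
by rewrite cabs_prod; apply: ler_prod => j _; rewrite cabs_ge0 (HK _).2.
Qed.

(** Telescoping: the factors are exchanged one at a time. *)
Lemma prod_lipschitz (s : seq 'I_n) (a b : 'I_n -> R[i]) (K e : R) : 1 <= K -> 0 <= e ->
  (forall i, cabs (a i) <= K) -> (forall i, cabs (b i) <= K) ->
  (forall i, cabs (a i - b i) <= e) ->
  cabs (\prod_(i <- s) a i - \prod_(i <- s) b i) <= (size s)%:R * K ^+ size s * e.
Proof.
move=> K1 e0 aK bK abe; have K0 : 0 <= K := le_trans ler01 K1.
elim: s => [|i s IH]; first by rewrite !big_nil subrr cabs0 !mul0r.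
rewrite !big_cons /=.
have -> : a i * \prod_(j <- s) a j - b i * \prod_(j <- s) b j =
  a i * (\prod_(j <- s) a j - \prod_(j <- s) b j) + (a i - b i) * \prod_(j <- s) b j by ring.
rewrite (le_trans (cabsD _ _))// !cabsM.
have hb : cabs (\prod_(j <- s) b j) <= K ^+ size s.
  elim: (s) => [|j s' IHs]; first by rewrite big_nil cabs1 expr0.
  by rewrite big_cons cabsM /= exprS; apply: ler_pM; rewrite ?cabs_ge0.
have h1 : cabs (a i) * cabs (\prod_(j <- s) a j - \prod_(j <- s) b j) <= K * ((size s)%:R * K ^+ size s * e).
  by apply: ler_pM; rewrite ?cabs_ge0.
have h2 : cabs (a i - b i) * cabs (\prod_(j <- s) b j) <= e * K ^+ size s.
  by apply: ler_pM; rewrite ?cabs_ge0.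
have h3 : e * K ^+ size s <= K * (e * K ^+ size s) by rewrite ler_peMl// mulr_ge0// exprn_ge0.
by rewrite exprS -addn1 natrD; lra.
Qed.

Lemma prodk_lipschitz (c : 'I_n -> nat) : exists2 L : R, 0 <= L &
  forall z w : 'cV[R]_n, cabs (prodk k c z - prodk k c w) <= L * `|z - w|.
Proof.
have [K HK] := kb.
have lip m : exists C : R, 0 <= C /\ forall a b : R, cabs (k m a - k m b) <= C * `|a - b|.
  by have [C C0 H] := cchain_lipschitz m; exists C.
have [C HC] := choice lip.
pose KK := 1 + \sum_(i < n) K (c i); pose CC := \sum_(i < n) C (c i).
have Kc i : 0 <= K (c i) by exact: le_trans ler01 (HK _).1.
have Cc i : 0 <= C (c i) by exact: (HC _).1.
have K1 : 1 <= KK by rewrite lerDl sumr_ge0.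
have K0 : 0 <= KK := le_trans ler01 K1.
have C0 : 0 <= CC by exact: sumr_ge0.
have KKi i : K (c i) <= KK.
  by rewrite /KK (bigD1 i)//= addrCA lerDl addr_ge0// sumr_ge0.
have CCi i : C (c i) <= CC by rewrite /CC (bigD1 i)//= lerDl sumr_ge0.
exists ((size (index_enum 'I_n))%:R * KK ^+ size (index_enum 'I_n) * CC).
  by rewrite !mulr_ge0// exprn_ge0.
move=> z w; rewrite -[leRHS]mulrA /prodk; apply: prod_lipschitz => //.
- by rewrite mulr_ge0.
- by move=> i; exact: le_trans ((HK _).2 _) (KKi i).
- by move=> i; exact: le_trans ((HK _).2 _) (KKi i).
- move=> i; rewrite (le_trans ((HC _).2 _ _))//; apply: ler_pM => //.
  by have := le_mx_norm (z - w) i; rewrite !mxE.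
Qed.

(* The iterated partial derivative of [U [::]] along [s]. *)
Let U (s : seq 'I_n) := conv g (prodk k (fun i => count_mem i s)).
Let I0 := fine (\int[mu]_y (cabs (g y))%:E)%E.
Let I00 : 0 <= I0.
Proof. by apply: fine_ge0; apply: integral_ge0 => y _; rewrite lee_fin cabs_ge0. Qed.

Let Uint c x : cint mu (fun y => g y * prodk k c (x - y)).
Proof.
have [B B0 HB] := prodk_bounded r0 ck vk c.
exact: (cint_conv g2 gr (cmeas_prodk ck c) HB).
Qed.

(** The Taylor remainder of the convolution is the convolution of [g] with the remainder [K'] of the
    kernel, whose quadratic bound is uniform. *)
Lemma conv_prodk_derive s i : exists2 C : R, 0 <= C & forall (x : 'cV[R]_n) (h : R),
  cabs (U s (h *: delta_mx i 0 + x) - U s x - h%:C%C * U (i :: s) x) <= C * h ^+ 2.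
Proof.
have [||C C0 HC] := @prodk_taylor (fun i => count_mem i s) (fun j => count_mem j (i :: s)) i.
- by rewrite /= eqxx.
- by move=> j ji; rewrite /= eq_sym (negbTE ji).
exists (C * I0); first by rewrite mulr_ge0.
move=> x h; pose K' z := prodk k (fun i => count_mem i s) (h *: delta_mx i 0 + z) -
  prodk k (fun i => count_mem i s) z - h%:C%C * prodk k (fun j => count_mem j (i :: s)) z.
have E y : g y * prodk k (fun i => count_mem i s) (h *: delta_mx i 0 + x - y) +
   ((-1) * (g y * prodk k (fun i => count_mem i s) (x - y)) +
    (- h%:C%C) * (g y * prodk k (fun j => count_mem j (i :: s)) (x - y))) = g y * K' (x - y).
  by rewrite /K' (addrA (h *: delta_mx i 0) x (- y)); ring.
have i1 := Uint (fun i => count_mem i s) (h *: delta_mx i 0 + x).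
have i2 := cintZ (-1) (Uint (fun i => count_mem i s) x).
have i3 := cintZ (- h%:C%C) (Uint (fun j => count_mem j (i :: s)) x).
have i4 := cintD i1 (cintD i2 i3).
have -> : U s (h *: delta_mx i 0 + x) - U s x - h%:C%C * U (i :: s) x = conv g K' x.
  rewrite /conv -(cI_ext mu E) cID//; last exact: cintD.
  by rewrite cID// !cIZ ?mulN1r ?mulNr ?addrA//; exact: Uint.
rewrite mulrAC; apply: (cabs_conv_le g2 gr) => //.
- exact: cint_ext E i4.
- by rewrite mulr_ge0// sqr_ge0.
- by move=> z; exact: HC.
Qed.

Lemma conv_prodk_lipschitz s : exists2 L : R, 0 <= L & forall x y : 'cV[R]_n,
  cabs (U s x - U s y) <= L * `|x - y|.
Proof.
have [L L0 HL] := prodk_lipschitz (fun i => count_mem i s).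
exists (L * I0); first by rewrite mulr_ge0.
move=> x y; pose K' z := prodk k (fun i => count_mem i s) (x - y + z) -
  prodk k (fun i => count_mem i s) z.
have E v : g v * prodk k (fun i => count_mem i s) (x - v) +
   (-1) * (g v * prodk k (fun i => count_mem i s) (y - v)) = g v * K' (y - v).
  by rewrite /K' (addrA (x - y) y (- v)) subrK mulrBr mulN1r.
have i1 := Uint (fun i => count_mem i s) x.
have i2 := cintZ (-1) (Uint (fun i => count_mem i s) y).
have -> : U s x - U s y = conv g K' y.
  rewrite /conv -(cI_ext mu E) cID// cIZ ?mulN1r//; exact: Uint.
rewrite mulrAC; apply: (cabs_conv_le g2 gr) => //.
- by apply: (cint_ext E); exact: cintD.
- by rewrite mulr_ge0.
- by move=> z; rewrite (le_trans (HL _ _))// addrK.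
Qed.

Lemma smooth_conv : smooth (U [::]).
Proof.
split.
- apply: (@smooth_real_family R n (fun s x => complex.Re (U s x))).
  + move=> s; have [L L0 HL] := conv_prodk_lipschitz s.
    apply: (lipschitz_continuous L0) => x y.
    by rewrite -ReN -ReD (le_trans (cabs_Re _)).
  + move=> s i x; have [C C0 HC] := conv_prodk_derive s i.
    apply: (is_derive_quad (C := C)) => h.
    by rewrite -ReZ -!ReN -!ReD (le_trans (cabs_Re _)).
- apply: (@smooth_real_family R n (fun s x => complex.Im (U s x))).
  + move=> s; have [L L0 HL] := conv_prodk_lipschitz s.
    apply: (lipschitz_continuous L0) => x y.
    by rewrite -ImN -ImD (le_trans (cabs_Im _)).
  + move=> s i x; have [C C0 HC] := conv_prodk_derive s i.
    apply: (is_derive_quad (C := C)) => h.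
    by rewrite -ImZ -!ImN -!ImD (le_trans (cabs_Im _)).
Qed.

End smooth_conv.

(** * Construction of psi *)

Section compactness.
Context {R : realType} {n : nat}.
Notation mu := (lebesgue_cV R n).

Lemma continuous_trmx : continuous (trmx : 'rV[R]_n -> 'cV[R]_n).
Proof.
move=> x A /nbhs_ballP[e e0 xeA]; apply/nbhs_ballP; exists e => //= y xy.
by apply: xeA; split=> // i j; rewrite !mxE; exact: (xy.2 j i).
Qed.

(** The box is the transpose of a product of segments among row vectors, which is compact by
    Tychonoff. *)
Lemma compact_box (s : R) : compact (box s n).
Proof.
have -> : box s n = trmx @` [set v : 'rV[R]_n | forall i, `[- s, s]%classic (v ord0 i)].
  apply/seteqP; split.
    by move=> x bx; exists x^T; [move=> i; rewrite mxE; exact: bx|rewrite trmxK].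
  by move=> _ [v vs <-] i; rewrite mxE; exact: vs.
apply: continuous_compact; first by apply: continuous_subspaceT; exact: continuous_trmx.
exact: (@rV_compact _ n (fun=> `[- s, s]%classic) (fun=> @segment_compact R _ _)).
Qed.

Lemma supp_compact_support (f : 'cV[R]_n -> R[i]) (s : R) : supp f s -> compact_support f.
Proof.
move=> fs; have cb := @compact_box s.
have clb : closed (box s n) by apply: compact_closed => //; exact: norm_hausdorff.
apply: (subclosed_compact _ cb); first exact: closed_closure.
rewrite ((closure_id (box s n)).1 clb); apply: closure_subset => x /= fx.
by apply: contrapT => nb; move: fx; rewrite (supp_box fs nb) eqxx.
Qed.

Lemma compact_box_subset (K : set 'cV[R]_n) : compact K -> exists2 s : R, 0 < s & K `<=` box s n.
Proof.
move=> /compact_bounded[M [_ HM]].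
exists (`|M| + 1); first by rewrite ltr_wpDl.
move=> x Kx i; have M1 : M < `|M| + 1 by rewrite (le_lt_trans (ler_norm _))// ltrDl.
have := HM _ M1 x Kx; rewrite /= in_itv /= -ler_norml; apply: le_trans; exact: le_mx_norm.
Qed.

(** Cutting [g] to a box changes it on a null set, so the transforms agree at every point; the
    covering condition involves [g] only through [fourier g] and carries over. *)
Lemma ess_compact_truncation (g : 'cV[R]_n -> R[i]) : inL2 mu g -> ess_compact_support g ->
  exists g' : 'cV[R]_n -> R[i], exists2 r : R, 0 < r &
    [/\ inL2 mu g', supp g' r & fourier g = fourier g'].
Proof.
move=> g2 [K cK gK]; have [s s0 Ks] := compact_box_subset cK.
pose g' x := (\1_(box s n) x)%:C%C * g x.
have mb : cmeas (fun x : 'cV[R]_n => (\1_(box s n) x : R)%:C%C).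
  by apply: cmeas_indic; exact: measurable_bx_itv.
have g'2 : inL2 mu g'.
  apply: (inL2_mulb (M := 1)) => // x.
  by rewrite cabs_real ger0_norm// indicE; case: (_ \in _).
exists g', (s + 1); first by rewrite addr_gt0.
split => //.
  move=> x nx; rewrite /g' indicE memNset ?mul0r// => bx.
  by apply: nx => i; have := bx i; rewrite /= in_itv /= -ler_norml => /le_lt_trans; apply; rewrite ltrDl.
apply/funext => u; rewrite !fourierE.
have mE : cmeas (fun x : 'cV[R]_n => expi (- (2 * pi * dotp x u))).
  by apply: cmeas_expi; apply: measurable_funN; apply: measurable_funM => //; exact: measurable_dotp.
apply: cI_ae; [exact: cmeasM mE g2.1|exact: cmeasM mE g'2.1|].
apply: filterS gK => x gx; congr (_ * _); rewrite /g' indicE.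
have [b|nb] := pselect (box s n x); first by rewrite mem_set// mul1r.
by rewrite memNset// mul0r gx// => /Ks.
Qed.

End compactness.

(** * Weights of the lattice cells *)

Section weights.
Context {R : realType}.

Lemma sum_uniq_le (T : eqType) (s L : seq T) (a : T -> R) : (forall i, 0 <= a i) ->
  uniq s -> {subset s <= L} -> \sum_(i <- s) a i <= \sum_(i <- L) a i.
Proof.
move=> a0; elim: s L => [|x s IH] L; first by rewrite big_nil sumr_ge0.
rewrite cons_uniq => /andP[xs us] sL.
rewrite big_cons (big_rem x (sL x (mem_head x s))) /=.
rewrite lerD2l; apply: IH => // y ys; apply: rem_mem.
  by apply: contra xs => /eqP <-.
by apply: sL; rewrite inE ys orbT.
Qed.

(* Dominates [sg / t ^+ 2] on the unit interval centered at [j != 0]; the denominator is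
   chosen to telescope. *)
Definition omega (sg : R) (j : int) : R :=
  if j == 0 then 1 else 8 * sg / (`|j|%N%:R * (`|j|%N%:R + 1)).

Lemma sum_telescope (N : nat) :
  \sum_(0 <= i < N) (i.+1%:R * (i.+1%:R + 1))^-1 = 1 - (N.+1%:R)^-1 :> R.
Proof.
elim: N => [|N IH]; first by rewrite big_geq// invr1 subrr.
rewrite big_nat_recr//= IH -[N.+2%:R]natr1.
have h : N.+1%:R != 0 :> R by rewrite pnatr_eq0.
have h2 : N.+1%:R + 1 != 0 :> R by rewrite natr1 pnatr_eq0.
by move: h h2; move: (N.+1%:R : R) => x h h2; field; rewrite h h2.
Qed.

Lemma omega_ge0 sg j : 0 < sg -> 0 < omega sg j.
Proof.
move=> sg0; rewrite /omega; case: eqP => // /eqP j0.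
have j1 : 0 < `|j|%N%:R :> R by rewrite ltr0n absz_gt0.
by rewrite divr_gt0 ?mulr_gt0// ltr_wpDr.
Qed.

(** The index 0 contributes 1, and each of the two half lines telescopes to at most [8 * sg]. *)
Lemma sum_omega sg : 0 < sg -> (\esum_(j in [set: int]) (omega sg j)%:E <= (1 + 16 * sg)%:E)%E.
Proof.
move=> sg0; apply: esum_le_seq; first by move=> j _; rewrite lee_fin ltW// omega_ge0.
move=> s us _; rewrite sumEFin lee_fin.
pose N := \max_(j <- s) `|j|%N.
pose L := (0 : int) :: [seq Posz i.+1 | i <- iota 0 N] ++ [seq Negz i | i <- iota 0 N].
apply: (@le_trans _ _ (\sum_(j <- L) omega sg j)).
  apply: sum_uniq_le => //; first by move=> j; rewrite ltW// omega_ge0.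
  move=> j js; have jN : (`|j| <= N)%N by exact: (@leq_bigmax_seq _ s xpredT (fun j : int => `|j|%N)).
  case: j js jN => [[|m]|m] _ /= jN; rewrite inE ?eqxx//= mem_cat; apply/orP.
    by left; apply: map_f; rewrite mem_iota.
  by right; apply: map_f; rewrite mem_iota.
rewrite big_cons big_cat !big_map /= {1}/omega eqxx lerD2l.
have E (f : nat -> int) : (forall i, f i != 0) -> (forall i, `|f i|%N = i.+1) ->
    \sum_(i <- iota 0 N) omega sg (f i) <= 8 * sg.
  move=> f0 fa.
  rewrite (eq_bigr (fun i => 8 * sg * (i.+1%:R * (i.+1%:R + 1))^-1)); last first.
    by move=> i _; rewrite /omega (negbTE (f0 i)) fa.
  rewrite -big_distrr /= -[X in iota 0 X]subn0 -/(index_iota 0 N) sum_telescope.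
  rewrite -[leRHS]mulr1 ler_wpM2l ?mulr_ge0 ?(ltW sg0)//.
have h1 := E (fun i => Posz i.+1) (fun=> isT) (fun=> erefl).
have h2 := E Negz (fun=> isT) (fun=> erefl).
by move: h1 h2; lra.
Qed.

Lemma sum_prod_omega n sg : 0 < sg ->
  (\esum_(m in [set: 'cV[int]_n]) (\prod_(i < n) omega sg (m i 0))%:E <= ((1 + 16 * sg) ^+ n)%:E)%E.
Proof.
move=> sg0; elim: n => [|n IH].
  rewrite (_ : [set: 'cV[int]_0] = [set 0]); last first.
    by apply/seteqP; split => // x _ /=; apply/matrixP => -[].
  by rewrite esum_set1 big_ord0.
have p0 m (v : 'cV[int]_m) : 0 <= \prod_(i < m) omega sg (v i 0).
  by apply: prodr_ge0 => i _; rewrite ltW// omega_ge0.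
rewrite esum_cV; last by move=> k; rewrite lee_fin.
apply: (@le_trans _ _ (\esum_(j in [set: int]) (((1 + 16 * sg) ^+ n)%:E * (omega sg j)%:E))%E).
  apply: le_esum => j _.
  rewrite (_ : (\esum_(k in _) _)%E = ((omega sg j)%:E * \esum_(k in [set: 'cV[int]_n])
     (\prod_(i < n) omega sg (k i 0))%:E)%E).
    by rewrite muleC; apply: lee_wpmul2r => //; rewrite lee_fin ltW// omega_ge0.
  rewrite -esumZl; [|by rewrite ltW// omega_ge0|exact: countable_Zn|by move=> v _; rewrite lee_fin].
  apply: eq_esum => v _; rewrite big_ord_recl vcons0 -EFinM; congr (_ * _)%:E.
  by apply: eq_bigr => i _; rewrite vconsS.
have e0 : 0 <= (1 + 16 * sg) ^+ n by rewrite exprn_ge0// addr_ge0// mulr_ge0// ltW.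
rewrite esumZl//; [|exact: countableP|by move=> j _; rewrite lee_fin ltW// omega_ge0].
by rewrite exprSr EFinM; apply: lee_wpmul2l; [rewrite lee_fin|exact: sum_omega].
Qed.

Lemma expr_near1 n (e : R) : 0 < e -> e <= 1 -> exists2 x : R, 0 < x & (1 + x) ^+ n <= 1 + e.
Proof.
move=> e0 e1; elim: n e e0 e1 => [|n IH] e e0 e1; first by exists 1 => //; rewrite expr0 lerDl ltW.
have e40 : 0 < e / 4 by rewrite divr_gt0.
have [|x x0 hx] := IH (e / 4) e40; first by lra.
exists (Num.min x (e / 4)); first by rewrite lt_min x0 e40.
set y := Num.min x (e / 4).
have y0 : 0 < y by rewrite lt_min x0 e40.
have yx : y <= x by rewrite /y ge_min lexx.
have ye : y <= e / 4 by rewrite /y ge_min lexx orbT.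
have h : (1 + y) ^+ n <= 1 + e / 4.
  by apply: le_trans hx; rewrite lerXn2r ?nnegrE ?addr_ge0 ?(ltW y0) ?(ltW x0)// lerD2l.
rewrite exprS (@le_trans _ _ ((1 + e / 4) * (1 + e / 4)))//.
  apply: ler_pM => //; [lra|by rewrite exprn_ge0//; lra|lra].
by move: e0 e1; clear; nra.
Qed.

(** The product weights have sum at most [1 + Dl / 2], of which the cell 0 takes 1; giving that cell
    [Dl / 2] instead leaves at most [Dl]. It keeps a positive weight because the weighted
    Cauchy-Schwarz inequality divides by [W]. *)
Lemma weights n (Dl : R) : 0 < Dl -> Dl <= 1 -> exists sg : R, exists2 W : 'cV[int]_n -> R,
  0 < sg & [/\ forall m, 0 < W m,
    (\esum_(m in [set: 'cV[int]_n]) (W m)%:E <= Dl%:E)%E &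
    forall m, m != 0 -> W m = \prod_(i < n) omega sg (m i 0)].
Proof.
move=> D0 D1; have [||x x0 hx] := @expr_near1 n (Dl / 2); [by rewrite divr_gt0|lra|].
pose sg := x / 16; have sg0 : 0 < sg by rewrite divr_gt0.
pose P (m : 'cV[int]_n) := \prod_(i < n) omega sg (m i 0).
have P0 m : 0 < P m by apply: prodr_gt0 => i _; exact: omega_ge0.
pose W m := if m == 0 then Dl / 2 else P m.
have W0 m : 0 < W m by rewrite /W; case: ifP => // _; rewrite divr_gt0.
exists sg, W => //; split => //; last by move=> m m0; rewrite /W (negbTE m0).
pose I (c : R) (m : 'cV[int]_n) := if m == 0 then c else 0.
have I0 c m : 0 <= c -> 0 <= I c m by rewrite /I; case: ifP.
have sI c : 0 <= c -> (\esum_(m in [set: 'cV[int]_n]) (I c m)%:E = c%:E)%E.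
  move=> c0; apply/eqP; rewrite eq_le; apply/andP; split.
    apply: esum_le_seq; first by move=> m _; rewrite lee_fin I0.
    move=> s us _; rewrite sumEFin lee_fin.
    have [s0|s0] := boolP (0 \in s).
      rewrite (bigD1_seq 0)//= big1 ?addr0; last by move=> m /negbTE m0; rewrite /I m0.
      by rewrite /I eqxx.
    rewrite big1_seq// => m /= ms; rewrite /I; case: eqP => // m0.
    by rewrite -m0 ms in s0.
  have := @seq_le_esum R _ [set: 'cV[int]_n] (fun m => (I c m)%:E) [:: 0] isT.
  by rewrite big_seq1 /I eqxx; apply => // m _; rewrite lee_fin (I0 c m).
have P00 : P 0 = 1 by rewrite /P big1// => i _; rewrite mxE /omega eqxx.
(* The exchange of the term at 0 is written additively, the sums being extended reals. *)
have E : (\esum_(m in [set: 'cV[int]_n]) (W m)%:E + 1%:E =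
    \esum_(m in [set: 'cV[int]_n]) (P m)%:E + (Dl / 2)%:E)%E.
  rewrite -(sI 1 ler01) -(sI (Dl / 2)); last by lra.
  rewrite -!esumD; try (by move=> m _; rewrite lee_fin ?I0 ?ltW//; lra).
    apply: eq_esum => m _; rewrite -!EFinD; congr _%:E; rewrite /W /I.
    by case: eqP => [->|_]; rewrite ?P00 ?addr0// addrC.
have := sum_prod_omega n sg0; rewrite -/P.
have -> : 1 + 16 * sg = 1 + x by rewrite /sg; congr (_ + _); field.
move=> hP.
have : (\esum_(m in [set: 'cV[int]_n]) (W m)%:E + 1%:E <= (Dl + 1)%:E)%E.
  rewrite E (@le_trans _ _ ((1 + x) ^+ n + Dl / 2)%:E)//; first by rewrite EFinD leeD.
  by rewrite lee_fin; lra.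
by rewrite EFinD leeD2rE.
Qed.

End weights.

(** * The window psi *)

Section window.
Context {R : realType}.

(** When the nearest integer [j] is not 0, [1 <= |j| <= 2 |t|], hence [|j| (|j| + 1) <= 8 t ^+ 2];
    this is the 8 in [omega]. *)
Lemma decay_omega (sg t e : R) : 0 < sg -> e <= 1 ->
  (2^-1 <= `|t| -> e <= sg / t ^+ 2) -> e <= omega sg (Num.floor (t + 2^-1)).
Proof.
move=> sg0 e1 et; rewrite /omega; case: eqVneq => // j0.
have := floor_itv (t + 2^-1); move: j0; move: (Num.floor _) => j j0 /andP[j1 j2].
rewrite rmorphD /= in j2.
have jt : 2^-1 <= `|t| /\ `|j%:~R : R| <= 2 * `|t|.
  have [jp|jn] := ltP 0 j.
    have j3 : 1 <= j%:~R :> R by rewrite ler1z.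
    have t0 : 0 <= t by lra.
    by rewrite (ger0_norm t0) ger0_norm; lra.
  have j3 : j%:~R <= -1 :> R.
    rewrite (_ : -1 = (-1)%:~R)// ler_int.
    by move: j0 jn; case: j {j1 j2} => [[|]|] //.
  have t0 : t <= 0 by lra.
  by rewrite (ler0_norm t0) ler0_norm; lra.
case: jt => t2 jt; apply: (le_trans (et t2)).
rewrite natr_absz intr_norm.
have jj : 1 <= `|j%:~R : R|.
  by rewrite -intr_norm -natr_absz ler1n absz_gt0.
move: jj jt; move: `|j%:~R : R| => y y1 yt.
have t0 : 0 < t ^+ 2 by rewrite -real_normK ?num_real// exprn_gt0//; lra.
rewrite ler_pdivlMr; last by nra.
rewrite mulrAC ler_pdivrMr// -(real_normK (num_real t)).
have yy : y * (y + 1) <= 8 * `|t| ^+ 2 by have := normr_ge0 t; move: y1 yt; clear; nra.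
by have := ler_wpM2l (ltW sg0) yy; clear; lra.
Qed.

Lemma window n (Dl theta rg : R) (g : 'cV[R]_n -> R[i]) :
  0 < Dl < 1 -> 0 < theta < 1 -> 0 < rg -> inL2 (lebesgue_cV R n) g -> supp g rg ->
  exists psi h : 'cV[R]_n -> R[i], exists W : 'cV[int]_n -> R, exists r : R,
  [/\ smooth psi, compact_support psi,
      [/\ supp g r, inL2 (lebesgue_cV R n) psi & supp psi r],
      [/\ forall u, fourier psi u = fourier g u * h u, cmeas h & forall x, cabs (h x) <= 1] &
      [/\ forall m, 0 < W m,
          (\esum_(m in [set: 'cV[int]_n]) (W m)%:E <= Dl%:E)%E,
          forall x, cell x != 0 -> cabs (h x) <= W (cell x) &
          forall x : 'cV[R]_n, (forall i, `|x i 0| <= (1 - theta) / 2) -> 1 - Dl <= cabs (h x)]].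
Proof.
move=> /andP[D0 D1] th01 rg0 g2 gr.
have [sg [W sg0 [W0 WD WE]]] := weights n D0 (ltW D1).
(* By Bernoulli [(1 - dl) ^+ n >= 1 - n * dl >= 1 - Dl]; the divisor [n.+1] is positive in dimension
   0 as well. *)
pose dl := Dl / n.+1%:R.
have n0 : 0 < n.+1%:R :> R by rewrite ltr0n.
have dl01 : 0 < dl < 1.
  rewrite divr_gt0//= ltr_pdivrMr// mul1r (lt_le_trans D1)//.
  by rewrite ler1n.
have [r [k [r0 ck] [vk k1 kin kout]]] := kernel1 dl01 sg0 th01.
pose K := prodk k (fun _ : 'I_n => 0%N).
have [B B0 KB] := prodk_bounded r0 ck vk (fun _ : 'I_n => 0%N).
have mK : cmeas K by exact: (cmeas_prodk ck (fun _ : 'I_n => 0%N)).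
have Kr : supp K r by exact: (supp_prodk vk).
have hE u : cabs (fourier K u) = \prod_i cabs (ft1 (k 0%N) (u i 0)).
  by rewrite (fourier_prodk r0 ck vk) cabs_prod.
have sp := @supp_conv R n g rg gr K r Kr.
exists (conv g K), (fourier K), W, (rg + r); split.
- exact: (smooth_conv g2 gr r0 ck vk).
- exact: supp_compact_support sp.
- split => //; first by apply: supp_le gr; rewrite lerDl ltW.
  exact: (inL2_conv g2 gr mK KB Kr).
- split; [exact: (fourier_conv g2 gr mK KB Kr)|exact: cmeas_fourier mK|].
  move=> x; rewrite hE; apply: prodr_ile1 => i _.
  by rewrite cabs_ge0 k1.
- split => //.
  (* Coordinates of index 0 use the trivial bound 1, the value of [omega] at 0; the others use the
     decay of the kernel. *)
  + move=> x cx; rewrite hE WE//; apply: ler_prod => i _; rewrite cabs_ge0 andTb mxE.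
    by apply: (decay_omega sg0 (k1 _)) => ht; exact: kout.
  + move=> x hx; rewrite hE.
    have dl0 : 0 <= 1 - dl by case/andP: dl01 => _ h; rewrite subr_ge0 ltW.
    apply: (@le_trans _ _ ((1 - dl) ^+ n)).
      have b : -1 <= - dl by rewrite lerN2; case/andP: dl01 => _ /ltW.
      apply: le_trans (bernoulli_ge n b); rewrite mulNrn lerD2l lerN2 -mulr_natr /dl.
      rewrite mulrAC ler_pdivrMr// ler_wpM2l ?(ltW D0)//.
      by rewrite ler_nat.
    rewrite -[leLHS](_ : \prod_(i < n) (1 - dl) = _); last by rewrite prodr_const card_ord.
    by apply: ler_prod => i _; rewrite dl0 kin.
Qed.

End window.

Theorem theorem1 (R : realType) (d : nat) (d_gt0 : (0 < d)%N)
    (A B theta : R) (A_gt0 : 0 < A) (B_gt0 : 0 < B)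
    (theta_gt0 : 0 < theta) (theta_lt1 : theta < 1) :
  exists2 eps0 : R, 0 < eps0 &
  forall eps : R, 0 < eps -> eps < eps0 ->
  forall g : 'cV[R]_d -> R[i], in_L2 g -> ess_compact_support g ->
  exists psi : 'cV[R]_d -> R[i],
    [/\ smooth psi, compact_support psi &
      forall Ts : set (tile R d),
        countable Ts -> (forall T, Ts T -> is_tile T) ->
        covering_condition Ts g A B theta ->
        forall f : 'cV[R]_d -> R[i], in_L2 f ->
          (((1 - eps) * A)%:E * L2norm_sqr f <= frame_sum Ts psi f)%E /\
          (frame_sum Ts psi f <= ((1 + eps) * B)%:E * L2norm_sqr f)%E].
Proof.
(* Every [eps < 1] is admissible: this keeps [(1 - eps) * A] positive, as [frame_lower] requires,
   and forces [Dl < 1]. *)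
exists 1 => // eps e0 e1 g [g1 g2 goo] gc.
have th01 : 0 < theta < 1 by rewrite theta_gt0.
have [g' [rg rg0 [g'2 g'r gE]]] := ess_compact_truncation (conj (conj g1 g2) goo) gc.
have S0 : 0 < 3 * A + 2 * B by rewrite addr_gt0// mulr_gt0.
(* Then [(1 + Dl)^2 <= 1 + eps] and
   [(1 - Dl)^2 A - (Dl^2 + Dl) B >= (1 + Dl) (1 - eps) A]. *)
pose Dl := eps * A / (3 * A + 2 * B).
have DE : Dl * (3 * A + 2 * B) = eps * A by rewrite divfK// gt_eqF.
have D0 : 0 < Dl by rewrite divr_gt0// mulr_gt0.
have D3 : 3 * Dl <= eps.
  by rewrite /Dl mulrA ler_pdivrMr//; have := mulr_gt0 e0 B_gt0; lra.
have D1 : Dl < 1 by lra.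
have D01 : 0 < Dl < 1 by rewrite D0.
have [psi [h [W [r [spsi cpsi [gr psi2 psir] [psiE mh h1] [W0 WD hW hk]]]]]] :=
  window D01 th01 rg0 g'2 g'r.
(* [psi] is fixed before [Ts] appears: the data behind it are [g], [theta], [d], and [A], [B], [eps]
   through [Dl]. *)
exists psi; split => // Ts cTs uTs cov f [f1 f2 foo].
have cov' : covering_condition Ts g' A B theta by move: cov; rewrite /covering_condition gE.
have fL2 : inL2 (lebesgue_cV R d) f by [].
split.
- apply: (frame_lower g'2 gr psi2 psir psiE mh h1 D0 (ltW D1) W0 WD hW th01 hk A_gt0 B_gt0 cTs uTs cov') => //.
    by rewrite mulr_gt0// subr_gt0.
  (* After substitution of [DE] the difference of the two sides is exactly the sum of the three
     nonnegative terms in [p3], [p4] and [p5]. *)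
  have p1 := mulr_gt0 D0 B_gt0; have p2 := mulr_gt0 D0 A_gt0.
  have p3 : 0 <= (Dl - Dl ^+ 2) * B by rewrite mulr_ge0 ?(ltW B_gt0)// expr2; nra.
  have p4 : 0 <= Dl ^+ 2 * A by rewrite mulr_ge0 ?sqr_ge0 ?(ltW A_gt0).
  have p5 : 0 <= eps * (Dl * A) by rewrite ltW// mulr_gt0.
  move: DE p1 p2 p3 p4 p5; clear; lra.
- apply: (le_trans (frame_upper g'2 gr psi2 psir psiE mh h1 D0 W0 WD hW B_gt0 cTs uTs cov' fL2)).
  apply: lee_wpmul2r; first exact: nsq_ge0.
  rewrite lee_fin ler_wpM2r ?(ltW B_gt0)//.
  by move: D0 D1 D3; clear; nra.
Qed.
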